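(* Let $a_1,\ldots,a_n\in C^\infty(\mathbb{T}^n)$ be real-valued, let $X_j=\partial_{t_j}+a_j(t)\partial_x$ for $j\in\{1,\ldots,n\}$ on $\mathbb{T}^{n+1}=\mathbb{T}^n_t\times\mathbb{T}_x$, and let $P=\sum_{j=1}^nX_j^2$. For each $j$ put $$a_{j0}(t)=\frac1{2\pi}\int_0^{2\pi}a_j(t_1,\ldots,t_{j-1},\lambda,t_{j+1},\ldots,t_n)\,d\lambda,\quad t\in\mathbb{T}^n.$$ Then $P$ is globally hypoelliptic in $\mathbb{T}^{n+1}$ if and only if there is a point $t\in\mathbb{T}^n$ of finite type for $X_1,\ldots,X_n$, or the range of $a_{j0}$ contains a real number $\alpha_j$ for each $j\in\{1,\ldots,n\}$ such that the collection $\{\alpha_1,\ldots,\alpha_n\}\subset\mathbb{R}$ is not simultaneously approximable.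
   Context: $\mathbb{T}=\mathbb{R}/2\pi\mathbb{Z}$. An operator $P$ is globally hypoelliptic in $\mathbb{T}^{N}$ if $u\in\mathcal{D}'(\mathbb{T}^N)$ and $Pu\in C^\infty(\mathbb{T}^N)$ imply $u\in C^\infty(\mathbb{T}^N)$. A point $t\in\mathbb{T}^n$ is of finite type for $X_1,\ldots,X_n$ if Hörmander's condition holds there, i.e. the Lie algebra generated by $X_1,\ldots,X_n$ under iterated commutators spans the tangent space of $\mathbb{T}^{n+1}$ at $(t,x)$ (this does not depend on $x\in\mathbb{T}$, as the coefficients depend only on $t$). A collection (indexed family) of real numbers $\{\alpha_1,\ldots,\alpha_n\}$ is not simultaneously approximable if there exist $C,\rho>0$ such that $\max_{1\le j\le n}|\eta_j+\alpha_j\xi|\ge C(1+|\xi|)^{-\rho}$ for all $\eta=(\eta_1,\ldots,\eta_n)\in\mathbb{Z}^n$ and $\xi\in\mathbb{Z}\setminus\{0\}$; otherwise it is simultaneously approximable. *)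

(* Defs.v *)
From mathcomp Require Import all_boot all_order all_algebra.
From mathcomp Require Import all_classical all_reals all_analysis.
From mathcomp Require Export complex.

Set Implicit Arguments.
Unset Strict Implicit.
Unset Printing Implicit Defensive.

Import Order.TTheory GRing.Theory Num.Theory.
Import numFieldNormedType.Exports.

Local Open Scope classical_set_scope.
Local Open Scope ring_scope.
Local Open Scope complex_scope.

(* The torus T^N = (R / 2 pi Z)^N is handled through its universal cover:
   a point of T^N is given by any representative in 'rV[R]_N, and a function
   on T^N is a function on 'rV[R]_N that is 2 pi-periodic in each coordinate. *)

Section Torus.
Variables (R : realType) (N : nat).
Implicit Types (f : 'rV[R]_N -> R) (phi : 'rV[R]_N -> R[i]).

Definition evec (k : 'I_N) : 'rV[R]_N := delta_mx 0 k.

Definition partial (k : 'I_N) f : 'rV[R]_N -> R := fun z => 'D_(evec k) f z.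

(* d_{k_1} ... d_{k_m} f for s = [:: k_1; ...; k_m] *)
Definition partials (s : seq 'I_N) f : 'rV[R]_N -> R := foldr partial f s.

Definition smooth f : Prop :=
  forall s : seq 'I_N,
    continuous (partials s f) /\
    forall (k : 'I_N) (z : 'rV[R]_N), derivable (partials s f) z (evec k).

Definition periodic (T : Type) (g : 'rV[R]_N -> T) : Prop :=
  forall (k : 'I_N) (z : 'rV[R]_N), g (z + (2 * pi) *: evec k) = g z.

Definition Cinfty f : Prop := smooth f /\ periodic f.

Definition re_part phi : 'rV[R]_N -> R := fun z => complex.Re (phi z).
Definition im_part phi : 'rV[R]_N -> R := fun z => complex.Im (phi z).

Definition CinftyC phi : Prop := Cinfty (re_part phi) /\ Cinfty (im_part phi).

Definition partialsC (s : seq 'I_N) phi : 'rV[R]_N -> R[i] :=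
  fun z => partials s (re_part phi) z +i* partials s (im_part phi) z.

Definition upd (z : 'rV[R]_N) (k : 'I_N) (x : R) : 'rV[R]_N :=
  \row_j (if j == k then x else z 0 j).

Definition int_coord (k : 'I_N) f : 'rV[R]_N -> R :=
  fun z => \int[lebesgue_measure]_(x in `[0, 2 * pi]) f (upd z k x).

Definition average (k : 'I_N) f : 'rV[R]_N -> R :=
  fun z => (2 * pi)^-1 * int_coord k f z.

(* Integral over T^N as an iterated integral; it is only used for continuous
   integrands. After integrating in all the coordinates the function is
   constant, so the evaluation point 0 is irrelevant. *)
Definition int_torus f : R := foldr int_coord f (enum 'I_N) 0.

Definition int_torusC phi : R[i] :=
  int_torus (re_part phi) +i* int_torus (im_part phi).

(* The usual norm of C^m(T^N), up to equivalence: a multi-index is represented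
   by the sequences of coordinates in which one differentiates. *)
Definition Cm_norm (m : nat) phi : R :=
  \sum_(s : {bseq m of 'I_N})
    sup [set ComplexField.Normc.normc (partialsC s phi z)
        | z in [set: 'rV[R]_N]].

(* Functionals are total on 'rV[R]_N -> R[i], but only their values on
   CinftyC are ever relevant. *)
Definition functional := ('rV[R]_N -> R[i]) -> R[i].

(* D'(T^N), the topological dual of the Frechet space C^infty(T^N). *)
Definition is_distribution (u : functional) : Prop :=
  (forall (c : R[i]) phi psi, CinftyC phi -> CinftyC psi ->
     u (fun z => c * phi z + psi z) = c * u phi + u psi) /\
  (exists (m : nat) (C : R), forall phi, CinftyC phi ->
     ComplexField.Normc.normc (u phi) <= C * Cm_norm m phi).

Definition is_smooth (u : functional) : Prop :=
  exists2 f : 'rV[R]_N -> R[i], CinftyC f &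
    forall phi, CinftyC phi -> u phi = int_torusC (fun z => f z * phi z).

Definition dist_partial (k : 'I_N) (u : functional) : functional :=
  fun phi => - u (partialsC [:: k] phi).

Definition dist_mul (g : 'rV[R]_N -> R) (u : functional) : functional :=
  fun phi => u (fun z => (g z)%:C * phi z).

Definition globally_hypoelliptic (P : functional -> functional) : Prop :=
  forall u : functional, is_distribution u -> is_smooth (P u) -> is_smooth u.

(* Vector fields on T^N, given by their components in the frame of coordinate
   derivations. *)
Definition vfield := 'rV[R]_N -> 'rV[R]_N.

Definition vf_act (V : vfield) (u : functional) : functional :=
  fun phi => \sum_(k < N) dist_mul (fun z => V z 0 k) (dist_partial k u) phi.

Definition bracket (V W : vfield) : vfield :=
  fun z => 'D_(V z) W z - 'D_(W z) V z.

Inductive lie_generated (n : nat) (X : 'I_n -> vfield) : vfield -> Prop :=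
| lie_gen j : lie_generated X (X j)
| lie_lin (c : R) V W : lie_generated X V -> lie_generated X W ->
    lie_generated X (fun z => c *: V z + W z)
| lie_bracket V W : lie_generated X V -> lie_generated X W ->
    lie_generated X (bracket V W).

Definition hormander_at (n : nat) (X : 'I_n -> vfield) (z : 'rV[R]_N) : Prop :=
  forall v : 'rV[R]_N, exists2 V, lie_generated X V & V z = v.

End Torus.

Section SumOfSquares.
Variables (R : realType) (n : nat).
Implicit Type a : 'I_n -> 'rV[R]_n -> R.

(* Points of T^(n+1) are row_mx t x%:M: the n coordinates t come first
   (lshift), the coordinate x comes last (rshift). *)
Definition Xfield a (j : 'I_n) : vfield R (n + 1) :=
  fun z => evec R (lshift 1 j) + a j (lsubmx z) *: evec R (rshift n ord0).

Definition sum_squares a (u : functional R (n + 1)) : functional R (n + 1) :=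
  fun phi => \sum_(j < n) vf_act (Xfield a j) (vf_act (Xfield a j) u) phi.

Definition finite_type a (t : 'rV[R]_n) : Prop :=
  forall x : R, hormander_at (Xfield a) (row_mx t x%:M).

Definition not_simultaneously_approximable (alpha : 'I_n -> R) : Prop :=
  exists C rho : R, [/\ 0 < C, 0 < rho &
    forall (eta : 'I_n -> int) (xi : int), xi != 0 ->
      C * (1 + `|xi%:~R|) `^ (- rho) <=
      \big[Num.max/0]_(j < n) `|(eta j)%:~R + alpha j * xi%:~R| ].

End SumOfSquares.

(* Main.v *)
(* Put c_jk = d_j a_k - d_k a_j, so that [X_j, X_k] = c_jk d_x.  If c_jk(t) is
   nonzero for some j, k, t, then t is of finite type.  Otherwise the Lie algebra
   consists of the constant combinations of the X_j, no point is of finite type,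
   and a_j = alpha_j + d_j A with A smooth on T^n; then a_j0 is the constant
   alpha_j.

   Global hypoellipticity follows from estimates
     |V|^2 <= C (1 + |m|)^p sum_j |X_j V|^2      (L^2 norms, m <> 0)
   for smooth V of frequency m in x.  Indeed, if Pu is smooth, applying the
   estimate to the m-th partial Fourier series of u bounds its coefficients by
   rapidly decreasing functions of m; that this series is smooth, with bounds
   polynomial in m, is due to the ellipticity of P in t at fixed x-frequency.
   When some c_jk is nonzero, the estimate follows from
   [X_j, X_k] V = i m c_jk V and a Poincare inequality that compares the weight
   c_jk^2 with its mean.  When all vanish, V -> e^(i m A) V turns X_j into
   d_j + alpha_j d_x, and the estimate is Bessel's inequality together with
   the Diophantine condition.

   If that condition fails there are (eta_k, xi_k), with xi_k growing
   exponentially, such that eta_k + alpha xi_k is smaller than every power of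
   1 / |xi_k|, and the sum over k of exp(i (eta_k t + xi_k (x - A(t)))) is a
   distribution that is not smooth but has a smooth image under P. *)
Require Import Defs.
From mathcomp Require Import all_boot all_order all_algebra.
From mathcomp Require Import all_classical all_reals all_analysis.
From mathcomp Require Import ring lra zify.
(* all_analysis shadows periodic. *)
Import Defs.

Set Implicit Arguments.
Unset Strict Implicit.
Unset Printing Implicit Defensive.

Import Order.TTheory GRing.Theory Num.Theory.
Import numFieldNormedType.Exports.

Local Open Scope classical_set_scope.
Local Open Scope ring_scope.
Local Open Scope complex_scope.

(** * Smooth functions *)

(** Distributions enter only through their values on the exponentials [em th]. This is enough
    because trigonometric polynomials built with a positive kernel approximate a smooth function
    together with all its derivatives, so that a sequentially continuous functional is controlled
    mode by mode. Uniqueness of Fourier coefficients and the symmetry of second derivatives are read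
    off from the same principle.

    A single point where c_jk is nonzero suffices because X_j acts as d_j on functions of t: a bound
    on the energy keeps |V|^2 from avoiding, in t, a neighbourhood of that point, while the
    commutator bounds V there.

    The loss (1 + |m|)^p is harmless: Pu being smooth, p more integrations by parts in x repay it.

    The estimates say nothing about decay in the t-frequency. That decay, at the price of powers of
    m, and the decay in m are proved separately and then interpolated. *)

Section Derivative.
Variables (R : realType) (V W : normedModType R).

(** Multiplying the difference quotient out removes the punctured neighbourhood, so that derivatives
    can be established by norm inequalities alone. *)
Lemma is_deriveP (f : V -> W) (z v : V) (d : W) :
  is_derive z v f d <->
  forall e : R, 0 < e -> exists2 r : R, 0 < r & forall h : R, `|h| < r ->
    `|f (h *: v + z) - f z - h *: d| <= e * `|h|.
Proof.
split.
  case=> dr dv e e0.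
  have : (fun h : R => h^-1 *: ((f \o shift z) (h *: v) - f z)) @ 0^' --> d.
    by rewrite -dv; exact: dr.
  move/cvgrPdist_le => /(_ e e0) /=.
  rewrite near_withinE => /nbhs_ballP[r /= r0 hr].
  exists r => // h hlt.
  have [->|h0] := eqVneq h 0.
    by rewrite !scale0r add0r subrr subr0 normr0 normr0 mulr0.
  have hb : ball (0 : R) r h by rewrite /ball /= sub0r normrN.
  move: (hr h hb h0); rewrite /= => H.
  rewrite mulrC -ler_pdivrMl ?normr_gt0 //.
  rewrite -normfV -normrZ scalerBr scalerA mulVf // scale1r distrC.
  exact: H.
move=> H.
have C : (fun h : R => h^-1 *: ((f \o shift z) (h *: v) - f z)) @ 0^' --> d.
  apply/cvgrPdist_le => e e0 /=.
  have [r r0 hr] := H e e0.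
  rewrite near_withinE; apply/nbhs_ballP; exists r => //= h.
  rewrite /ball /= sub0r normrN => hlt h0.
  have := hr h hlt.
  rewrite mulrC -ler_pdivrMl ?normr_gt0 //.
  by rewrite -normfV -normrZ scalerBr scalerA mulVf // scale1r distrC.
apply: DeriveDef; first by apply/cvg_ex; exists d.
exact: (cvg_lim (@norm_hausdorff _ _) C).
Qed.

End Derivative.

Section Line.
Variables (R : realType) (V W : normedModType R).

Lemma is_derive_line (f : V -> W) (z v : V) (h0 : R) :
  derivable f (h0 *: v + z) v ->
  is_derive h0 (1 : R) (fun h : R => f (h *: v + z)) ('D_v f (h0 *: v + z)).
Proof.
move=> /derivableP/is_deriveP H; apply/is_deriveP => e /H[r r0 hr].
exists r => // h /hr; rewrite addrA -scalerDl /GRing.scale /= mulr1.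
by rewrite addrC.
Qed.

End Line.

Section Smooth.
Variables (R : realType) (N : nat).
Implicit Types (f g : 'rV[R]_N -> R).

Lemma is_derive_smooth f (k : 'I_N) z : smooth f ->
  is_derive z (evec R k) f (partial k f z).
Proof. by move=> /(_ [::]) [_ /(_ k z) /= ?]; exact: derivableP. Qed.

Lemma smooth_partial f k : smooth f -> smooth (partial k f).
Proof. by move=> sf s; have := sf (rcons s k); rewrite /partials foldr_rcons. Qed.

Lemma smooth_partials f s : smooth f -> smooth (partials s f).
Proof. by move=> sf; elim: s => [//|k s IH]; exact: (smooth_partial k IH). Qed.

Lemma smooth_continuous f : smooth f -> continuous f.
Proof. by move=> /(_ [::]) []. Qed.

Lemma smoothI f : continuous f -> (forall k z, derivable f z (evec R k)) ->
  (forall k, smooth (partial k f)) -> smooth f.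
Proof.
move=> cf df sf s; case/lastP: s => [//|s k].
by rewrite /partials foldr_rcons; exact: sf.
Qed.

Lemma partial_cst (c : R) k : partial k (fun _ : 'rV[R]_N => c) = fun=> 0.
Proof. by apply/funext => z; rewrite /partial derive_cst. Qed.

Lemma smooth_cst (c : R) : smooth (fun _ : 'rV[R]_N => c).
Proof.
move=> s; suff [d ->] : exists d : R, partials s (fun _ : 'rV[R]_N => c) = fun=> d.
  by split; [exact: cst_continuous|move=> k z; exact: derivable_cst].
elim: s => [|k s [d IH]]; first by exists c.
by exists 0; rewrite /= IH partial_cst.
Qed.

(** Only the directional derivative of f is given, so the one-variable chain rule is applied to the
    restriction of f to the line through z along v. *)
Lemma is_derive_comp1 (g : R -> R) f z v (df dg : R) :
  is_derive (f z) 1 g dg -> is_derive z v f df ->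
  is_derive z v (g \o f) (dg * df).
Proof.
move=> dgf dff.
have fl : is_derive (0 : R) (1 : R) (fun h : R => f (h *: v + z)) df.
  have -> : df = 'D_v f (0 *: v + z) by rewrite scale0r add0r; case: dff.
  by apply: is_derive_line; rewrite scale0r add0r; case: dff.
have : is_derive (0 : R) (1 : R) (g \o (fun h : R => f (h *: v + z))) (dg * df).
  by apply: is_derive1_comp; rewrite /= scale0r add0r.
move=> /is_deriveP H; apply/is_deriveP => e /H[r r0 hr].
exists r => // h /hr; rewrite /= scale0r add0r.
by have -> : h *: (1 : R) + 0 = h by rewrite addr0 /GRing.scale /= mulr1.
Qed.

(* A generating class for smooth functions: it suffices that the class is
   closed under the first order partial derivatives. *)
Inductive smooth_alg : ('rV[R]_N -> R) -> Prop :=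
| salg_smooth f : smooth f -> smooth_alg f
| salg_add f g : smooth_alg f -> smooth_alg g -> smooth_alg (fun z => f z + g z)
| salg_mul f g : smooth_alg f -> smooth_alg g -> smooth_alg (fun z => f z * g z)
| salg_cos f : smooth_alg f -> smooth_alg (fun z => cos (f z))
| salg_sin f : smooth_alg f -> smooth_alg (fun z => sin (f z)).

Lemma smooth_algP f : smooth_alg f ->
  continuous f /\ forall k, exists2 df, smooth_alg df &
    forall z, is_derive z (evec R k) f (df z).
Proof.
elim=> {f} [f sf|f g _ [cf df] _ [cg dg]|f g af [cf df] ag [cg dg]|f af [cf df]|f af [cf df]].
- split; first exact: smooth_continuous.
  move=> k; exists (partial k f); first exact/salg_smooth/smooth_partial.
  by move=> z; exact: is_derive_smooth.
- split; first by move=> z; apply: continuousD; [exact: cf|exact: cg].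
  move=> k; have [u au fu] := df k; have [v av gv] := dg k.
  exists (fun z => u z + v z); first exact: salg_add.
  by move=> z; exact: is_deriveD.
- split; first by move=> z; apply: continuousM; [exact: cf|exact: cg].
  move=> k; have [u au fu] := df k; have [v av gv] := dg k.
  exists (fun z => f z * v z + g z * u z).
    by apply: salg_add; exact: salg_mul.
  by move=> z; exact: is_deriveM.
- split; first by move=> z; apply: continuous_comp; [exact: cf|exact: continuous_cos].
  move=> k; have [u au fu] := df k.
  exists (fun z => (-1 * sin (f z)) * u z).
    apply: salg_mul => //; apply: salg_mul; last exact: salg_sin.
    exact/salg_smooth/smooth_cst.
  by move=> z; rewrite mulN1r; exact: is_derive_comp1.
- split; first by move=> z; apply: continuous_comp; [exact: cf|exact: continuous_sin].
  move=> k; have [u au fu] := df k.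
  exists (fun z => cos (f z) * u z).
    by apply: salg_mul => //; apply: salg_cos.
  by move=> z; exact: is_derive_comp1.
Qed.

Lemma smooth_alg_smooth f : smooth_alg f -> smooth f.
Proof.
move=> af s; suff : smooth_alg (partials s f).
  move=> /smooth_algP[cs ds]; split => // k z.
  by have [df _ /(_ z)[]] := ds k.
elim: s => //= k s /smooth_algP[_ /(_ k)[df adf H]].
suff -> : partial k (partials s f) = df by [].
by apply/funext => z; case: (H z).
Qed.

Lemma smoothD f g : smooth f -> smooth g -> smooth (fun z => f z + g z).
Proof. by move=> sf sg; apply/smooth_alg_smooth/salg_add; exact: salg_smooth. Qed.

Lemma smoothM f g : smooth f -> smooth g -> smooth (fun z => f z * g z).
Proof. by move=> sf sg; apply/smooth_alg_smooth/salg_mul; exact: salg_smooth. Qed.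

Lemma smoothZ (c : R) f : smooth f -> smooth (fun z => c * f z).
Proof. by move=> sf; apply: smoothM => //; exact: smooth_cst. Qed.

Lemma smooth_cos f : smooth f -> smooth (fun z => cos (f z)).
Proof. by move=> sf; apply/smooth_alg_smooth/salg_cos/salg_smooth. Qed.

Lemma smooth_sin f : smooth f -> smooth (fun z => sin (f z)).
Proof. by move=> sf; apply/smooth_alg_smooth/salg_sin/salg_smooth. Qed.

Lemma partialD f g k : smooth f -> smooth g ->
  partial k (fun z => f z + g z) = fun z => partial k f z + partial k g z.
Proof.
move=> sf sg; apply/funext => z.
by case: (is_deriveD (is_derive_smooth k z sf) (is_derive_smooth k z sg)).
Qed.

Lemma partialM f g k : smooth f -> smooth g ->
  partial k (fun z => f z * g z) = fun z => f z * partial k g z + g z * partial k f z.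
Proof.
move=> sf sg; apply/funext => z.
by case: (is_deriveM (is_derive_smooth k z sf) (is_derive_smooth k z sg)).
Qed.

Lemma partialZ (c : R) f k : smooth f ->
  partial k (fun z => c * f z) = fun z => c * partial k f z.
Proof.
move=> sf; rewrite (partialM _ (smooth_cst c) sf); apply/funext => z.
by rewrite partial_cst mulr0 addr0.
Qed.

Lemma partial_cos f k : smooth f ->
  partial k (fun z => cos (f z)) = fun z => - sin (f z) * partial k f z.
Proof.
move=> sf; apply/funext => z.
by case: (is_derive_comp1 (is_derive_cos (f z)) (is_derive_smooth k z sf)).
Qed.

Lemma partial_sin f k : smooth f ->
  partial k (fun z => sin (f z)) = fun z => cos (f z) * partial k f z.
Proof.
move=> sf; apply/funext => z.
by case: (is_derive_comp1 (is_derive_sin (f z)) (is_derive_smooth k z sf)).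
Qed.

Definition dotr (th : 'I_N -> R) (z : 'rV[R]_N) : R := \sum_i th i * z 0 i.

Lemma is_derive_dotr th k z : is_derive z (evec R k) (dotr th) (th k).
Proof.
apply/is_deriveP => e e0; exists 1 => // h _.
suff -> : dotr th (h *: evec R k + z) - dotr th z - h *: th k = 0.
  by rewrite normr0 mulr_ge0 // ltW.
rewrite /dotr -sumrB (bigD1 k) //= big1 => [|i ik]; rewrite !mxE eqxx /=.
  have -> : h *: th k = h * th k by [].
  by rewrite eqxx mulr1n; ring.
by rewrite (negbTE ik) mulr0n; ring.
Qed.

Lemma smooth_dotr th : smooth (dotr th).
Proof.
apply: smoothI.
- apply: continuous_big => [|i _ z]; first exact: add_continuous.
  by apply: continuousM; [exact: cst_continuous|exact: coord_continuous].
- by move=> k z; case: (is_derive_dotr th k z).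
- move=> k; suff -> : partial k (dotr th) = fun=> th k by exact: smooth_cst.
  by apply/funext => z; case: (is_derive_dotr th k z).
Qed.

Lemma partial_dotr th k : partial k (dotr th) = fun=> th k.
Proof. by apply/funext => z; case: (is_derive_dotr th k z). Qed.

Lemma is_derive_periodic (g : 'rV[R]_N -> R) k : periodic g -> periodic (partial k g).
Proof.
move=> pg j z; rewrite /partial /derive.
suff -> : (fun h : R => h^-1 *: ((g \o shift (z + (2 * pi) *: evec R j)) (h *: evec R k)
    - g (z + (2 * pi) *: evec R j))) =
  (fun h : R => h^-1 *: ((g \o shift z) (h *: evec R k) - g z)) by [].
by apply/funext => h /=; rewrite addrA !pg.
Qed.

Lemma periodic_partials f s : periodic f -> periodic (partials s f).
Proof. by move=> pf; elim: s => //= k s; exact: is_derive_periodic. Qed.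

Lemma Cinfty_partials f s : Cinfty f -> Cinfty (partials s f).
Proof. by case=> sf pf; split; [exact: smooth_partials|exact: periodic_partials]. Qed.

Lemma periodic_int f k (m : int) z : periodic f ->
  f (z + (m%:~R * (2 * pi)) *: evec R k) = f z.
Proof.
move=> pf; have P (p : nat) y : f (y + (p%:R * (2 * pi)) *: evec R k) = f y.
  elim: p y => [|p IH] y; first by rewrite mul0r scale0r addr0.
  by rewrite -natr1 mulrDl mul1r scalerDl addrA pf IH.
case: m => p; first by rewrite -pmulrn P.
rewrite NegzE mulrNz mulNr scaleNr.
by rewrite -[in RHS](subrK ((p.+1%:~R * (2 * pi)) *: evec R k) z) -pmulrn P.
Qed.

End Smooth.

(** * Integration over the torus *)

Section LipschitzIntegral.
Variable R : realType.
Local Notation mu := (@lebesgue_measure R).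
Implicit Types (g : R -> R) (L : R).

(** Fubini is proved below for iterated integrals of functions Lipschitz in each variable, a class
    that contains the smooth periodic functions and is stable under partial integration. *)
Definition lip1 g L := forall x y, `|g x - g y| <= L * `|x - y|.

Lemma lip1_continuous g L : lip1 g L -> continuous g.
Proof.
move=> lg x; apply/cvgrPdist_lt => e e0.
have L1 : 0 < `|L| + 1 by rewrite ltr_wpDl.
near=> y.
apply: (le_lt_trans (lg x y)).
apply: (@le_lt_trans _ _ ((`|L| + 1) * `|x - y|)).
  by rewrite ler_wpM2r // (le_trans (ler_norm L)) // lerDl.
rewrite -ltr_pdivlMl //.
by near: y; apply: (@cvgr_dist_lt _ _ _ (nbhs x) _ id x) => //; rewrite mulr_gt0 ?invr_gt0.
Unshelve. all: by end_near.
Qed.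

Lemma lip1_integrable g L a b : lip1 g L -> mu.-integrable `[a, b] (EFin \o g).
Proof.
move=> /lip1_continuous cg; apply: continuous_compact_integrable.
  exact: segment_compact.
exact: continuous_subspaceT.
Qed.

Lemma Rintegral_cst_itv (a b c : R) (s : bool) : a <= b ->
  \int[mu]_(x in [set` Interval (BSide s a) (BRight b)]) c = c * (b - a).
Proof.
move=> ab; rewrite Rintegral_cst //=; congr (_ * _).
rewrite lebesgue_measure_itv /= lte_fin; case: ltgtP ab => //= -> _.
by rewrite subrr.
Qed.

Lemma lip1_integral_increment g L y y' : lip1 g L -> 0 <= y -> y <= y' ->
  `|\int[mu]_(x in `[0, y']) g x - \int[mu]_(x in `[0, y]) g x - g y * (y' - y)|
    <= L * (y' - y) ^+ 2.
Proof.
move=> lg y0 yy'.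
rewrite Rintegral_itvB ?bnd_simp //; last exact: lip1_integrable lg.
have ig : mu.-integrable `]y, y'] (EFin \o g).
  apply: integrableS (lip1_integrable y y' lg) => //.
  by apply: subset_itvr; rewrite bnd_simp.
have ic (c : R) : mu.-integrable `]y, y'] (EFin \o (fun=> c)).
  apply: (@integrableS _ _ _ mu `[y, y']) => //.
    by apply: subset_itvr; rewrite bnd_simp.
  apply: (@lip1_integrable (fun=> c) 0) => a b.
  by rewrite subrr normr0 mul0r.
rewrite -[g y * _](Rintegral_cst_itv (g y) false yy').
rewrite -RintegralB //=.
apply: (le_trans (le_normr_Rintegral _ _)) => //=.
  by apply: (integrableB _ ig (ic (g y))).
rewrite expr2 mulrA -(Rintegral_cst_itv (L * (y' - y)) false yy').
apply: le_Rintegral => //.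
  apply: (@integrable_norm _ _ _ mu `]y, y'] (g \- (fun=> g y))) => //.
  exact: (integrableB _ ig (ic (g y))).
move=> x /=; rewrite in_itv /= => /andP[yx xy'].
apply: (le_trans (lg x y)).
have L0 : 0 <= L.
  have := lg 0 1; rewrite sub0r normrN normr1 mulr1; exact: le_trans.
have {}yx := ltW yx; by rewrite ler_wpM2l // ger0_norm ?subr_ge0 // lerD2r.
Qed.

Lemma dist_Rintegral g1 g2 L1 L2 M c : 0 <= c -> lip1 g1 L1 -> lip1 g2 L2 ->
  (forall x, `|g1 x - g2 x| <= M) ->
  `|\int[mu]_(x in `[0, c]) g1 x - \int[mu]_(x in `[0, c]) g2 x| <= M * c.
Proof.
move=> c0 l1 l2 h.
have l12 : lip1 (fun x => g1 x - g2 x) (L1 + L2).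
  move=> x y; have -> : g1 x - g2 x - (g1 y - g2 y) = (g1 x - g1 y) - (g2 x - g2 y) by ring.
  by apply: (le_trans (ler_normB _ _)); rewrite mulrDl lerD.
have i1 := lip1_integrable 0 c l1; have i2 := lip1_integrable 0 c l2.
have i12 := lip1_integrable 0 c l12.
have lc (d : R) : lip1 (fun=> d) 0 by move=> x y; rewrite subrr normr0 mul0r.
rewrite -RintegralB //; apply: (le_trans (le_normr_Rintegral _ _)) => //.
have -> : M * c = M * (c - 0) by rewrite subr0.
rewrite -(Rintegral_cst_itv M true c0).
apply: le_Rintegral => //.
  exact: (@integrable_norm _ _ _ mu _ (fun x => g1 x - g2 x)).
exact: lip1_integrable (lc M).
Qed.

Variables (F : R -> R -> R) (L c : R).
Hypothesis c0 : 0 <= c.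
Hypothesis F1 : forall v, lip1 (F ^~ v) L.
Hypothesis F2 : forall u, lip1 (F u) L.

Lemma lip1_Rintegral y : 0 <= y ->
  lip1 (fun u => \int[mu]_(v in `[0, y]) F u v) (L * y).
Proof.
move=> y0 u u'; rewrite mulrAC.
by apply: (dist_Rintegral y0 (F2 u) (F2 u')) => v; exact: F1.
Qed.

Lemma lip1_Rintegral' y : 0 <= y ->
  lip1 (fun v => \int[mu]_(u in `[0, y]) F u v) (L * y).
Proof.
move=> y0 u u'; rewrite mulrAC.
by apply: (dist_Rintegral y0 (F1 u) (F1 u')) => v; exact: F2.
Qed.

Let H y := \int[mu]_(u in `[0, y]) \int[mu]_(v in `[0, c]) F u v -
           \int[mu]_(v in `[0, c]) \int[mu]_(u in `[0, y]) F u v.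

(** As functions of the upper limit y, both iterated integrals have derivative the integral of
    [F y v] in v. The quadratic bound is the quantitative form of the vanishing of the derivative of
    H. *)
Lemma fubini_increment y y' : 0 <= y -> y <= y' ->
  `|H y' - H y| <= 2 * L * c * (y' - y) ^+ 2.
Proof.
move=> y0 yy'.
have A := lip1_integral_increment (lip1_Rintegral c0) y0 yy'.
have y0' := le_trans y0 yy'.
have ly := lip1_Rintegral' y0; have ly' := lip1_Rintegral' y0'.
have lyy : lip1 (fun v => \int[mu]_(u in `[0, y]) F u v + F y v * (y' - y))
    (L * y + L * (y' - y)).
  move=> v v'.
  have -> : \int[mu]_(u in `[0, y]) F u v + F y v * (y' - y) -
    (\int[mu]_(u in `[0, y]) F u v' + F y v' * (y' - y)) =
    (\int[mu]_(u in `[0, y]) F u v - \int[mu]_(u in `[0, y]) F u v') +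
    (F y v - F y v') * (y' - y) by ring.
  apply: (le_trans (ler_normD _ _)); rewrite [leRHS]mulrDl lerD //.
  rewrite normrM [`|y' - y|]ger0_norm ?subr_ge0 // mulrAC.
  by rewrite ler_wpM2r ?subr_ge0 //; exact: F2.
have B := dist_Rintegral c0 ly' lyy (M := L * (y' - y) ^+ 2).
have {B} : `|\int[mu]_(v in `[0, c]) \int[mu]_(u in `[0, y']) F u v -
   (\int[mu]_(v in `[0, c]) \int[mu]_(u in `[0, y]) F u v +
    (\int[mu]_(v in `[0, c]) F y v) * (y' - y))| <= L * (y' - y) ^+ 2 * c.
  rewrite -RintegralZr //; last exact: lip1_integrable (F2 y).
  rewrite -[X in _ - X]RintegralD; [|exact: measurable_itv| |].
  - apply: B => v; rewrite opprD addrA.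
    exact: lip1_integral_increment.
  - exact: lip1_integrable ly.
  - apply: (@lip1_integrable _ (L * (y' - y))) => v v'.
    rewrite -mulrBl normrM [`|y' - y|]ger0_norm ?subr_ge0 // mulrAC.
    by rewrite ler_wpM2r ?subr_ge0 //; exact: F2.
rewrite /H; set a := \int[mu]_(u in `[0, y']) _ in A *.
set b := \int[mu]_(u in `[0, y]) _ in A *.
set d := \int[mu]_(v in `[0, c]) \int[mu]_(u in `[0, y']) _.
set e := \int[mu]_(v in `[0, c]) \int[mu]_(u in `[0, y]) _.
move=> B.
have -> : a - d - (b - e) =
  (a - b - (\int[mu]_(v in `[0, c]) F y v) * (y' - y)) -
  (d - (e + (\int[mu]_(v in `[0, c]) F y v) * (y' - y))) by ring.
apply: (le_trans (ler_normB _ _)).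
apply: (le_trans (lerD A B)).
by rewrite le_eqVlt; apply/orP; left; apply/eqP; ring.
Qed.

(** Cutting [0, c] into M + 1 equal steps bounds |H c| by M + 1 increments, each quadratic in c / (M
    + 1), hence by a multiple of 1 / (M + 1). *)
Lemma fubini_lip1 :
  \int[mu]_(u in `[0, c]) \int[mu]_(v in `[0, c]) F u v =
  \int[mu]_(v in `[0, c]) \int[mu]_(u in `[0, c]) F u v.
Proof.
have H0 : H 0 = 0.
  rewrite /H set_itv1 Rintegral_set1.
  under [X in _ - X]eq_Rintegral do rewrite Rintegral_set1.
  by rewrite Rintegral_cst_itv // mul0r subrr.
apply/eqP; rewrite -subr_eq0 -normr_le0 -/(H c).
apply/ler_addgt0Pl => e e0; rewrite addr0.
have L0 : 0 <= L.
  have := F2 0 0 1; rewrite sub0r normrN normr1 mulr1; exact: le_trans.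
have [M hM] : exists M : nat, 2 * L * c * c ^+ 2 / e < M.+1%:R.
  exists (Num.truncn (2 * L * c * c ^+ 2 / e)).
  exact: truncnS_gt.
have M0 : (0 : R) < M.+1%:R by rewrite ltr0n.
pose x (i : nat) : R := c * i%:R / M.+1%:R.
have xd i : x i.+1 - x i = c / M.+1%:R.
  by rewrite /x -natr1; field; rewrite gt_eqF.
have st i : `|H (x i.+1) - H (x i)| <= 2 * L * c * (c / M.+1%:R) ^+ 2.
  rewrite -(xd i); apply: fubini_increment.
    by rewrite !mulr_ge0 // invr_ge0 ltW.
  by rewrite -subr_ge0 xd divr_ge0 // ltW.
have S m : `|H (x m)| <= m%:R * (2 * L * c * (c / M.+1%:R) ^+ 2).
  elim: m => [|m IH].
    by rewrite /x mulr0 mul0r H0 normr0 mul0r.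
  rewrite -natr1 mulrDl mul1r -[H _](subrK (H (x m))) addrC.
  exact: (le_trans (ler_normD _ _) (lerD IH (st m))).
have := S M.+1; have -> : x M.+1 = c by rewrite /x -mulrA divff ?mulr1 // gt_eqF.
move=> h; apply: (le_trans h).
have -> : M.+1%:R * (2 * L * c * (c / M.+1%:R) ^+ 2) = 2 * L * c * c ^+ 2 / M.+1%:R.
  by field; rewrite gt_eqF.
by rewrite ler_pdivrMr // -ler_pdivrMl // mulrC ltW.
Qed.

End LipschitzIntegral.

(** * Iterated integrals of separately Lipschitz functions *)

Section TorusIntegral.
Variables (R : realType) (N : nat).
Local Notation mu := (@lebesgue_measure R).
Implicit Types (f g : 'rV[R]_N -> R) (z : 'rV[R]_N).

Lemma pi2_ge0 : 0 <= 2 * pi :> R.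
Proof. by rewrite mulr_ge0 // pi_ge0. Qed.

Lemma pi2_gt0 : 0 < 2 * pi :> R.
Proof. by rewrite mulr_gt0 // pi_gt0. Qed.

(** The Lipschitz constant is common to all coordinates and base points, which makes the class
    stable under [int_coord]. *)
Definition lipc f := exists L : R,
  forall (k : 'I_N) z h, `|f (z + h *: evec R k) - f z| <= L * `|h|.

Lemma updE z k (x : R) : upd z k x = z + (x - z 0 k) *: evec R k.
Proof.
apply/rowP => j; rewrite !mxE eqxx /=; case: eqVneq => [->|_].
  by rewrite mulr1n mulr1 addrC subrK.
by rewrite mulr0n mulr0 addr0.
Qed.

Lemma upd_diff z k (x y : R) : upd z k y = upd z k x + (y - x) *: evec R k.
Proof. by rewrite !updE -addrA -scalerDl; congr (_ + _ *: _); ring. Qed.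

Lemma updC z j k (x y : R) : j != k -> upd (upd z j x) k y = upd (upd z k y) j x.
Proof.
move=> jk; apply/rowP => i; rewrite !mxE; case: (eqVneq i k) => // ->.
by rewrite eq_sym (negbTE jk).
Qed.

Lemma upd_addC z j k (x h : R) : j != k ->
  upd (z + h *: evec R j) k x = upd z k x + h *: evec R j.
Proof.
move=> jk; apply/rowP => i; rewrite !mxE; case: eqVneq => // ->.
by rewrite eqxx eq_sym (negbTE jk) /= mulr0n mulr0 addr0.
Qed.

Lemma upd_add z k (x h : R) : upd (z + h *: evec R k) k x = upd z k x.
Proof.
apply/rowP => i; rewrite !mxE; case: eqVneq => // ik.
by rewrite andbF mulr0n mulr0 addr0.
Qed.

Lemma lipc_slice f : lipc f -> exists L, forall z k, lip1 (fun x => f (upd z k x)) L.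
Proof. by case=> L lf; exists L => z k x y; rewrite (upd_diff z k y x). Qed.

Lemma lipc_integrable f z k : lipc f ->
  mu.-integrable `[0, 2 * pi] (EFin \o (fun x => f (upd z k x))).
Proof. by move=> /lipc_slice[L /(_ z k)]; exact: lip1_integrable. Qed.

Lemma lipc_cst (c : R) : lipc (fun=> c).
Proof. by exists 0 => k z h; rewrite subrr normr0 mul0r. Qed.

Lemma lipcD f g : lipc f -> lipc g -> lipc (fun z => f z + g z).
Proof.
move=> [L lf] [M lg]; exists (L + M) => k z h.
rewrite opprD addrACA mulrDl; apply: (le_trans (ler_normD _ _)); exact: lerD.
Qed.

Lemma lipcZ (c : R) f : lipc f -> lipc (fun z => c * f z).
Proof.
move=> [L lf]; exists (`|c| * L) => k z h.
by rewrite -mulrBr normrM -mulrA ler_wpM2l.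
Qed.

Lemma int_coord_lin k (c : R) f g : lipc f -> lipc g ->
  int_coord k (fun z => c * f z + g z) =
  fun z => c * int_coord k f z + int_coord k g z.
Proof.
move=> lf lg; apply/funext => z; rewrite /int_coord RintegralD //; last 2 first.
- exact: (lipc_integrable z k (lipcZ c lf)).
- exact: (lipc_integrable z k lg).
by rewrite RintegralZl //; exact: lipc_integrable.
Qed.

Lemma le_int_coord k f g z : lipc f -> lipc g -> (forall z, f z <= g z) ->
  int_coord k f z <= int_coord k g z.
Proof.
by move=> lf lg fg; apply: le_Rintegral => //; exact: lipc_integrable.
Qed.

Lemma int_coord_cst k (c : R) : int_coord k (fun=> c) = (fun _ : 'rV[R]_N => c * (2 * pi)).
Proof.
apply/funext => z; rewrite /int_coord Rintegral_cst_itv ?subr0 //.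
exact: pi2_ge0.
Qed.

Lemma int_coord_lipc k f : lipc f -> lipc (int_coord k f).
Proof.
move=> lf; have [M lM] := lipc_slice lf; case: lf => [L lf].
exists (L * (2 * pi)) => j z h; rewrite /int_coord mulrAC.
apply: (dist_Rintegral pi2_ge0 (lM _ _) (lM _ _)) => x.
have [->|jk] := eqVneq j k.
  rewrite upd_add subrr normr0 mulr_ge0 //.
  by have := lf k 0 1; rewrite normr1 mulr1; exact: le_trans.
by rewrite upd_addC.
Qed.

Lemma int_coordC j k f : lipc f ->
  int_coord j (int_coord k f) = int_coord k (int_coord j f).
Proof.
have [->//|jk] := eqVneq j k.
move=> /lipc_slice[L lf]; apply/funext => z; rewrite /int_coord.
under [RHS]eq_Rintegral do under eq_Rintegral do rewrite updC 1?eq_sym //.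
apply: (@fubini_lip1 _ (fun u v => f (upd (upd z j u) k v)) L) => //.
  exact: pi2_ge0.
move=> v x y; have := lf (upd z k v) j x y.
by rewrite !(updC z _ _ jk).
Qed.

Definition int_coords (s : seq 'I_N) f := foldr (@int_coord R N) f s.

Lemma int_coords_lipc s f : lipc f -> lipc (int_coords s f).
Proof. by move=> lf; elim: s => //= k s; exact: int_coord_lipc. Qed.

Lemma int_coords_lin s (c : R) f g : lipc f -> lipc g ->
  int_coords s (fun z => c * f z + g z) =
  fun z => c * int_coords s f z + int_coords s g z.
Proof.
move=> lf lg; elim: s => //= k s ->.
by rewrite int_coord_lin //; exact: int_coords_lipc.
Qed.

Lemma le_int_coords s f g : lipc f -> lipc g -> (forall z, f z <= g z) ->
  forall z, int_coords s f z <= int_coords s g z.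
Proof.
move=> lf lg fg; elim: s => //= k s IH z.
by apply: le_int_coord IH; exact: int_coords_lipc.
Qed.

Lemma int_coords_cst s (c : R) :
  int_coords s (fun=> c) = (fun _ : 'rV[R]_N => c * (2 * pi) ^+ size s).
Proof.
elim: s => [|k s IH]; first by apply/funext => z; rewrite /= mulr1.
rewrite /= -/(int_coords s _) IH int_coord_cst.
by apply/funext => z; rewrite exprSr -[LHS]mulrA.
Qed.

Lemma int_coords_int_coord s k f : lipc f ->
  int_coords s (int_coord k f) = int_coord k (int_coords s f).
Proof.
move=> lf; elim: s => //= j s ->; rewrite int_coordC //.
exact: int_coords_lipc.
Qed.

(** By commutation, the integration in coordinate k can be carried out before all the others. *)
Lemma int_coords_eq0 s k f : lipc f -> k \in s ->
  (forall z, int_coord k f z = 0) -> forall z, int_coords s f z = 0.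
Proof.
move=> lf ks f0; have {}f0 : int_coord k f = fun=> 0 by apply/funext.
elim: s ks => //= j s IH; rewrite in_cons => /orP[/eqP <-|ks] z.
  by rewrite -int_coords_int_coord // f0 int_coords_cst mul0r.
rewrite (_ : int_coords s f = fun=> 0) ?int_coord_cst ?mul0r //.
by apply/funext; exact: IH.
Qed.

Lemma int_torusD f g : lipc f -> lipc g ->
  int_torus (fun z => f z + g z) = int_torus f + int_torus g.
Proof.
move=> lf lg; have -> : (fun z => f z + g z) = (fun z => 1 * f z + g z).
  by apply/funext => z; rewrite mul1r.
by rewrite /int_torus -!/(int_coords _ _) int_coords_lin // mul1r.
Qed.

Lemma int_torusZ (c : R) f : lipc f -> int_torus (fun z => c * f z) = c * int_torus f.
Proof.
move=> lf; have -> : (fun z => c * f z) = (fun z => c * f z + 0).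
  by apply/funext => z; rewrite addr0.
rewrite /int_torus -!/(int_coords _ _) int_coords_lin //; last exact: lipc_cst.
by rewrite int_coords_cst mul0r addr0.
Qed.

Lemma le_int_torus f g : lipc f -> lipc g -> (forall z, f z <= g z) ->
  int_torus f <= int_torus g.
Proof. by move=> lf lg fg; exact: le_int_coords. Qed.

Lemma int_torus_cst (c : R) : int_torus (fun _ : 'rV[R]_N => c) = c * (2 * pi) ^+ N.
Proof. by rewrite /int_torus -/(int_coords _ _) int_coords_cst size_enum_ord. Qed.

Lemma int_torus_eq0 k f : lipc f ->
  (forall z, int_coord k f z = 0) -> int_torus f = 0.
Proof. by move=> lf f0; apply: (@int_coords_eq0 _ k) => //; rewrite mem_enum. Qed.

End TorusIntegral.

(** * Bounds for smooth periodic functions; integrals of derivatives *)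

Section Bounded.
Variables (R : realType) (N : nat).
Local Notation mu := (@lebesgue_measure R).
Implicit Types (f g : 'rV[R]_N -> R) (z : 'rV[R]_N).

Lemma periodic_box f z : periodic f ->
  exists2 w : 'rV[R]_N, (forall i, `[0, 2 * pi]%classic (w ord0 i)) & f w = f z.
Proof.
move=> pf; pose m i := - Num.floor (z 0 i / (2 * pi)).
exists (z + \sum_i ((m i)%:~R * (2 * pi)) *: evec R i).
  move=> i; rewrite !mxE summxE (bigD1 i) //= big1; last first.
    by move=> j ji; rewrite !mxE eqxx eq_sym (negbTE ji) mulr0n mulr0.
  rewrite !mxE !eqxx mulr1n mulr1 addr0 in_itv /=.
  have := Num.Theory.floor_itv (z 0 i / (2 * pi)).
  rewrite intrD1 ler_pdivlMr ?ltr_pdivrMr ?pi2_gt0 // /m intrN.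
  set c := _%:~R => /andP[a b]; apply/andP; split; first by lra.
  by move: b; rewrite mulrDl mul1r; lra.
elim: (index_enum _) => [|i s IH]; first by rewrite big_nil addr0.
by rewrite big_cons addrCA addrC periodic_int.
Qed.

Lemma Cinfty_bounded f : Cinfty f -> exists M, forall z, `|f z| <= M.
Proof.
move=> [sf pf].
pose A := [set v : 'rV[R]_N | forall i, `[0, 2 * pi]%classic (v ord0 i)].
have cA : compact A by apply: (@rV_compact R _ (fun=> `[0, 2 * pi]%classic)) => i; exact: segment_compact.
have A0 : A !=set0.
  by exists 0 => i; rewrite /= mxE in_itv /= lexx pi2_ge0.
have cf : {within A, continuous (fun z => `|f z|)}.
  apply: continuous_subspaceT => z; apply: continuous_comp.
    exact: smooth_continuous.
  exact: norm_continuous.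
have [c _ hc] := EVT_max_rV A0 cA cf.
exists `|f c| => z; have [w wA <-] := periodic_box z pf.
by apply: hc; rewrite inE.
Qed.

Lemma MVT_line f k z (h M : R) : smooth f -> (forall z, `|partial k f z| <= M) ->
  `|f (z + h *: evec R k) - f z| <= M * `|h|.
Proof.
move=> sf hM.
have key (a b : R) : a <= b -> `|f (b *: evec R k + z) - f (a *: evec R k + z)| <= M * `|b - a|.
  move=> ab.
  have dl x : is_derive x (1 : R) (fun h : R => f (h *: evec R k + z))
      (partial k f (x *: evec R k + z)).
    by apply: is_derive_line; case: (is_derive_smooth k (x *: evec R k + z) sf).
  have cl : {within `[a, b], continuous (fun h : R => f (h *: evec R k + z))}.
    apply: continuous_subspaceT => x.
    apply: differentiable_continuous; apply/derivable1_diffP.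
    by case: (dl x).
  have [c _ ->] := MVT_segment ab (fun x _ => dl x) cl.
  by rewrite normrM ler_wpM2r.
rewrite [z + _]addrC; have [h0|h0] := leP 0 h.
  by have := key _ _ h0; rewrite scale0r add0r subr0.
by have := key _ _ (ltW h0); rewrite scale0r add0r sub0r normrN distrC.
Qed.

Lemma Cinfty_bound_partial f : Cinfty f ->
  exists2 M, 0 <= M & forall k z, `|partial k f z| <= M.
Proof.
move=> cf; have H k : exists M, forall z, `|partial k f z| <= M.
  exact: Cinfty_bounded (Cinfty_partials [:: k] cf).
have [M hM] := choice H.
exists (\sum_k `|M k|); first exact: sumr_ge0.
move=> k z; apply: (le_trans (hM k z)); rewrite (bigD1 k) //=.
by apply: (le_trans (ler_norm _)); rewrite lerDl sumr_ge0.
Qed.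

Lemma Cinfty_lipc f : Cinfty f -> lipc f.
Proof.
move=> cf; have [M _ hM] := Cinfty_bound_partial cf.
by exists M => k z h; apply: MVT_line => //; case: cf.
Qed.

Lemma Cinfty_cst (c : R) : Cinfty (fun _ : 'rV[R]_N => c).
Proof. by split; [exact: smooth_cst|]. Qed.

Lemma CinftyD f g : Cinfty f -> Cinfty g -> Cinfty (fun z => f z + g z).
Proof.
move=> [sf pf] [sg pg]; split; first exact: smoothD.
by move=> k z; rewrite pf pg.
Qed.

Lemma CinftyM f g : Cinfty f -> Cinfty g -> Cinfty (fun z => f z * g z).
Proof.
move=> [sf pf] [sg pg]; split; first exact: smoothM.
by move=> k z; rewrite pf pg.
Qed.

Lemma CinftyN f : Cinfty f -> Cinfty (fun z => - f z).
Proof.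
move=> cf; have := CinftyM (Cinfty_cst (-1)) cf.
by congr Cinfty; apply/funext => z; rewrite mulN1r.
Qed.

Lemma CinftyB f g : Cinfty f -> Cinfty g -> Cinfty (fun z => f z - g z).
Proof. by move=> cf cg; apply: CinftyD => //; exact: CinftyN. Qed.

Lemma int_coord_partial k f z : Cinfty f -> int_coord k (partial k f) z = 0.
Proof.
move=> cf; rewrite /int_coord /Rintegral.
pose F x := f (upd z k x).
have dF x : is_derive x (1 : R) F (partial k f (upd z k x)).
  have -> : F = fun h => f (h *: evec R k + upd z k 0).
    by apply/funext => h; rewrite /F (upd_diff z k 0 h) subr0 addrC.
  have -> : upd z k x = x *: evec R k + upd z k 0.
    by rewrite (upd_diff z k 0 x) subr0 addrC.
  apply: is_derive_line; have [sf _] := cf.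
  by case: (is_derive_smooth k (x *: evec R k + upd z k 0) sf).
have cF : continuous F.
  move=> x; apply: differentiable_continuous; apply/derivable1_diffP.
  by case: (dF x).
rewrite (@continuous_FTC2 _ _ F) ?pi2_gt0 //.
- rewrite -EFinB /= /F (upd_diff z k 0 (2 * pi)) subr0.
  by have [_ pf] := cf; rewrite pf subrr.
- apply: continuous_subspaceT.
  have [L /(_ z k) /lip1_continuous //] := lipc_slice (Cinfty_lipc (Cinfty_partials [:: k] cf)).
- split => [x _||].
  + by case: (dF x).
  + by apply: cvg_at_right_filter; exact: cF.
  + by apply: cvg_at_left_filter; exact: cF.
- by move=> x _; rewrite derive1E; case: (dF x).
Qed.

Lemma int_torus_partial k f : Cinfty f -> int_torus (partial k f) = 0.
Proof.
move=> cf; apply: (@int_torus_eq0 _ _ k); last by move=> z; exact: int_coord_partial.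
exact: Cinfty_lipc (Cinfty_partials [:: k] cf).
Qed.

End Bounded.

(** * Complex-valued functions *)

Notation normc := ComplexField.Normc.normc.

Section ComplexNumbers.
Variable R : realType.
Implicit Types x y : R[i].

Lemma complex_eq x y : complex.Re x = complex.Re y -> complex.Im x = complex.Im y -> x = y.
Proof. by case: x y => a b [c d] /= -> ->. Qed.

Lemma cReD x y : complex.Re (x + y) = complex.Re x + complex.Re y.
Proof. by case: x y => a b [c d]. Qed.
Lemma cImD x y : complex.Im (x + y) = complex.Im x + complex.Im y.
Proof. by case: x y => a b [c d]. Qed.
Lemma cReN x : complex.Re (- x) = - complex.Re x.
Proof. by case: x. Qed.
Lemma cImN x : complex.Im (- x) = - complex.Im x.
Proof. by case: x. Qed.
Lemma cReM x y : complex.Re (x * y) =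
  complex.Re x * complex.Re y - complex.Im x * complex.Im y.
Proof. by case: x y => a b [c d]. Qed.
Lemma cImM x y : complex.Im (x * y) =
  complex.Re x * complex.Im y + complex.Im x * complex.Re y.
Proof. by case: x y => a b [c d]. Qed.
Lemma cReJ x : complex.Re (conjc x) = complex.Re x.
Proof. by case: x. Qed.
Lemma cImJ x : complex.Im (conjc x) = - complex.Im x.
Proof. by case: x. Qed.

Lemma RCD (a b : R) : (a + b)%:C = a%:C + b%:C.
Proof. by apply: complex_eq; rewrite //= addr0. Qed.
Lemma RCN (a : R) : (- a)%:C = - a%:C.
Proof. by apply: complex_eq; rewrite //= oppr0. Qed.
Lemma RCB (a b : R) : (a - b)%:C = a%:C - b%:C.
Proof. by rewrite RCD RCN. Qed.
Lemma RCM (a b : R) : (a * b)%:C = a%:C * b%:C.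
Proof. by apply: complex_eq; rewrite ?cReM ?cImM /=; ring. Qed.
Lemma RCX (a : R) n : (a ^+ n)%:C = a%:C ^+ n.
Proof. by elim: n => // n IH; rewrite !exprS RCM IH. Qed.
Lemma RCn n : (n%:R : R)%:C = n%:R.
Proof. by elim: n => // n IH; rewrite -!natr1 RCD IH. Qed.
Lemma RC_sum (I : Type) (r : seq I) (P : pred I) (F : I -> R) :
  (\sum_(i <- r | P i) F i)%:C = \sum_(i <- r | P i) (F i)%:C.
Proof. by apply: (big_morph (fun a : R => a%:C)) => // x y; exact: RCD. Qed.
Lemma RC_prod (I : Type) (r : seq I) (P : pred I) (F : I -> R) :
  (\prod_(i <- r | P i) F i)%:C = \prod_(i <- r | P i) (F i)%:C.
Proof. by apply: (big_morph (fun a : R => a%:C)) => // x y; exact: RCM. Qed.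

Lemma cJ_real (a : R) : (conjc (a%:C)) = a%:C.
Proof. by apply: complex_eq => //=; rewrite oppr0. Qed.
Lemma cJM x y : (conjc (x * y)) = conjc x * conjc y.
Proof. by case: x y => a b [c d]; apply: complex_eq => /=; ring. Qed.
Lemma cJD x y : (conjc (x + y)) = conjc x + conjc y.
Proof. by case: x y => a b [c d]; apply: complex_eq => /=; ring. Qed.

Lemma Re_sum (I : Type) (r : seq I) (P : pred I) (F : I -> R[i]) :
  complex.Re (\sum_(i <- r | P i) F i) = \sum_(i <- r | P i) complex.Re (F i).
Proof. by apply: (big_morph (@complex.Re R)) => // x y; exact: cReD. Qed.

Lemma normc_ge0 x : 0 <= normc x.
Proof. by case: x => a b; rewrite /= sqrtr_ge0. Qed.

Lemma normc_sqr x : normc x ^+ 2 = complex.Re x ^+ 2 + complex.Im x ^+ 2.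
Proof. by case: x => a b /=; rewrite sqr_sqrtr // addr_ge0 ?sqr_ge0. Qed.

Lemma normc_Re x : `|complex.Re x| <= normc x.
Proof.
case: x => a b /=; rewrite -sqrtr_sqr ler_wsqrtr //.
by rewrite lerDl sqr_ge0.
Qed.

Lemma normc_Im x : `|complex.Im x| <= normc x.
Proof.
case: x => a b /=; rewrite -sqrtr_sqr ler_wsqrtr //.
by rewrite lerDr sqr_ge0.
Qed.

Lemma normc_real (a : R) : normc (a%:C) = `|a|.
Proof. by rewrite /= expr0n addr0 sqrtr_sqr. Qed.

Lemma normcD x y : normc (x + y) <= normc x + normc y.
Proof. exact: le_normcD. Qed.

Lemma normc_le_ReIm x : normc x <= `|complex.Re x| + `|complex.Im x|.
Proof.
have -> : x = (complex.Re x)%:C + 0 +i* complex.Im x.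
  by apply: complex_eq; rewrite ?cReD ?cImD /= ?addr0 ?add0r.
apply: (le_trans (normcD _ _)); rewrite cReD cImD /= !expr0n ?addr0 ?add0r.
by rewrite !sqrtr_sqr.
Qed.

Lemma normcN x : normc (- x) = normc x.
Proof. by case: x => a b /=; rewrite !sqrrN. Qed.

Lemma normcJ x : normc (conjc x) = normc x.
Proof. by case: x => a b /=; rewrite sqrrN. Qed.

Lemma normc_i (a : R) : normc (0 +i* a) = `|a|.
Proof. by rewrite /= expr0n add0r sqrtr_sqr. Qed.

Lemma normc_eq0 x : normc x = 0 -> x = 0.
Proof. exact: ComplexField.Normc.eq0_normc. Qed.

Lemma normcM x y : normc (x * y) = normc x * normc y.
Proof. exact: ComplexField.Normc.normcM. Qed.

Lemma normcX x n : normc (x ^+ n) = normc x ^+ n.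
Proof.
elim: n => [|n IH]; first by rewrite expr0 ComplexField.Normc.normc1.
by rewrite !exprS normcM IH.
Qed.

Lemma normc_sum (I : Type) (r : seq I) (P : pred I) (F : I -> R[i]) :
  normc (\sum_(i <- r | P i) F i) <= \sum_(i <- r | P i) normc (F i).
Proof.
elim/big_rec2 : _ => [|i a b _ H]; first by rewrite ComplexField.Normc.normc0.
by apply: (le_trans (normcD _ _)); rewrite lerD2l.
Qed.

Lemma normcB x y : normc (x - y) <= normc x + normc y.
Proof. by rewrite -[in leRHS](normcN y) normcD. Qed.

End ComplexNumbers.

(** * Calculus, integration and L^2 norms of complex-valued functions *)

Section ComplexFunctions.
Variables (R : realType) (N : nat).
Implicit Types (f g : 'rV[R]_N -> R) (z : 'rV[R]_N) (phi psi : 'rV[R]_N -> R[i]).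

Definition dC (k : 'I_N) phi : 'rV[R]_N -> R[i] := partialsC [:: k] phi.

Lemma dCE k phi : dC k phi = partialsC [:: k] phi.
Proof. by []. Qed.

Lemma partialsC_cons k s phi : partialsC (k :: s) phi = dC k (partialsC s phi).
Proof. by []. Qed.

Lemma partialsC_rcons k s phi : partialsC (rcons s k) phi = partialsC s (dC k phi).
Proof. by rewrite /partialsC /partials !foldr_rcons. Qed.

Lemma partialsC_nil phi : partialsC [::] phi = phi.
Proof. by apply/funext => z; rewrite /partialsC /= /re_part /im_part; case: (phi z). Qed.

Lemma CinftyC_partials s phi : CinftyC phi -> CinftyC (partialsC s phi).
Proof. by case=> a b; split; exact: Cinfty_partials. Qed.

Lemma CinftyC_dC k phi : CinftyC phi -> CinftyC (dC k phi).
Proof. exact: CinftyC_partials. Qed.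

Lemma CinftyC_cst (c : R[i]) : CinftyC (fun _ : 'rV[R]_N => c).
Proof. by split; exact: Cinfty_cst. Qed.

Lemma CinftyC_real f : Cinfty f -> CinftyC (fun z => (f z)%:C).
Proof. by move=> cf; split => //; exact: Cinfty_cst. Qed.

Lemma CinftyC_add phi psi : CinftyC phi -> CinftyC psi -> CinftyC (fun z => phi z + psi z).
Proof.
move=> [a b] [c d]; split.
  suff -> : re_part (fun z => phi z + psi z) = fun z => re_part phi z + re_part psi z.
    exact: CinftyD.
  by apply/funext => z; rewrite /re_part cReD.
suff -> : im_part (fun z => phi z + psi z) = fun z => im_part phi z + im_part psi z.
  exact: CinftyD.
by apply/funext => z; rewrite /im_part cImD.
Qed.

Lemma re_partD phi psi : re_part (fun z => phi z + psi z) =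
  fun z => re_part phi z + re_part psi z.
Proof. by apply/funext => z; exact: cReD. Qed.

Lemma im_partD phi psi : im_part (fun z => phi z + psi z) =
  fun z => im_part phi z + im_part psi z.
Proof. by apply/funext => z; exact: cImD. Qed.

Lemma Re_dC k phi z : complex.Re (dC k phi z) = partial k (re_part phi) z.
Proof. by []. Qed.

Lemma Im_dC k phi z : complex.Im (dC k phi z) = partial k (im_part phi) z.
Proof. by []. Qed.

Lemma re_partM phi psi : re_part (fun z => phi z * psi z) =
  fun z => re_part phi z * re_part psi z + -1 * (im_part phi z * im_part psi z).
Proof. by apply/funext => z; rewrite /re_part cReM mulN1r. Qed.

Lemma im_partM phi psi : im_part (fun z => phi z * psi z) =
  fun z => re_part phi z * im_part psi z + im_part phi z * re_part psi z.
Proof. by apply/funext => z; rewrite /im_part cImM. Qed.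

Lemma CinftyC_mul phi psi : CinftyC phi -> CinftyC psi -> CinftyC (fun z => phi z * psi z).
Proof.
move=> [a b] [c d]; split.
  rewrite re_partM; apply: CinftyD; first exact: CinftyM.
  by apply: CinftyM; [exact: Cinfty_cst|exact: CinftyM].
by rewrite im_partM; apply: CinftyD; exact: CinftyM.
Qed.

Lemma CinftyC_scale (c : R[i]) phi : CinftyC phi -> CinftyC (fun z => c * phi z).
Proof. by move=> cp; apply: CinftyC_mul => //; exact: CinftyC_cst. Qed.

Lemma CinftyC_opp phi : CinftyC phi -> CinftyC (fun z => - phi z).
Proof.
move=> cp; have := CinftyC_scale (-1) cp.
by congr CinftyC; apply/funext => z; rewrite mulN1r.
Qed.

Lemma CinftyC_sub phi psi : CinftyC phi -> CinftyC psi -> CinftyC (fun z => phi z - psi z).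
Proof. by move=> cp cs; apply: CinftyC_add => //; exact: CinftyC_opp. Qed.

Lemma CinftyC_conj phi : CinftyC phi -> CinftyC (fun z => (conjc (phi z))).
Proof.
move=> [a b]; split.
  by suff -> : re_part (fun z => (conjc (phi z))) = re_part phi by []; apply/funext => z; exact: cReJ.
suff -> : im_part (fun z => (conjc (phi z))) = fun z => - im_part phi z by exact: CinftyN.
by apply/funext => z; exact: cImJ.
Qed.

Lemma CinftyC_sum (I : Type) (r : seq I) (P : pred I) (F : I -> 'rV[R]_N -> R[i]) :
  (forall i, CinftyC (F i)) -> CinftyC (fun z => \sum_(i <- r | P i) F i z).
Proof.
move=> cF; elim: r => [|i r IH].
  suff -> : (fun z => \sum_(i <- [::] | P i) F i z) = fun=> 0 by exact: CinftyC_cst.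
  by apply/funext => z; rewrite big_nil.
case Pi : (P i).
  suff -> : (fun z => \sum_(i <- i :: r | P i) F i z) =
      fun z => F i z + \sum_(i <- r | P i) F i z by exact: CinftyC_add.
  by apply/funext => z; rewrite big_cons Pi.
suff -> : (fun z => \sum_(i <- i :: r | P i) F i z) =
    fun z => \sum_(i <- r | P i) F i z by [].
by apply/funext => z; rewrite big_cons Pi.
Qed.

Lemma dC_cst k (c : R[i]) : dC k (fun _ : 'rV[R]_N => c) = fun=> 0.
Proof. by apply/funext => z; apply: complex_eq; rewrite /= partial_cst. Qed.

Lemma dC_add k phi psi : CinftyC phi -> CinftyC psi ->
  dC k (fun z => phi z + psi z) = fun z => dC k phi z + dC k psi z.
Proof.
move=> [[a _] [b _]] [[c _] [d _]]; apply/funext => z; apply: complex_eq.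
  by rewrite cReD !Re_dC re_partD partialD.
by rewrite cImD !Im_dC im_partD partialD.
Qed.

Lemma dC_mul k phi psi : CinftyC phi -> CinftyC psi ->
  dC k (fun z => phi z * psi z) = fun z => dC k phi z * psi z + phi z * dC k psi z.
Proof.
move=> [[a _] [b _]] [[c _] [d _]]; apply/funext => z; apply: complex_eq.
  rewrite Re_dC re_partM partialD; last 2 first.
  - exact: smoothM.
  - by apply: smoothZ; exact: smoothM.
  rewrite partialZ; last exact: smoothM.
  by rewrite !partialM // cReD !cReM !Re_dC !Im_dC /re_part /im_part; ring.
rewrite Im_dC im_partM partialD; [|exact: smoothM|exact: smoothM].
by rewrite !partialM // cImD !cImM !Re_dC !Im_dC /re_part /im_part; ring.
Qed.

Lemma dC_scale k (c : R[i]) phi : CinftyC phi ->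
  dC k (fun z => c * phi z) = fun z => c * dC k phi z.
Proof.
move=> cp; rewrite dC_mul //; last exact: CinftyC_cst.
by apply/funext => z; rewrite dC_cst mul0r add0r.
Qed.

Lemma dC_opp k phi : CinftyC phi -> dC k (fun z => - phi z) = fun z => - dC k phi z.
Proof.
move=> cp; have -> : (fun z => - phi z) = fun z => -1 * phi z.
  by apply/funext => z; rewrite mulN1r.
by rewrite dC_scale //; apply/funext => z; rewrite mulN1r.
Qed.

Lemma dC_sub k phi psi : CinftyC phi -> CinftyC psi ->
  dC k (fun z => phi z - psi z) = fun z => dC k phi z - dC k psi z.
Proof. by move=> cp cs; rewrite dC_add ?dC_opp //; exact: CinftyC_opp. Qed.

Lemma dC_conj k phi : CinftyC phi -> dC k (fun z => (conjc (phi z))) = fun z => (conjc (dC k phi z)).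
Proof.
move=> [[a _] [b _]]; apply/funext => z; apply: complex_eq.
  rewrite cReJ !Re_dC; suff -> : re_part (fun z => (conjc (phi z))) = re_part phi by [].
  by apply/funext => w; exact: cReJ.
rewrite cImJ !Im_dC.
have -> : im_part (fun z => (conjc (phi z))) = fun z => -1 * im_part phi z.
  by apply/funext => w; rewrite /im_part cImJ mulN1r.
by rewrite partialZ // mulN1r.
Qed.

Lemma dC_real k f : dC k (fun z => (f z)%:C) = fun z => (partial k f z)%:C.
Proof. by apply/funext => z; apply: complex_eq => //=; rewrite partial_cst. Qed.

Lemma dC_sum k (I : Type) (r : seq I) (P : pred I) (F : I -> 'rV[R]_N -> R[i]) :
  (forall i, CinftyC (F i)) ->
  dC k (fun z => \sum_(i <- r | P i) F i z) = fun z => \sum_(i <- r | P i) dC k (F i) z.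
Proof.
move=> cF; elim: r => [|i r IH].
  have -> : (fun z => \sum_(i <- [::] | P i) F i z) = fun=> 0.
    by apply/funext => z; rewrite big_nil.
  by rewrite dC_cst; apply/funext => z; rewrite big_nil.
case Pi : (P i).
  have -> : (fun z => \sum_(i <- i :: r | P i) F i z) =
      fun z => F i z + \sum_(i <- r | P i) F i z.
    by apply/funext => z; rewrite big_cons Pi.
  rewrite dC_add //; last exact: CinftyC_sum.
  by rewrite IH; apply/funext => z; rewrite big_cons Pi.
have -> : (fun z => \sum_(i <- i :: r | P i) F i z) = fun z => \sum_(i <- r | P i) F i z.
  by apply/funext => z; rewrite big_cons Pi.
by rewrite IH; apply/funext => z; rewrite big_cons Pi.
Qed.

Lemma CinftyC_bounded phi : CinftyC phi ->
  exists2 M, 0 <= M & forall z, normc (phi z) <= M.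
Proof.
move=> [/Cinfty_bounded[M hM] /Cinfty_bounded[M' hM']].
exists (M + M').
  by apply: addr_ge0; [exact: le_trans (hM 0)|exact: le_trans (hM' 0)].
by move=> z; apply: (le_trans (normc_le_ReIm _)); exact: lerD (hM z) (hM' z).
Qed.

Lemma CinftyC_lipc phi : CinftyC phi -> lipc (re_part phi) /\ lipc (im_part phi).
Proof. by move=> [a b]; split; exact: Cinfty_lipc. Qed.

Lemma intC_add phi psi : CinftyC phi -> CinftyC psi ->
  int_torusC (fun z => phi z + psi z) = int_torusC phi + int_torusC psi.
Proof.
move=> /CinftyC_lipc[a b] /CinftyC_lipc[c d]; apply: complex_eq.
  by rewrite cReD /int_torusC /= re_partD int_torusD.
by rewrite cImD /int_torusC /= im_partD int_torusD.
Qed.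

Lemma intC_scale (c : R[i]) phi : CinftyC phi ->
  int_torusC (fun z => c * phi z) = c * int_torusC phi.
Proof.
move=> /CinftyC_lipc[a b]; apply: complex_eq.
  rewrite cReM /= -mulNr -!int_torusZ // -int_torusD; [|exact: lipcZ..].
  by congr int_torus; apply/funext => z; rewrite /re_part cReM mulNr.
rewrite cImM /= -!int_torusZ // -int_torusD; [|exact: lipcZ..].
by congr int_torus; apply/funext => z; rewrite /im_part cImM.
Qed.

Lemma intC_opp phi : CinftyC phi -> int_torusC (fun z => - phi z) = - int_torusC phi.
Proof.
move=> cp; have -> : (fun z => - phi z) = fun z => -1 * phi z.
  by apply/funext => z; rewrite mulN1r.
by rewrite intC_scale // mulN1r.
Qed.

Lemma intC_sub phi psi : CinftyC phi -> CinftyC psi ->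
  int_torusC (fun z => phi z - psi z) = int_torusC phi - int_torusC psi.
Proof. by move=> cp cs; rewrite intC_add ?intC_opp //; exact: CinftyC_opp. Qed.

Lemma intC_cst (c : R[i]) :
  int_torusC (fun _ : 'rV[R]_N => c) = c * ((2 * pi) ^+ N)%:C.
Proof.
apply: complex_eq; rewrite ?cReM ?cImM /= /re_part /im_part int_torus_cst.
  by rewrite mulr0 subr0.
by rewrite mulr0 add0r.
Qed.

Lemma intC_sum (I : Type) (r : seq I) (P : pred I) (F : I -> 'rV[R]_N -> R[i]) :
  (forall i, CinftyC (F i)) ->
  int_torusC (fun z => \sum_(i <- r | P i) F i z) = \sum_(i <- r | P i) int_torusC (F i).
Proof.
move=> cF; elim: r => [|i r IH].
  have -> : (fun z => \sum_(i <- [::] | P i) F i z) = fun=> 0.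
    by apply/funext => z; rewrite big_nil.
  by rewrite intC_cst mul0r big_nil.
case Pi : (P i).
  have -> : (fun z => \sum_(i <- i :: r | P i) F i z) =
      fun z => F i z + \sum_(i <- r | P i) F i z.
    by apply/funext => z; rewrite big_cons Pi.
  rewrite intC_add //; last exact: CinftyC_sum.
  by rewrite IH big_cons Pi.
have -> : (fun z => \sum_(i <- i :: r | P i) F i z) = fun z => \sum_(i <- r | P i) F i z.
  by apply/funext => z; rewrite big_cons Pi.
by rewrite IH big_cons Pi.
Qed.

Lemma intC_dC k phi : CinftyC phi -> int_torusC (dC k phi) = 0.
Proof. by move=> [a b]; apply: complex_eq; apply: int_torus_partial. Qed.

Lemma intC_parts k phi psi : CinftyC phi -> CinftyC psi ->
  int_torusC (fun z => dC k phi z * psi z) = - int_torusC (fun z => phi z * dC k psi z).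
Proof.
move=> cp cs; apply/eqP; rewrite -addr_eq0 -intC_add; last 2 first.
- by apply: CinftyC_mul => //; exact: CinftyC_dC.
- by apply: CinftyC_mul => //; exact: CinftyC_dC.
by rewrite -dC_mul // intC_dC //; exact: CinftyC_mul.
Qed.

Lemma intC_conj phi : CinftyC phi -> int_torusC (fun z => (conjc (phi z))) = (conjc (int_torusC phi)).
Proof.
move=> /CinftyC_lipc[a b]; apply: complex_eq; rewrite ?cReJ ?cImJ /=.
  by congr int_torus; apply/funext => z; exact: cReJ.
rewrite -mulN1r -int_torusZ //; congr int_torus; apply/funext => z.
by rewrite /im_part cImJ mulN1r.
Qed.

(** The factor 2 comes from bounding the real and imaginary parts separately. *)
Lemma normc_int_le phi f : CinftyC phi -> Cinfty f -> (forall z, normc (phi z) <= f z) ->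
  normc (int_torusC phi) <= 2 * int_torus f.
Proof.
move=> /CinftyC_lipc[a b] cf h; have lf := Cinfty_lipc cf.
have lNf : lipc (fun z => -1 * f z) by exact: lipcZ.
apply: (le_trans (normc_le_ReIm _)).
have -> : 2 * int_torus f = int_torus f + int_torus f by ring.
have H g : lipc g -> (forall z, `|g z| <= f z) -> `|int_torus g| <= int_torus f.
  move=> lg hg; rewrite ler_norml; apply/andP; split.
    rewrite -mulN1r -int_torusZ //; apply: le_int_torus => // z.
    by rewrite mulN1r; have := hg z; rewrite ler_norml => /andP[].
  by apply: le_int_torus => // z; apply: le_trans (hg z); exact: ler_norm.
by apply: lerD; apply: H => // z; apply: le_trans (h z); [exact: normc_Re|exact: normc_Im].
Qed.

Lemma normc_int_cst phi M : CinftyC phi -> (forall z, normc (phi z) <= M) ->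
  normc (int_torusC phi) <= 2 * (M * (2 * pi) ^+ N).
Proof.
move=> cp h; apply: le_trans (normc_int_le cp (Cinfty_cst _ M) h) _.
by rewrite int_torus_cst.
Qed.

(** The squared L^2 norm, not normalised by the volume. *)
Definition sqn phi : R := int_torus (fun z => re_part phi z ^+ 2 + im_part phi z ^+ 2).

Lemma Cinfty_sqn phi : CinftyC phi -> Cinfty (fun z => re_part phi z ^+ 2 + im_part phi z ^+ 2).
Proof. by move=> [a b]; apply: CinftyD; exact: CinftyM. Qed.

Lemma sqn_ge0 phi : CinftyC phi -> 0 <= sqn phi.
Proof.
move=> cp; have -> : 0 = int_torus (fun _ : 'rV[R]_N => 0) :> R by rewrite int_torus_cst mul0r.
apply: le_int_torus; [exact: lipc_cst|exact: Cinfty_lipc (Cinfty_sqn cp)|].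
by move=> z; rewrite addr_ge0 ?sqr_ge0.
Qed.

Lemma sqnE phi : CinftyC phi -> int_torusC (fun z => phi z * (conjc (phi z))) = (sqn phi)%:C.
Proof.
move=> cp; apply: complex_eq => /=.
  by congr int_torus; apply/funext => z; rewrite /re_part cReM cReJ cImJ /im_part; ring.
rewrite -[RHS](mul0r ((2 * pi) ^+ N)) -int_torus_cst; congr int_torus; apply/funext => z.
by rewrite /im_part cImM cReJ cImJ; ring.
Qed.

Lemma sqn_mul_le phi psi B : CinftyC phi -> CinftyC psi ->
  (forall z, normc (phi z) <= B) -> sqn (fun z => phi z * psi z) <= B ^+ 2 * sqn psi.
Proof.
move=> cp cs h; have lpsi := Cinfty_lipc (Cinfty_sqn cs).
rewrite /sqn -int_torusZ //.
apply: le_int_torus; [exact: Cinfty_lipc (Cinfty_sqn (CinftyC_mul cp cs))|exact: lipcZ|].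
move=> z; rewrite -!normc_sqr normcM exprMn ler_wpM2r ?sqr_ge0 //.
by rewrite lerXn2r ?nnegrE ?normc_ge0 // (le_trans _ (h z)) ?normc_ge0.
Qed.

(** Young's inequality with a free parameter takes the place of Cauchy-Schwarz: a suitable d later
    lets one of the two terms be absorbed. *)
Lemma normc_int_mul phi psi d : 0 < d -> CinftyC phi -> CinftyC psi ->
  normc (int_torusC (fun z => phi z * psi z)) <= d^-1 * sqn phi + d * sqn psi.
Proof.
move=> d0 cp cs.
have lp := Cinfty_lipc (Cinfty_sqn cp); have ls := Cinfty_lipc (Cinfty_sqn cs).
have cf : Cinfty (fun z => 2^-1 * (d^-1 * (re_part phi z ^+ 2 + im_part phi z ^+ 2) +
     d * (re_part psi z ^+ 2 + im_part psi z ^+ 2))).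
  apply: CinftyM; first exact: Cinfty_cst.
  by apply: CinftyD; (apply: CinftyM; [exact: Cinfty_cst|exact: Cinfty_sqn]).
apply: le_trans (normc_int_le (CinftyC_mul cp cs) cf _) _.
  move=> z; rewrite -!normc_sqr normcM ler_pdivlMl // -subr_ge0.
  have -> : d^-1 * normc (phi z) ^+ 2 + d * normc (psi z) ^+ 2 -
      2 * (normc (phi z) * normc (psi z)) = d^-1 * (normc (phi z) - d * normc (psi z)) ^+ 2.
    by field; rewrite gt_eqF.
  by rewrite mulr_ge0 ?sqr_ge0 // invr_ge0 ltW.
rewrite int_torusZ; last by apply: lipcD; exact: lipcZ.
by rewrite int_torusD ?int_torusZ //; [rewrite mulrA divff // mul1r|exact: lipcZ..].
Qed.

End ComplexFunctions.

(** * Fourier coefficients *)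

Section Expi.
Variable R : realType.

Definition expi (t : R) : R[i] := cos t +i* sin t.

Lemma expiD (s t : R) : expi (s + t) = expi s * expi t.
Proof. by apply: complex_eq; rewrite ?cReM ?cImM /= ?cosD ?sinD; ring. Qed.

Lemma expi0 : expi 0 = 1.
Proof. by rewrite /expi cos0 sin0. Qed.

Lemma expiN (t : R) : expi (- t) = (conjc (expi t)).
Proof. by rewrite /expi cosN sinN. Qed.

Lemma normc_expi (t : R) : normc (expi t) = 1.
Proof. by rewrite /= cos2Dsin2 sqrtr1. Qed.

Lemma expiMn (t : R) n : expi t ^+ n = expi (t * n%:R).
Proof.
elim: n => [|n IH]; first by rewrite mulr0 expi0.
by rewrite exprSr IH -expiD -natr1 mulrDr mulr1.
Qed.

Lemma expi_2pi (m : int) : expi (m%:~R * (2 * pi)) = 1.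
Proof.
have H : expi (2 * pi) = 1 by rewrite mulrC -mulr_natr /expi ?mulr_natr cos2pi sin2pi.
case: m => n; first by rewrite -pmulrn mulrC -expiMn H expr1n.
by rewrite NegzE mulrNz mulNr expiN -pmulrn mulrC -expiMn H expr1n conjc1.
Qed.

Lemma expi_sum (I : Type) (r : seq I) (F : I -> R) :
  expi (\sum_(i <- r) F i) = \prod_(i <- r) expi (F i).
Proof. by apply: (big_morph expi) => [x y|]; [exact: expiD|exact: expi0]. Qed.

End Expi.

(** * Exponential modes and the decay of Fourier coefficients *)

Section Exponentials.
Variables (R : realType) (N : nat).
Implicit Types (f : 'rV[R]_N -> R) (z : 'rV[R]_N) (phi psi : 'rV[R]_N -> R[i]).
Local Notation Z := {ffun 'I_N -> int}.
Implicit Types (th et : Z).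

Lemma dC_expi k f : smooth f ->
  dC k (fun z => expi (f z)) = fun z => (0 +i* partial k f z) * expi (f z).
Proof.
move=> sf; apply/funext => z; apply: complex_eq.
  by rewrite Re_dC cReM /= (partial_cos k sf); ring.
by rewrite Im_dC cImM /= (partial_sin k sf); ring.
Qed.

Lemma CinftyC_expi f : smooth f -> periodic (fun z => expi (f z)) ->
  CinftyC (fun z => expi (f z)).
Proof.
move=> sf pf; split; split.
- exact: smooth_cos.
- by move=> k z; rewrite /re_part pf.
- exact: smooth_sin.
- by move=> k z; rewrite /im_part pf.
Qed.

Definition dotz th : 'rV[R]_N -> R := dotr (fun i => (th i)%:~R).

Definition em th : 'rV[R]_N -> R[i] := fun z => expi (dotz th z).

Lemma dotzD th et z : dotz (th + et) z = dotz th z + dotz et z.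
Proof.
by rewrite /dotz /dotr -big_split; apply: eq_bigr => i _; rewrite ffunE rmorphD mulrDl.
Qed.

Lemma dotzN th z : dotz (- th) z = - dotz th z.
Proof.
by rewrite /dotz /dotr -sumrN; apply: eq_bigr => i _; rewrite ffunE rmorphN mulNr.
Qed.

Lemma emD th et z : em (th + et) z = em th z * em et z.
Proof. by rewrite /em dotzD expiD. Qed.

Lemma emN th z : em (- th) z = (conjc (em th z)).
Proof. by rewrite /em dotzN expiN. Qed.

Lemma em0 z : em 0 z = 1.
Proof. by rewrite /em /dotz /dotr big1 ?expi0 // => i _; rewrite ffunE mul0r. Qed.

Lemma normc_em th z : normc (em th z) = 1.
Proof. exact: normc_expi. Qed.

Lemma em_prod th z : em th z = \prod_i expi ((th i)%:~R * z 0 i).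
Proof. exact: expi_sum. Qed.

Lemma emNr th z : em th (- z) = em (- th) z.
Proof. by rewrite !em_prod; apply: eq_bigr => i _; rewrite mxE ffunE rmorphN mulrN mulNr. Qed.

Lemma emDr th z w : em th (z + w) = em th z * em th w.
Proof.
by rewrite !em_prod -big_split; apply: eq_bigr => i _; rewrite mxE mulrDr expiD.
Qed.

Lemma periodic_em th : periodic (em th).
Proof.
move=> k z; rewrite emDr [X in _ * X]em_prod (bigD1 k) //= big1 => [|i ik].
  by rewrite !mxE !eqxx mulr1n mulr1 expi_2pi !mulr1.
by rewrite !mxE (negbTE ik) mulr0n !mulr0 expi0.
Qed.

Lemma CinftyC_em th : CinftyC (em th).
Proof. by apply: CinftyC_expi; [exact: smooth_dotr|exact: periodic_em]. Qed.

Lemma dC_em k th : dC k (em th) = fun z => (0 +i* (th k)%:~R) * em th z.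
Proof. by rewrite dC_expi ?partial_dotr //; exact: smooth_dotr. Qed.

Definition vol : R := (2 * pi) ^+ N.

Lemma vol_gt0 : 0 < vol.
Proof. by rewrite exprn_gt0 // pi2_gt0. Qed.

(** For th != 0 the mode is, up to the factor i th_k with th_k != 0, its own derivative in z_k, and
    the integral of a derivative vanishes. *)
Lemma int_em th : int_torusC (em th) = if th == 0 then vol%:C else 0.
Proof.
case: eqVneq => [->|th0].
  have -> : em 0 = fun=> 1 by apply/funext => z; exact: em0.
  by rewrite intC_cst mul1r.
have [k thk] : exists k, th k != 0.
  apply/existsP; apply: contraNT th0 => /existsPn H; apply/eqP/ffunP => i.
  by rewrite ffunE; apply/eqP; have := H i; rewrite negbK.
have := intC_dC k (CinftyC_em th); rewrite dC_em intC_scale; last exact: CinftyC_em.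
move/eqP; rewrite mulf_eq0 => /orP[|/eqP//].
by rewrite eq_complex /= eqxx intr_eq0 (negbTE thk).
Qed.

(** The Fourier coefficient, normalised so that [fc (em th) th] is 1. *)
Definition fc phi th : R[i] := (vol^-1)%:C * int_torusC (fun z => phi z * em (- th) z).

Lemma CinftyC_mul_em phi th : CinftyC phi -> CinftyC (fun z => phi z * em th z).
Proof. by move=> cp; apply: CinftyC_mul => //; exact: CinftyC_em. Qed.

Lemma volC_neq0 : vol%:C != 0 :> R[i].
Proof. by rewrite eq_complex /= negb_and gt_eqF ?vol_gt0. Qed.

Lemma volCV : (vol^-1)%:C = (vol%:C)^-1 :> R[i].
Proof. by rewrite fmorphV. Qed.

Lemma int_fc phi th : int_torusC (fun z => phi z * em (- th) z) = vol%:C * fc phi th.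
Proof. by rewrite /fc volCV mulrA divff ?volC_neq0 // mul1r. Qed.

Lemma fc_em th et : fc (em et) th = (th == et)%:R.
Proof.
have -> : fc (em et) th = (vol^-1)%:C * int_torusC (em (et - th)).
  by congr (_ * int_torusC _); apply/funext => z; rewrite emD.
rewrite int_em subr_eq0 eq_sym; case: eqP => _; last by rewrite mulr0.
by rewrite volCV mulVf ?volC_neq0.
Qed.

Lemma fc_add phi psi th : CinftyC phi -> CinftyC psi ->
  fc (fun z => phi z + psi z) th = fc phi th + fc psi th.
Proof.
move=> cp cs; rewrite /fc -mulrDr -intC_add; try exact: CinftyC_mul_em.
by congr (_ * int_torusC _); apply/funext => z; rewrite mulrDl.
Qed.

Lemma fc_scale (c : R[i]) phi th : CinftyC phi ->
  fc (fun z => c * phi z) th = c * fc phi th.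
Proof.
move=> cp; rewrite /fc mulrCA -(intC_scale c); last exact: CinftyC_mul_em.
by congr (_ * int_torusC _); apply/funext => z; rewrite mulrA.
Qed.

Lemma fc_sub phi psi th : CinftyC phi -> CinftyC psi ->
  fc (fun z => phi z - psi z) th = fc phi th - fc psi th.
Proof.
move=> cp cs; rewrite fc_add //; last exact: CinftyC_opp.
congr (_ + _); have -> : (fun z => - psi z) = fun z => -1 * psi z.
  by apply/funext => z; rewrite mulN1r.
by rewrite fc_scale // mulN1r.
Qed.

Lemma fc_sum (I : Type) (r : seq I) (P : pred I) (F : I -> 'rV[R]_N -> R[i]) th :
  (forall i, CinftyC (F i)) ->
  fc (fun z => \sum_(i <- r | P i) F i z) th = \sum_(i <- r | P i) fc (F i) th.
Proof.
move=> cF; rewrite /fc -mulr_sumr -intC_sum; last by move=> i; exact: CinftyC_mul_em.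
by congr (_ * int_torusC _); apply/funext => z; rewrite mulr_suml.
Qed.

Lemma fc_dC k phi th : CinftyC phi -> fc (dC k phi) th = (0 +i* (th k)%:~R) * fc phi th.
Proof.
move=> cp; rewrite /fc intC_parts //; last exact: CinftyC_em.
rewrite dC_em mulrCA; congr (_ * _).
have -> : (fun z => phi z * ((0 +i* ((- th) k)%:~R) * em (- th) z)) =
  (fun z => (0 +i* ((- th) k)%:~R) * (phi z * em (- th) z)).
  by apply/funext => z; rewrite mulrCA.
rewrite intC_scale ?ffunE; last exact: CinftyC_mul_em.
by rewrite -mulNr; congr (_ * _); apply: complex_eq; rewrite ?cReN ?cImN /= ?oppr0 // rmorphN opprK.
Qed.

Lemma fc_conj phi th : CinftyC phi -> fc (fun z => (conjc (phi z))) th = (conjc (fc phi (- th))).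
Proof.
move=> cp; rewrite /fc cJM cJ_real -intC_conj; last exact: CinftyC_mul_em.
by congr (_ * int_torusC _); apply/funext => z; rewrite cJM -emN opprK.
Qed.

Lemma normc_fc phi th M : CinftyC phi -> (forall z, normc (phi z) <= M) ->
  normc (fc phi th) <= 2 * M.
Proof.
move=> cp h; have v0 := ltW vol_gt0.
rewrite /fc normcM normc_real ger0_norm ?invr_ge0 //.
rewrite ler_pdivrMl ?vol_gt0 //.
apply: le_trans (normc_int_cst (CinftyC_mul_em (- th) cp) (M := M) _) _.
  by move=> z; rewrite normcM normc_em mulr1.
by rewrite -/vol le_eqVlt; apply/orP; left; apply/eqP; ring.
Qed.

Definition wt th : R := 1 + \sum_i `|(th i)%:~R|.

Lemma wt_ge1 th : 1 <= wt th.
Proof. by rewrite lerDl sumr_ge0. Qed.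

Lemma wt_gt0 th : 0 < wt th.
Proof. exact: lt_le_trans (wt_ge1 th). Qed.

Lemma wtN th : wt (- th) = wt th.
Proof. by congr (_ + _); apply: eq_bigr => i _; rewrite ffunE rmorphN normrN. Qed.

Lemma le_wt th i : `|(th i)%:~R| <= wt th.
Proof.
by rewrite /wt (bigD1 i) //= addrCA lerDl addr_ge0 // sumr_ge0.
Qed.

(** Both sides are compared with M, the maximum of 1 and the |th_i|: the weight is at most (N + 1)
    M, and M^p is one of the terms on the right. *)
Lemma wt_pow_le th p :
  wt th ^+ p <= N.+1%:R ^+ p * (1 + \sum_i `|(th i)%:~R| ^+ p).
Proof.
pose M := \big[Num.max/(1:R)]_i `|(th i)%:~R|.
have M1 : 1 <= M by apply: bigmax_ge_id.
have MX : M ^+ p <= 1 + \sum_i `|(th i)%:~R : R| ^+ p.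
  have S0 : 0 <= \sum_i `|(th i)%:~R : R| ^+ p by apply: sumr_ge0 => i _; rewrite exprn_ge0.
  rewrite /M; elim/big_ind : _ => [|x y hx hy|i _].
  - by rewrite expr1n lerDl.
  - by rewrite /Num.max; case: ifP.
  - by rewrite (bigD1 i) //= addrCA lerDl addr_ge0 // sumr_ge0.
apply: (@le_trans _ _ ((N.+1%:R * M) ^+ p)); last first.
  by rewrite exprMn ler_wpM2l // exprn_ge0.
have M0 := le_trans ler01 M1; have w0 := ltW (wt_gt0 th).
apply: lerXn2r; rewrite ?nnegrE ?mulr_ge0 //.
rewrite -natr1 mulrDl mul1r addrC /wt lerD //.
rewrite -[in leRHS](card_ord N) mulr_natl -sumr_const ler_sum // => i _.
exact: le_bigmax.
Qed.

Lemma fc_partials_nseq phi k p th : CinftyC phi ->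
  fc (partialsC (nseq p k) phi) th = (0 +i* (th k)%:~R) ^+ p * fc phi th.
Proof.
move=> cp; elim: p => [|p IH]; first by rewrite partialsC_nil mul1r.
rewrite partialsC_cons fc_dC ?IH ?exprS ?mulrA //; exact: CinftyC_partials.
Qed.

(** Differentiating p times in coordinate k multiplies the coefficient by (i th_k)^p, and the
    coefficients of each derivative are bounded. *)
Lemma fc_decay phi p : CinftyC phi ->
  exists2 C, 0 <= C & forall th, normc (fc phi th) * wt th ^+ p <= C.
Proof.
move=> cp.
have [M0 M00 hM0] := CinftyC_bounded cp.
have H k : exists M, forall th, normc (fc phi th) * `|(th k)%:~R| ^+ p <= M.
  have cpp := CinftyC_partials (nseq p k) cp.
  have [M _ hM] := CinftyC_bounded cpp.
  exists (2 * M) => th; have := normc_fc th cpp hM.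
  by rewrite fc_partials_nseq // normcM normcX normc_i mulrC.
have [M hM] := choice H.
exists (N.+1%:R ^+ p * (2 * M0 + \sum_i `|M i|)).
  by rewrite mulr_ge0 ?exprn_ge0 // addr_ge0 ?sumr_ge0 // mulr_ge0.
move=> th; apply: le_trans (ler_wpM2l (normc_ge0 _) (wt_pow_le th p)) _.
rewrite mulrCA ler_wpM2l ?exprn_ge0 // mulrDr mulr1 lerD //.
  exact: normc_fc.
rewrite mulr_sumr ler_sum // => i _.
exact: le_trans (hM i th) (ler_norm _).
Qed.

End Exponentials.

(** * Density of trigonometric polynomials *)

Section CentralBinomial.

Lemma bin_half_incr K l : (l < K)%N -> ('C(K.*2, l) <= 'C(K.*2, l.+1))%N.
Proof.
move=> lK; rewrite -(@leq_pmul2l l.+1) // mul_bin_left.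
rewrite leq_mul2r; apply/orP; right.
by lia.
Qed.

Lemma bin_central_max K l : ('C(K.*2, l) <= 'C(K.*2, K))%N.
Proof.
have H d : (d <= K)%N -> ('C(K.*2, K - d) <= 'C(K.*2, K))%N.
  elim: d => [|d IH] dK; first by rewrite subn0.
  apply: leq_trans (IH (ltnW dK)); rewrite -[in leqRHS](subnSK dK).
  by apply: bin_half_incr; lia.
have [lK|Kl] := leqP l K; first by have := H _ (leq_subr l K); rewrite subKn.
have [l2|l2] := leqP l K.*2; last by rewrite bin_small.
rewrite -bin_sub //; have -> : (K.*2 - l = K - (l - K))%N by lia.
by apply: H; lia.
Qed.

Lemma bin_central_next K : (K.+1 * 'C(K.*2, K.+1) = K * 'C(K.*2, K))%N.
Proof. by rewrite mul_bin_left -addnn addnK. Qed.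

End CentralBinomial.

(** * A nonnegative trigonometric kernel *)

Section Kernel.
Variables (R : realType) (N : nat).
Local Notation Z := {ffun 'I_N -> int}.
Implicit Types (th et : Z) (K : nat) (z w : 'rV[R]_N).

(* The Fourier coefficients of the nonnegative kernel
   (2 + 2 cos y) ^ K / C(2K, K), shifted to the indices 0, ..., 2K. *)
Definition q1 K (l : nat) : R := ('C(K.*2, l))%:R / ('C(K.*2, K))%:R.

Lemma binK_gt0 K : (0 : R) < ('C(K.*2, K))%:R.
Proof. by rewrite ltr0n bin_gt0 -addnn leq_addr. Qed.

Lemma q1_ge0 K l : 0 <= q1 K l.
Proof. by rewrite divr_ge0. Qed.

Lemma q1_le1 K l : q1 K l <= 1.
Proof. by rewrite ler_pdivrMr ?binK_gt0 // mul1r ler_nat bin_central_max. Qed.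

Lemma q1K K : q1 K K = 1.
Proof. by rewrite /q1 divff // gt_eqF // binK_gt0. Qed.

(** The defect 1 / (K + 1) of the first off-centre coefficient governs how fast the kernel
    concentrates at the origin. *)
Lemma q1S K : q1 K K.+1 = 1 - K.+1%:R^-1.
Proof.
have := congr1 (fun n => n%:R : R) (bin_central_next K).
rewrite !natrM => H; have K1 : K.+1%:R != 0 :> R by rewrite pnatr_eq0.
have b0 := binK_gt0 K.
apply: (mulfI K1); rewrite /q1 mulrA H mulfK ?gt_eqF //.
by rewrite mulrBr divff // -natr1; ring.
Qed.

(** The sum is the binomial expansion of (e^(-iy/2) + e^(iy/2))^(2K) = (2 cos (y/2))^(2K), an even
    power of a real number. *)
Lemma kernel1_ge0 K (y : R) : exists2 r : R, 0 <= r &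
  \sum_(l < (K.*2).+1) (q1 K l)%:C * expi ((l%:Z - K%:Z)%:~R * y) = r%:C.
Proof.
exists ((2 * cos (y / 2)) ^+ K.*2 / ('C(K.*2, K))%:R).
  by rewrite divr_ge0 // -mul2n exprM exprn_ge0 // sqr_ge0.
have E : (expi (- (y / 2)) + expi (y / 2)) = (2 * cos (y / 2))%:C.
  by apply: complex_eq; rewrite ?cReD ?cImD /= ?cosN ?sinN; ring.
rewrite RCM RCX -E exprDn mulr_suml; apply: eq_bigr => l _.
rewrite /q1 RCM RCn !expiMn -expiD -[in RHS]mulr_natr.
have lK : (l <= K.*2)%N by rewrite -ltnS.
have -> : - (y / 2) * (K.*2 - l)%:R + y / 2 * l%:R = (l%:Z - K%:Z)%:~R * y.
  move: (nat_of_ord l) lK => m lK.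
  by rewrite natrB // -muln2 natrM rmorphB /= -!pmulrn; field.
by ring.
Qed.

(** The frequencies of the cube [-K, K]^N are indexed by finite functions into {0, ..., 2K}; the
    index K stands for frequency 0. *)
Definition bx K (j : {ffun 'I_N -> 'I_(K.*2).+1}) : Z := [ffun i => (j i)%:Z - K%:Z].
Definition qc K (j : {ffun 'I_N -> 'I_(K.*2).+1}) : R := \prod_i q1 K (j i).

Lemma bx_inj K : injective (@bx K).
Proof.
move=> j j' /ffunP H; apply/ffunP => i; have := H i; rewrite !ffunE.
by move=> /addIr [] /ord_inj.
Qed.

Lemma qc_ge0 K (j : {ffun 'I_N -> 'I_(K.*2).+1}) : 0 <= qc j.
Proof. by apply: prodr_ge0 => i _; exact: q1_ge0. Qed.

Lemma qc_le1 K (j : {ffun 'I_N -> 'I_(K.*2).+1}) : qc j <= 1.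
Proof. by apply: prodr_ile1 => i _; rewrite q1_ge0 q1_le1. Qed.

Definition kernel K z : R[i] := \sum_j (@qc K j)%:C * em (bx j) z.

(** Distributing a product over sums shows that the kernel is the product of its one-dimensional
    versions in the coordinates. *)
Lemma kernel_ge0 K z : exists2 r : R, 0 <= r & kernel K z = r%:C.
Proof.
have H i := kernel1_ge0 K (z 0 i).
have [r r0 hr] : exists2 r : 'I_N -> R, (forall i, 0 <= r i) & forall i,
  \sum_(l < (K.*2).+1) (q1 K l)%:C * expi ((l%:Z - K%:Z)%:~R * z 0 i) = (r i)%:C.
  have H' i : exists r, 0 <= r /\ \sum_(l < (K.*2).+1) (q1 K l)%:C * expi ((l%:Z - K%:Z)%:~R * z 0 i) = r%:C.
    by have [r] := H i; exists r.
  by have [r hr] := choice H'; exists r => i; case: (hr i).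
exists (\prod_i r i); first exact: prodr_ge0.
rewrite RC_prod; under eq_bigr do rewrite -hr.
rewrite bigA_distr_bigA /kernel; apply: eq_bigr => j _.
rewrite big_split /= /qc RC_prod em_prod; congr (_ * _).
by apply: eq_bigr => i _; rewrite ffunE.
Qed.

Definition rkernel K z w : R[i] := kernel K (z - w).

Lemma rkernelE K z : rkernel K z = fun w => \sum_j ((@qc K j)%:C * em (bx j) z) * em (- bx j) w.
Proof.
apply/funext => w; apply: eq_bigr => j _.
by rewrite emDr emNr mulrA.
Qed.

Lemma CinftyC_rkernel K z : CinftyC (rkernel K z).
Proof.
by rewrite rkernelE; apply: CinftyC_sum => j; apply: CinftyC_scale; exact: CinftyC_em.
Qed.

(** The convolution of phi with the kernel, written as a Fourier sum damped by the weights [qc]. *)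
Definition trig_approx K (phi : 'rV[R]_N -> R[i]) z : R[i] :=
  \sum_j (@qc K j)%:C * fc phi (bx j) * em (bx j) z.

Lemma trig_approx_int K phi z : CinftyC phi ->
  trig_approx K phi z = ((vol R N)^-1)%:C * int_torusC (fun w => phi w * rkernel K z w).
Proof.
move=> cp; rewrite rkernelE.
have -> : (fun w => phi w * \sum_j ((@qc K j)%:C * em (bx j) z) * em (- bx j) w) =
  fun w => \sum_j ((@qc K j)%:C * em (bx j) z) * (phi w * em (- bx j) w).
  by apply/funext => w; rewrite mulr_sumr; apply: eq_bigr => j _; rewrite mulrCA.
rewrite intC_sum; last by move=> j; apply: CinftyC_scale; exact: CinftyC_mul_em.
rewrite mulr_sumr; apply: eq_bigr => j _.
rewrite intC_scale /fc; last exact: CinftyC_mul_em.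
by rewrite -!mulrA [em _ _ * _]mulrC !mulrA [_%:C * (qc j)%:C]mulrC.
Qed.

Lemma trig_approx_em K j z : trig_approx K (em (@bx K j)) z = (qc j)%:C * em (bx j) z.
Proof.
rewrite /trig_approx (bigD1 j) //= fc_em eqxx mulr1 big1 ?addr0 // => j' jj'.
by rewrite fc_em (inj_eq (@bx_inj K)) (negbTE jj') mulr0 mul0r.
Qed.

Lemma int_rkernel_em K (j : {ffun 'I_N -> 'I_(K.*2).+1}) z :
  int_torusC (fun w => em (bx j) w * rkernel K z w) = (vol R N)%:C * ((qc j)%:C * em (bx j) z).
Proof.
have := trig_approx_int K z (CinftyC_em R (bx j)); rewrite trig_approx_em => ->.
by rewrite volCV mulrA divff ?mul1r // volC_neq0.
Qed.

Definition unitz (i : 'I_N) : Z := [ffun k => (k == i)%:Z].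

Lemma em_unitz i z : em (unitz i) z = expi (z 0 i).
Proof.
rewrite em_prod (bigD1 i) //= ffunE eqxx mul1r big1 ?mulr1 // => k ki.
by rewrite ffunE (negbTE ki) mul0r expi0.
Qed.

Definition cidx K (s : 'I_N -> nat) : {ffun 'I_N -> 'I_(K.*2).+1} := [ffun i => inord (s i)].

Lemma cidxE K s i : (s i <= K.*2)%N -> cidx K s i = s i :> nat.
Proof. by move=> h; rewrite ffunE inordK // ltnS. Qed.

Lemma int_rkernel K z : int_torusC (rkernel K z) = (vol R N)%:C.
Proof.
(* The constant index K is the zero frequency, since [bx] subtracts K. *)
pose j := cidx K (fun=> K).
have jK i : j i = K :> nat by apply: cidxE; rewrite -addnn leq_addr.
have b0 : bx j = 0 by apply/ffunP => i; rewrite [LHS]ffunE jK subrr ffunE.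
have q0 : qc j = 1 by apply: big1 => i _; rewrite jK q1K.
have := int_rkernel_em j z; rewrite b0 q0 em0 !mulr1 => <-.
by congr int_torusC; apply/funext => w; rewrite em0 mul1r.
Qed.

Lemma int_rkernel_unitz K i z : (0 < K)%N ->
  int_torusC (fun w => em (unitz i) w * rkernel K z w) =
    (vol R N)%:C * ((1 - K.+1%:R^-1)%:C * em (unitz i) z).
Proof.
(* The unit frequency has index K + 1 in coordinate i; 0 < K keeps this index within 2K. *)
move=> K0; pose j := cidx K (fun k => if k == i then K.+1 else K).
have jE k : j k = (if k == i then K.+1 else K) :> nat.
  apply: cidxE; case: ifP => _; last by rewrite -addnn leq_addr.
  by rewrite -addnn -addn1 leq_add2l.
have bE : bx j = unitz i.
  apply/ffunP => k; rewrite [LHS]ffunE jE ffunE; case: eqP => _; last by rewrite subrr.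
  by rewrite -addn1 PoszD addrAC subrr add0r.
have qE : qc j = 1 - K.+1%:R^-1.
  rewrite /qc (bigD1 i) //= jE eqxx q1S big1 ?mulr1 // => k ki.
  by rewrite jE (negbTE ki) q1K.
by have := int_rkernel_em j z; rewrite bE qE.
Qed.

Lemma Re_rkernel_ge0 K z w : 0 <= complex.Re (rkernel K z w) /\ complex.Im (rkernel K z w) = 0.
Proof. by rewrite /rkernel; have [r r0 ->] := kernel_ge0 K (z - w). Qed.

(** The second moment of the kernel. The weight 1 - cos only involves the frequency 0 and the unit
    frequency, so only the coefficients 1 and 1 - 1 / (K + 1) enter. *)
Lemma int_kernel_cos K i z : (0 < K)%N ->
  int_torus (fun w => (1 - cos (w 0 i - z 0 i)) * complex.Re (rkernel K z w)) =
  vol R N / K.+1%:R.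
Proof.
move=> K0; have ck := CinftyC_rkernel K z.
have -> : int_torus (fun w => (1 - cos (w 0 i - z 0 i)) * complex.Re (rkernel K z w)) =
  complex.Re (int_torusC (fun w => rkernel K z w +
     - em (- unitz i) z * (em (unitz i) w * rkernel K z w))).
  congr int_torus; apply/funext => w; rewrite /re_part cReD mulrA cReM.
  have [_ ->] := Re_rkernel_ge0 K z w.
  rewrite cReM emN !em_unitz mulr0 subr0 cosB !cReN !cImN cReJ cImJ /=; ring.
rewrite intC_add //; last by apply: CinftyC_scale; exact: CinftyC_mul (CinftyC_em _ _) ck.
rewrite intC_scale; last exact: CinftyC_mul (CinftyC_em _ _) ck.
rewrite int_rkernel int_rkernel_unitz //.
have -> : (vol R N)%:C + - em (- unitz i) z * ((vol R N)%:C * ((1 - K.+1%:R^-1)%:C * em (unitz i) z)) =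
  (vol R N)%:C - (vol R N)%:C * (1 - K.+1%:R^-1)%:C * (em (- unitz i) z * em (unitz i) z).
  by ring.
by rewrite -emD addNr em0 mulr1 -RCM -RCB /=; ring.
Qed.

Lemma Cinfty_kernel_cos K i z :
  Cinfty (fun w => (1 - cos (w 0 i - z 0 i)) * complex.Re (rkernel K z w)).
Proof.
apply: CinftyM; last by case: (CinftyC_rkernel K z).
suff -> : (fun w => 1 - cos (w 0 i - z 0 i)) =
  (fun w => 1 - re_part (fun w => em (- unitz i) z * em (unitz i) w) w).
  apply: CinftyB; first exact: Cinfty_cst.
  by case: (CinftyC_scale (em (- unitz i) z) (CinftyC_em R (unitz i))).
apply/funext => w; rewrite /re_part cReM emN !em_unitz cReJ cImJ cosB /=; ring.
Qed.

End Kernel.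

(** * Moduli of continuity measured by 1 - cos *)

Section Oscillation.
Variables (R : realType) (N : nat).
Implicit Types (f : 'rV[R]_N -> R) (z w : 'rV[R]_N).

Lemma cos_2pi_shift (h : R) (m : int) : cos (h + m%:~R * (2 * pi)) = cos h.
Proof.
have := congr1 (@complex.Re R) (expiD h (m%:~R * (2 * pi))).
by rewrite expi_2pi mulr1.
Qed.

(** After reducing h modulo 2 pi to [-pi, pi], a shift of size at most d costs at most e by the
    Lipschitz bound; a larger one is paid for by 1 - cos h, which is then at least 1 - cos d > 0. *)
Lemma oscillation1 f e : Cinfty f -> 0 < e -> exists2 C, 0 <= C &
  forall k z h, `|f (z + h *: evec R k) - f z| <= e + C * (1 - cos h).
Proof.
move=> cf e0; have [M M0 hM] := Cinfty_bound_partial cf.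
pose L := M + 1; have L0 : 0 < L by rewrite ltr_wpDl.
have pi0 := pi_gt0 R.
pose d := Num.min (e / L) pi; have d0 : 0 < d by rewrite lt_min divr_gt0.
have dpi : d <= pi by rewrite ge_min lexx orbT.
have cd : 0 < 1 - cos d.
  by rewrite subr_gt0 -cos0 ltr_cos ?in_itv /= ?lexx ?dpi ?(ltW pi0) ?(ltW d0).
have C0 : 0 <= L * pi / (1 - cos d).
  by rewrite divr_ge0 ?(ltW cd) // mulr_ge0 ?(ltW L0) ?(ltW pi0).
exists (L * pi / (1 - cos d)) => //.
move=> k z h; pose m := - Num.floor ((h + pi) / (2 * pi)).
pose h' := h + m%:~R * (2 * pi).
have [sf pf] := cf.
have -> : f (z + h *: evec R k) = f (z + h' *: evec R k).
  by rewrite /h' scalerDl addrA periodic_int.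
have -> : cos h = cos h' by rewrite /h' cos_2pi_shift.
have hpi : `|h'| <= pi.
  have := Num.Theory.floor_itv ((h + pi) / (2 * pi)).
  rewrite intrD1 ler_pdivlMr ?ltr_pdivrMr ?pi2_gt0 // /h' /m intrN.
  set c := _%:~R => /andP[a b]; rewrite ler_norml; apply/andP; split; first by lra.
  by move: b; rewrite mulrDl mul1r; lra.
have le1 : `|f (z + h' *: evec R k) - f z| <= L * `|h'|.
  apply: MVT_line => // w; apply: le_trans (hM k w) _.
  by rewrite lerDl.
apply: (le_trans le1).
have [hd|dh] := leP `|h'| d.
  rewrite ler_wpDr //.
    by apply: mulr_ge0 => //; rewrite subr_ge0 cos_le1.
  by rewrite mulrC -ler_pdivlMr // (le_trans hd) // ge_min lexx.
rewrite ler_wpDl ?(ltW e0) //.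
apply: (@le_trans _ _ (L * pi)); first by rewrite ler_wpM2l ?(ltW L0).
rewrite mulrAC ler_pdivlMr // ler_wpM2l ?mulr_ge0 ?(ltW L0) ?(ltW pi0) //.
rewrite lerB // -[cos h']cos_norm ltW //.
by rewrite ltr_cos ?in_itv /= ?normr_ge0 ?hpi ?dpi ?(ltW d0).
Qed.

Lemma oscillation f e : Cinfty f -> 0 < e -> exists2 C, 0 <= C &
  forall z w, `|f w - f z| <= e + C * \sum_i (1 - cos (w 0 i - z 0 i)).
Proof.
move=> cf e0; have N1 : (0 : R) < N.+1%:R by rewrite ltr0n.
(* The coordinates are changed one at a time, each step costing e / (N + 1); the denominator is
   positive even when N = 0. *)
have [C C0 hC] := oscillation1 cf (divr_gt0 e0 N1).
exists C => // z w.
have H (s : seq 'I_N) : `|f (z + \sum_(i <- s) (w 0 i - z 0 i) *: evec R i) - f z| <=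
    (size s)%:R * (e / N.+1%:R) + C * \sum_(i <- s) (1 - cos (w 0 i - z 0 i)).
  elim: s => [|i s IH].
    by rewrite !big_nil addr0 subrr normr0 mul0r mulr0 addr0.
  rewrite !big_cons [(w 0 i - z 0 i) *: _ + _]addrC addrA.
  set y := z + _ in IH *.
  rewrite -[f (y + _)](subrK (f y)) -addrA.
  apply: (le_trans (ler_normD _ _)).
  apply: le_trans (lerD (hC i y _) IH) _.
  by rewrite le_eqVlt; apply/orP; left; apply/eqP; rewrite /= -[in RHS]natr1; ring.
have := H (index_enum 'I_N).
have -> : z + \sum_i (w 0 i - z 0 i) *: evec R i = w.
  apply/rowP => j; rewrite mxE summxE (bigD1 j) //= big1 => [|i ij].
    by rewrite !mxE !eqxx mulr1n mulr1 addr0 addrC subrK.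
  by rewrite !mxE eqxx eq_sym (negbTE ij) mulr0n mulr0.
move=> /le_trans; apply; rewrite lerD2r.
have -> : size (index_enum 'I_N) = N by rewrite -[RHS]size_enum_ord enumT.
by rewrite mulrCA ler_piMr ?(ltW e0) // ler_pdivrMr // mul1r ler_nat.
Qed.

Lemma Cinfty_sum (I : Type) (r : seq I) (F : I -> 'rV[R]_N -> R) :
  (forall i, Cinfty (F i)) -> Cinfty (fun z => \sum_(i <- r) F i z).
Proof.
move=> cF; elim: r => [|i r IH].
  suff -> : (fun z => \sum_(i <- [::]) F i z) = fun=> 0 by exact: Cinfty_cst.
  by apply/funext => z; rewrite big_nil.
suff -> : (fun z => \sum_(i <- i :: r) F i z) = fun z => F i z + \sum_(i <- r) F i z.
  exact: CinftyD.
by apply/funext => z; rewrite big_cons.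
Qed.

Lemma int_torus_sum (I : Type) (r : seq I) (F : I -> 'rV[R]_N -> R) :
  (forall i, Cinfty (F i)) ->
  int_torus (fun z => \sum_(i <- r) F i z) = \sum_(i <- r) int_torus (F i).
Proof.
move=> cF; elim: r => [|i r IH].
  have -> : (fun z => \sum_(i <- [::]) F i z) = fun=> 0.
    by apply/funext => z; rewrite big_nil.
  by rewrite int_torus_cst mul0r big_nil.
have -> : (fun z => \sum_(i <- i :: r) F i z) = fun z => F i z + \sum_(i <- r) F i z.
  by apply/funext => z; rewrite big_cons.
rewrite int_torusD ?IH ?big_cons //; first exact: Cinfty_lipc.
exact/Cinfty_lipc/Cinfty_sum.
Qed.

End Oscillation.

(** * Uniform approximation; functionals are controlled by their values on modes *)

Section Density.
Variables (R : realType) (N : nat).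
Local Notation Z := {ffun 'I_N -> int}.
Implicit Types (phi psi : 'rV[R]_N -> R[i]) (u v : functional R N).

(** Korovkin's argument: the kernel is nonnegative of mass [vol], the oscillation of phi is at most
    e / 4 plus C times a sum of terms 1 - cos, and integrating these against the kernel gives [vol]
    N / (K + 1). *)
Lemma trig_approx_cvg phi e : CinftyC phi -> 0 < e -> exists K0, forall K, (K0 <= K)%N ->
  forall z, normc (phi z - trig_approx K phi z) <= e.
Proof.
move=> cp e0; have [cr ci] := cp.
have e8 : 0 < e / 8 by rewrite divr_gt0.
have [C1 C10 h1] := oscillation cr e8; have [C2 C20 h2] := oscillation ci e8.
pose C := C1 + C2; have C0 : 0 <= C by rewrite addr_ge0.
have hC z w : normc (phi w - phi z) <= e / 4 + C * \sum_i (1 - cos (w 0 i - z 0 i)).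
  apply: (le_trans (normc_le_ReIm _)).
  rewrite cReD cImD cReN cImN; apply: le_trans (lerD (h1 z w) (h2 z w)) _.
  by rewrite le_eqVlt; apply/orP; left; apply/eqP; rewrite /C; field.
have v0 := vol_gt0 R N.
(* From this index on C N / (K + 1) <= e / 4. Together with the other e / 4 this makes e / 2, and
   [normc_int_le] doubles it. *)
exists (Num.truncn (4 * C * N%:R / e)).+1 => K hK z.
have K0 : (0 < K)%N by exact: leq_trans hK.
have K1 : (0 : R) < K.+1%:R by rewrite ltr0n.
have ck := CinftyC_rkernel K z.
rewrite -normcN opprB trig_approx_int //.
have -> : phi z = ((vol R N)^-1)%:C * int_torusC (fun w => phi z * rkernel K z w).
  by rewrite intC_scale // int_rkernel mulrCA volCV mulVf ?mulr1 // volC_neq0.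
rewrite -mulrBr -intC_sub; last 2 first.
- exact: CinftyC_mul.
- exact: CinftyC_scale.
pose g w := e / 4 * complex.Re (rkernel K z w) +
   C * \sum_i ((1 - cos (w 0 i - z 0 i)) * complex.Re (rkernel K z w)).
have crk : Cinfty (fun w => complex.Re (rkernel K z w)) by case: ck.
have cs : Cinfty (fun w => \sum_i ((1 - cos (w 0 i - z 0 i)) * complex.Re (rkernel K z w))).
  by apply: Cinfty_sum => i; exact: Cinfty_kernel_cos.
have cg : Cinfty g.
  by apply: CinftyD; apply: CinftyM => //; exact: Cinfty_cst.
have ig : int_torus g = vol R N * (e / 4 + C * N%:R / K.+1%:R).
  rewrite int_torusD; [|by apply/lipcZ/Cinfty_lipc..].
  rewrite !int_torusZ; [|exact: Cinfty_lipc..].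
  rewrite int_torus_sum; last by move=> i; exact: Cinfty_kernel_cos.
  under eq_bigr do rewrite int_kernel_cos //.
  rewrite sumr_const card_ord.
  have -> : int_torus (fun w => complex.Re (rkernel K z w)) = vol R N.
    by have := congr1 (@complex.Re R) (int_rkernel K z).
  by rewrite -mulr_natr; ring.
rewrite normcM normc_real ger0_norm ?invr_ge0 ?(ltW v0) //.
rewrite ler_pdivrMl //.
have H : normc (int_torusC (fun w => phi w * rkernel K z w - phi z * rkernel K z w)) <= 2 * int_torus g.
  apply: normc_int_le => //.
    by apply: CinftyC_sub; [exact: CinftyC_mul|exact: CinftyC_scale].
  move=> w; rewrite -mulrBl normcM.
  have [r0 i0] := Re_rkernel_ge0 K z w.
  have -> : normc (rkernel K z w) = complex.Re (rkernel K z w).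
    by rewrite -[RHS]ger0_norm // -normc_real; congr normc; apply: complex_eq.
  rewrite /g -mulr_suml mulrA -mulrDl; apply: ler_wpM2r => //; exact: hC.
apply: (le_trans H); rewrite ig.
have : C * N%:R / K.+1%:R <= e / 4.
  rewrite ler_pdivrMr //.
  have h : 4 * C * N%:R / e < K%:R.
    by apply: lt_le_trans (truncnS_gt _) _; rewrite ler_nat.
  move: h; rewrite ltr_pdivrMr // => h.
  have : K%:R * e <= K.+1%:R * e by rewrite ler_wpM2r ?(ltW e0) // ler_nat.
  by lra.
move=> h; rewrite mulrCA; apply: ler_wpM2l; first exact: ltW.
by move: (C * N%:R / K.+1%:R) h => x h; lra.
Qed.

Lemma dC_trig_approx K k phi : CinftyC phi ->
  dC k (trig_approx K phi) = trig_approx K (dC k phi).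
Proof.
move=> cp; rewrite /trig_approx dC_sum; last first.
  by move=> j; apply: CinftyC_scale; exact: CinftyC_em.
apply/funext => z; apply: eq_bigr => j _.
rewrite dC_scale ?dC_em ?fc_dC //; last exact: CinftyC_em.
by ring.
Qed.

Lemma CinftyC_trig_approx K phi : CinftyC (trig_approx K phi).
Proof. by apply: CinftyC_sum => j; apply: CinftyC_scale; exact: CinftyC_em. Qed.

Lemma partialsC_trig_approx K s phi : CinftyC phi ->
  partialsC s (trig_approx K phi) = trig_approx K (partialsC s phi).
Proof.
move=> cp; elim: s => [|k s IH]; first by rewrite !partialsC_nil.
by rewrite !partialsC_cons IH dC_trig_approx //; exact: CinftyC_partials.
Qed.

Lemma partialsC_add s phi psi : CinftyC phi -> CinftyC psi ->
  partialsC s (fun z => phi z + psi z) = fun z => partialsC s phi z + partialsC s psi z.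
Proof.
move=> cp cs; elim: s => [|k s IH]; first by rewrite !partialsC_nil.
by rewrite !partialsC_cons IH dC_add //; exact: CinftyC_partials.
Qed.

Lemma partialsC_scale s (c : R[i]) phi : CinftyC phi ->
  partialsC s (fun z => c * phi z) = fun z => c * partialsC s phi z.
Proof.
move=> cp; elim: s => [|k s IH]; first by rewrite !partialsC_nil.
by rewrite !partialsC_cons IH dC_scale //; exact: CinftyC_partials.
Qed.

Lemma partialsC_sub s phi psi : CinftyC phi -> CinftyC psi ->
  partialsC s (fun z => phi z - psi z) = fun z => partialsC s phi z - partialsC s psi z.
Proof.
move=> cp cs; elim: s => [|k s IH]; first by rewrite !partialsC_nil.
by rewrite !partialsC_cons IH dC_sub //; exact: CinftyC_partials.
Qed.

(** Convergence to 0 in the topology of C^infty. *)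
Definition tends0 (psi : nat -> 'rV[R]_N -> R[i]) : Prop :=
  forall s e, 0 < e -> exists K0, forall K, (K0 <= K)%N ->
    forall z, normc (partialsC s (psi K) z) <= e.

Lemma tends0_trig_approx phi : CinftyC phi ->
  tends0 (fun K z => phi z - trig_approx K phi z).
Proof.
move=> cp s e e0.
have [K0 hK] := trig_approx_cvg (CinftyC_partials s cp) e0.
exists K0 => K /hK h z; rewrite partialsC_sub //; last exact: CinftyC_trig_approx.
by rewrite partialsC_trig_approx.
Qed.

Definition linearC u : Prop := forall (c : R[i]) phi psi, CinftyC phi -> CinftyC psi ->
  u (fun z => c * phi z + psi z) = c * u phi + u psi.

(* Sequential continuity is all that is used of a distribution once its order
   has been recorded; unlike is_distribution it is obviously a linear property. *)
Definition wdist u : Prop := linearC u /\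
  forall psi : nat -> 'rV[R]_N -> R[i], (forall K, CinftyC (psi K)) -> tends0 psi ->
  forall e, 0 < e -> exists K0, forall K, (K0 <= K)%N -> normc (u (psi K)) <= e.

Lemma Cm_norm_le m phi e : 0 <= e ->
  (forall s : {bseq m of 'I_N}, forall z, normc (partialsC s phi z) <= e) ->
  Cm_norm m phi <= #|{bseq m of 'I_N}|%:R * e.
Proof.
move=> e0 h; rewrite /Cm_norm mulr_natl -sumr_const; apply: ler_sum => s _.
apply: ge_sup; first by exists (normc (partialsC s phi 0)), 0.
by move=> _ [z _ <-]; exact: h.
Qed.

Lemma Cm_norm_ge0 m phi : 0 <= Cm_norm m phi.
Proof.
apply: sumr_ge0 => s _; set S := [set _ | _ in _].
(* Outside [has_sup] the value of [sup] is 0 by convention. *)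
have [hS|hS] := pselect (has_sup S); last by rewrite sup_out.
apply: le_trans (normc_ge0 (partialsC s phi 0)) _.
by apply: ub_le_sup; [case: hS|exists 0].
Qed.

Lemma is_distribution_wdist u : is_distribution u -> wdist u.
Proof.
move=> [lu [m [C hC]]]; split => // psi cpsi tpsi e e0.
pose B : R := #|{bseq m of 'I_N}|%:R.
have B0 : 0 <= B by [].
(* The absolute value and the shifts by 1 make the denominator positive whatever the sign of C. *)
have D0 : 0 < (`|C| + 1) * (B + 1) by rewrite mulr_gt0 // ltr_wpDl.
have /choice[K0 hK0] : forall s : {bseq m of 'I_N}, exists K0, forall K, (K0 <= K)%N ->
    forall z, normc (partialsC s (psi K) z) <= e / ((`|C| + 1) * (B + 1)).
  by move=> s; apply: tpsi; exact: divr_gt0.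
exists (\max_s K0 s) => K hK.
apply: le_trans (hC _ (cpsi K)) _.
have H : Cm_norm m (psi K) <= B * (e / ((`|C| + 1) * (B + 1))).
  apply: Cm_norm_le; first by rewrite ltW // divr_gt0.
  move=> s z; apply: hK0; apply: leq_trans hK; exact: leq_bigmax.
have Cm0 : 0 <= Cm_norm m (psi K).
  exact: Cm_norm_ge0.
apply: (@le_trans _ _ ((`|C| + 1) * Cm_norm m (psi K))).
  by rewrite ler_wpM2r // (le_trans (ler_norm C)) // lerDl.
apply: (le_trans (ler_wpM2l _ H)); first by rewrite addr_ge0.
have -> : (`|C| + 1) * (B * (e / ((`|C| + 1) * (B + 1)))) = e * (B / (B + 1)).
  by field; rewrite !gt_eqF // ltr_wpDl.
by rewrite ler_piMr ?(ltW e0) // ler_pdivrMr ?ltr_wpDl // mul1r lerDl.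
Qed.

Lemma linearC_add u phi psi : linearC u -> CinftyC phi -> CinftyC psi ->
  u (fun z => phi z + psi z) = u phi + u psi.
Proof.
move=> lu cp cs; rewrite -[u phi]mul1r -lu //.
by congr u; apply/funext => z; rewrite mul1r.
Qed.

Lemma linearC0 u : linearC u -> u (fun=> 0) = 0.
Proof.
move=> lu; have c0 := CinftyC_cst N (0 : R[i]).
have := linearC_add lu c0 c0.
have -> : (fun _ : 'rV[R]_N => (0 : R[i]) + 0) = fun=> 0 by apply/funext => z; rewrite addr0.
by move=> /eqP; rewrite -subr_eq0 opprD addNKr oppr_eq0 => /eqP.
Qed.

Lemma linearC_scale u (c : R[i]) phi : linearC u -> CinftyC phi ->
  u (fun z => c * phi z) = c * u phi.
Proof.
move=> lu cp; have c0 := CinftyC_cst N (0 : R[i]).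
have := lu c _ _ cp c0; rewrite linearC0 // addr0 => <-.
by congr u; apply/funext => z; rewrite addr0.
Qed.

Lemma linearC_sub u phi psi : linearC u -> CinftyC phi -> CinftyC psi ->
  u (fun z => phi z - psi z) = u phi - u psi.
Proof.
move=> lu cp cs; rewrite linearC_add //; last exact: CinftyC_opp.
congr (_ + _); rewrite -mulN1r -linearC_scale //.
by congr u; apply/funext => z; rewrite mulN1r.
Qed.

Lemma linearC_sum u (I : Type) (r : seq I) (P : pred I) (F : I -> 'rV[R]_N -> R[i]) :
  linearC u -> (forall i, CinftyC (F i)) ->
  u (fun z => \sum_(i <- r | P i) F i z) = \sum_(i <- r | P i) u (F i).
Proof.
move=> lu cF; elim: r => [|i r IH].
  have -> : (fun z => \sum_(i <- [::] | P i) F i z) = fun=> 0.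
    by apply/funext => z; rewrite big_nil.
  by rewrite linearC0 // big_nil.
case Pi : (P i).
  have -> : (fun z => \sum_(i <- i :: r | P i) F i z) =
      fun z => F i z + \sum_(i <- r | P i) F i z.
    by apply/funext => z; rewrite big_cons Pi.
  rewrite linearC_add //; last exact: CinftyC_sum.
  by rewrite IH big_cons Pi.
have -> : (fun z => \sum_(i <- i :: r | P i) F i z) = fun z => \sum_(i <- r | P i) F i z.
  by apply/funext => z; rewrite big_cons Pi.
by rewrite IH big_cons Pi.
Qed.

(** u phi is the limit of u on the trigonometric approximations of phi, whose damping weights lie
    between 0 and 1. This reduces bounds on functionals to bounds on modes. *)
Lemma wdist_le u phi M : wdist u -> CinftyC phi ->
  (forall K, \sum_j normc (fc phi (@bx N K j)) * normc (u (em (bx j))) <= M) ->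
  normc (u phi) <= M.
Proof.
move=> [lu cu] cp hM; apply/ler_addgt0Pl => e e0.
have [K0 hK] := cu _ (fun K => CinftyC_sub cp (CinftyC_trig_approx K phi))
  (tends0_trig_approx cp) e e0.
have := hK K0 (leqnn _); rewrite linearC_sub //; last exact: CinftyC_trig_approx.
set x := u phi; set y := u _ => hxy.
rewrite -(subrK y x); apply: (le_trans (normcD _ _)); rewrite lerD //.
apply: le_trans (hM K0).
rewrite /y /trig_approx linearC_sum //; last first.
  by move=> j; apply: CinftyC_scale; exact: CinftyC_em.
apply: (le_trans (normc_sum _ _ _)); apply: ler_sum => j _.
rewrite linearC_scale //; last exact: CinftyC_em.
rewrite normcM normcM normc_real ger0_norm ?qc_ge0 // -mulrA ler_piMl ?qc_le1 //.
by apply: mulr_ge0; exact: normc_ge0.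
Qed.

(** The uniqueness principle used throughout: applied to a difference of two functionals, it only
    compares them on modes present in phi. *)
Lemma wdist_eq0 u phi : wdist u -> CinftyC phi ->
  (forall th, fc phi th = 0 \/ u (em th) = 0) -> u phi = 0.
Proof.
move=> wu cp h; apply: normc_eq0; apply/eqP; rewrite eq_le normc_ge0 andbT.
apply: (wdist_le wu cp) => K; rewrite big1 // => j _.
by case: (h (bx j)) => ->; rewrite ComplexField.Normc.normc0 ?mul0r ?mulr0.
Qed.

Lemma wdist_sub u v : wdist u -> wdist v -> wdist (fun phi => u phi - v phi).
Proof.
move=> [lu cu] [lv cv]; split.
  by move=> c phi psi cp cs; rewrite lu // lv //; ring.
move=> psi cpsi tpsi e e0; have e2 : 0 < e / 2 by rewrite divr_gt0.
have [K1 h1] := cu psi cpsi tpsi _ e2; have [K2 h2] := cv psi cpsi tpsi _ e2.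
exists (maxn K1 K2) => K; rewrite geq_max => /andP[/h1 a /h2 b].
by apply: (le_trans (normcB _ _)); lra.
Qed.

Lemma wdist_eval z : wdist (fun phi => phi z).
Proof.
split=> // psi _ tpsi e e0; have [K0 h] := tpsi [::] e e0.
by exists K0 => K /h /(_ z); rewrite partialsC_nil.
Qed.

Lemma wdist_int (F : 'rV[R]_N -> R[i]) : CinftyC F ->
  wdist (fun phi => int_torusC (fun z => F z * phi z)).
Proof.
move=> cF; split.
  move=> c phi psi cp cs.
  have -> : (fun z => F z * (c * phi z + psi z)) = fun z => c * (F z * phi z) + F z * psi z.
    by apply/funext => z; ring.
  have cFp := CinftyC_mul cF cp.
  by rewrite (intC_add (CinftyC_scale c cFp) (CinftyC_mul cF cs)) (intC_scale c cFp).
move=> psi cpsi tpsi e e0.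
have [M M0 hM] := CinftyC_bounded cF.
have v0 := vol_gt0 R N.
have D0 : 0 < 2 * (M + 1) * vol R N by rewrite !mulr_gt0 // ltr_wpDl.
have [K0 h] := tpsi [::] _ (divr_gt0 e0 D0).
exists K0 => K /h hK.
apply: le_trans (normc_int_cst (CinftyC_mul cF (cpsi K)) (M := (M + 1) * (e / (2 * (M + 1) * vol R N))) _) _.
  move=> z; rewrite normcM ler_pM ?normc_ge0 //.
    by rewrite (le_trans (hM z)) // lerDl.
  by have := hK z; rewrite partialsC_nil.
rewrite -/(vol R N) le_eqVlt; apply/orP; left; apply/eqP; field.
by rewrite !gt_eqF // ltr_wpDl.
Qed.

(** Evaluation at a point is a continuous functional, so uniqueness for functionals yields
    uniqueness for functions. *)
Lemma fc_inj phi psi : CinftyC phi -> CinftyC psi ->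
  (forall th, fc phi th = fc psi th) -> phi = psi.
Proof.
move=> cp cs h; apply/funext => z; apply/eqP; rewrite -subr_eq0; apply/eqP.
apply: (wdist_eq0 (wdist_eval z) (CinftyC_sub cp cs)) => th.
by left; rewrite fc_sub // h subrr.
Qed.

(** Mixed derivatives have the same Fourier coefficients, because the multipliers i th_j and i th_k
    commute. *)
Lemma dC_comm j k phi : CinftyC phi -> dC j (dC k phi) = dC k (dC j phi).
Proof.
move=> cp; have cj := CinftyC_dC j cp; have ck := CinftyC_dC k cp.
apply: fc_inj; [exact: CinftyC_dC..|move=> th].
apply: (eq_trans (fc_dC j th ck)); apply: (eq_trans _ (esym (fc_dC k th cj))).
have -> := fc_dC k th cp; have -> := fc_dC j th cp; exact: mulrCA.
Qed.

End Density.

(** * Fourier series with rapidly decreasing coefficients *)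

Section UniformLimits.
Variables (R : realType) (N : nat).
Implicit Types (f : nat -> 'rV[R]_N -> R) (z : 'rV[R]_N).

Lemma cauchy_limit (u : nat -> R) :
  (forall e, 0 < e -> exists K0, forall K L, (K0 <= K)%N -> (K0 <= L)%N -> `|u K - u L| <= e) ->
  exists l : R, u @ \oo --> l.
Proof.
move=> hu; suff /cvg_ex : cvg (u @ \oo) by [].
apply/cauchy_cvgP; apply: cauchy_exP => e e0.
have [K0 hK] := hu _ (divr_gt0 e0 (@ltr0n R 2)).
exists (u K0); exists K0 => //= K /= hK'.
rewrite /ball /=; apply: le_lt_trans (hK K0 K (leqnn _) hK') _.
by rewrite ltr_pdivrMr // ltr_pMr // ltr1n.
Qed.

Lemma uniform_limit f :
  (forall e, 0 < e -> exists K0, forall K L, (K0 <= K)%N -> (K0 <= L)%N ->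
     forall z, `|f K z - f L z| <= e) ->
  exists F, forall e, 0 < e -> exists K0, forall K, (K0 <= K)%N ->
     forall z, `|f K z - F z| <= e.
Proof.
move=> hf; have /choice[F hF] : forall z, exists l : R, (fun K => f K z) @ \oo --> l.
  move=> z; apply: cauchy_limit => e /hf[K0 h].
  by exists K0 => K L a b; exact: h.
exists F => e e0; have [K0 h] := hf e e0; exists K0 => K hK z.
apply/ler_addgt0Pl => d d0; have /cvgrPdist_le/(_ d d0)[L0 _ hL] := hF z.
have := hL (maxn L0 K0) (leq_maxl _ _); have := h K (maxn L0 K0) hK (leq_maxr _ _) z.
rewrite !ler_norml => /andP[? ?] /andP[? ?].
by apply/andP; split; lra.
Qed.

(** The difference quotient of the limit G s is compared with that of f_K. The mean value theorem
    applied to f_K - f_L, whose derivative is uniformly small, makes the comparison uniform in L,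
    and L then tends to infinity. *)
Lemma smooth_limit f :
  (forall K, Cinfty (f K)) ->
  (forall s e, 0 < e -> exists K0, forall K L, (K0 <= K)%N -> (K0 <= L)%N ->
     forall z, `|partials s (f K) z - partials s (f L) z| <= e) ->
  exists2 F, Cinfty F & forall s e, 0 < e -> exists K0, forall K, (K0 <= K)%N ->
     forall z, `|partials s (f K) z - partials s F z| <= e.
Proof.
move=> cf hf.
have /choice[G hG] s := uniform_limit (hf s).
have cts s K : Cinfty (partials s (f K)) by exact: Cinfty_partials.
have dG s k z : is_derive z (evec R k) (G s) (G (k :: s) z).
  apply/is_deriveP => e e0; have e4 : 0 < e / 4 by rewrite divr_gt0.
  have [K1 h1] := hf (k :: s) _ e4; have [K2 h2] := hG (k :: s) _ e4.
  pose K := maxn K1 K2.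
  have [r r0 hr] : exists2 r : R, 0 < r & forall h : R, `|h| < r ->
      `|partials s (f K) (h *: evec R k + z) - partials s (f K) z -
        h *: partials (k :: s) (f K) z| <= e / 4 * `|h|.
    have [sK _] := cts s K.
    by have /is_deriveP/(_ _ e4) := is_derive_smooth k z sK.
  exists r => // h hh.
  apply/ler_addgt0Pl => d d0; have d2 : 0 < d / 2 by rewrite divr_gt0.
  (* K and r are already fixed; only L depends on the extra error d, which is arbitrary. *)
  have [K3 h3] := hG s _ d2; pose L := maxn K3 K1.
  have mvt : `|(partials s (f K) (z + h *: evec R k) - partials s (f L) (z + h *: evec R k)) -
      (partials s (f K) z - partials s (f L) z)| <= e / 4 * `|h|.
    have [sK _] := cts s K; have [sL _] := CinftyN (cts s L).
    apply: (@MVT_line _ _ (fun z => partials s (f K) z + - partials s (f L) z)).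
      exact: smoothD.
    move=> w; rewrite partialD //.
    have -> : partial k (fun z => - partials s (f L) z) w = - partials (k :: s) (f L) w.
      have [sL' _] := cts s L.
      have -> : (fun z => - partials s (f L) z) = fun z => -1 * partials s (f L) z.
        by apply/funext => y; rewrite mulN1r.
      by rewrite partialZ // mulN1r.
    by apply: h1; [exact: leq_maxl|exact: leq_maxr].
  have a1 := h3 L (leq_maxl _ _) (h *: evec R k + z); have a2 := h3 L (leq_maxl _ _) z.
  have a3 := hr h hh; have a4 := h2 K (leq_maxr _ _) z.
  rewrite [z + _]addrC in mvt.
  set w := h *: evec R k + z in mvt a1 a3 *.
  have E x : h *: x = h * x by [].
  have a5 : `|h * (partials (k :: s) (f K) z - G (k :: s) z)| <= `|h| * (e / 4).
    by rewrite normrM ler_wpM2l.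
  rewrite !E in a3 *.
  move: a1 a2 a3 a5 mvt; rewrite !ler_norml.
  move=> /andP[? ?] /andP[? ?] /andP[? ?] /andP[? ?] /andP[? ?].
  have : 0 <= e * `|h| by rewrite mulr_ge0 // ltW.
  by move=> ?; apply/andP; split; lra.
have GE s : partials s (G [::]) = G s.
  elim: s => // k s IH; rewrite /= IH; apply/funext => z.
  by case: (dG s k z).
exists (G [::]).
  split; last first.
    move=> k z; apply/eqP; rewrite -subr_eq0 -normr_le0.
    apply/ler_addgt0Pl => e e0; rewrite addr0.
    have [K0 h] := hG [::] _ (divr_gt0 e0 (@ltr0n R 2)).
    have a := h K0 (leqnn _) z; have := h K0 (leqnn _) (z + (2 * pi) *: evec R k).
    have [_ pK] := cf K0; rewrite /= pK /= in a *.
    move: a; rewrite !ler_norml => /andP[? ?] /andP[? ?].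
    by apply/andP; split; lra.
  move=> s; rewrite GE; split; last by move=> k z; case: (dG s k z).
  move=> z; apply: (proj2 (cvgrPdist_le (FF := nbhs_filter z) _ _)) => e e0.
  have e3 : 0 < e / 3 by rewrite divr_gt0.
  have [K0 h] := hG s _ e3.
  have cK : continuous (partials s (f K0)) by have [sK _] := cts s K0; exact: smooth_continuous.
  have /cvgrPdist_le/(_ _ e3) := cK z.
  apply: (@filterS _ (nbhs z)) => w hw.
  have a := h K0 (leqnn _) z; have b := h K0 (leqnn _) w.
  move: a b hw; rewrite !ler_norml => /andP[? ?] /andP[? ?] /andP[? ?].
  by apply/andP; split; lra.
by move=> s e e0; have [K0 h] := hG s e e0; exists K0 => K hK z; rewrite GE; exact: h.
Qed.


End UniformLimits.

Section UniformLimitsC.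
Variables (R : realType) (N : nat).

Lemma smooth_limitC (f : nat -> 'rV[R]_N -> R[i]) :
  (forall K, CinftyC (f K)) ->
  (forall s e, 0 < e -> exists K0, forall K L, (K0 <= K)%N -> (K0 <= L)%N ->
     forall z, normc (partialsC s (f K) z - partialsC s (f L) z) <= e) ->
  exists2 F, CinftyC F & tends0 (fun K z => f K z - F z).
Proof.
move=> cf hf.
have [G cG hG] : exists2 F, Cinfty F & forall s e, 0 < e -> exists K0, forall K, (K0 <= K)%N ->
    forall z, `|partials s (re_part (f K)) z - partials s F z| <= e.
  apply: smooth_limit => [K|s e /(hf s)[K0 h]]; first by case: (cf K).
  exists K0 => K L hK hL z; apply: le_trans (h K L hK hL z).
  by apply: le_trans (normc_Re _); rewrite cReD cReN.
have [H cH hH] : exists2 F, Cinfty F & forall s e, 0 < e -> exists K0, forall K, (K0 <= K)%N ->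
    forall z, `|partials s (im_part (f K)) z - partials s F z| <= e.
  apply: smooth_limit => [K|s e /(hf s)[K0 h]]; first by case: (cf K).
  exists K0 => K L hK hL z; apply: le_trans (h K L hK hL z).
  by apply: le_trans (normc_Im _); rewrite cImD cImN.
have cF : CinftyC (fun z => G z +i* H z) by split.
exists (fun z => G z +i* H z) => // s e e0.
have e2 : 0 < e / 2 by rewrite divr_gt0.
have [K1 h1] := hG s _ e2; have [K2 h2] := hH s _ e2.
exists (maxn K1 K2) => K; rewrite geq_max => /andP[a b] z.
rewrite partialsC_sub //; apply: (le_trans (normc_le_ReIm _)).
rewrite cReD cImD cReN cImN.
by have := lerD (h1 K a z) (h2 K b z); rewrite -splitr.
Qed.

End UniformLimitsC.

(** * Summation over the frequency lattice and Fourier inversion *)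

Section LatticeSums.
Variables (R : realType).

Lemma sum_inv_sq (a : int) M :
  \sum_(l < M) ((1 + `|(l%:Z + a)%:~R : R|) ^+ 2)^-1 <= 3.
Proof.
(* H is an increasing function on the integers with values in [0, 3] whose
   increments dominate the terms of the sum. *)
pose H (m : int) : R := match m with Posz n => 3 - n.+1%:R^-1 | Negz n => n.+1%:R^-1 end.
have inv_le1 n : n.+1%:R^-1 <= 1 :> R by rewrite invf_le1 ?ltr0n // ler1n.
have inv_ge0 n : 0 <= n.+1%:R^-1 :> R by rewrite invr_ge0.
have Hb m : 0 <= H m <= 3.
  case: m => n /=; last by rewrite inv_ge0 (le_trans (inv_le1 n)) // ler1n.
  by move: (n.+1%:R^-1) (inv_le1 n) (inv_ge0 n) => x ? ?; apply/andP; split; lra.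
have key n : ((1 + n.+1%:R) ^+ 2)^-1 <= n.+1%:R^-1 - n.+2%:R^-1 :> R.
  have n1 : (0 : R) < n.+1%:R by rewrite ltr0n.
  have n2 : (0 : R) < n.+2%:R by rewrite ltr0n.
  have -> : 1 + n.+1%:R = n.+2%:R :> R by rewrite -[n.+2%:R]natr1 addrC.
  have -> : n.+1%:R^-1 - n.+2%:R^-1 = (n.+1%:R * n.+2%:R)^-1 :> R.
    by rewrite -[n.+2%:R]natr1 in n2 *; field; rewrite !gt_eqF.
  rewrite lef_pV2 ?posrE ?exprn_gt0 ?mulr_gt0 // expr2 ler_wpM2r ?(ltW n2) //.
  by rewrite ler_nat.
have Hs m : ((1 + `|m%:~R : R|) ^+ 2)^-1 <= H m - H (m - 1).
  case: m => [[|n]|n].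
  - by rewrite /= normr0 addr0 expr1n invr1; lra.
  - have -> : (Posz n.+1 - 1 = Posz n)%R by lia.
    rewrite /= -pmulrn ger0_norm //; apply: le_trans (key n) _.
    by move: (n.+1%:R^-1) (n.+2%:R^-1) => x y; lra.
  - have -> : (Negz n - 1 = Negz n.+1)%R by lia.
    rewrite /= NegzE mulrNz normrN -pmulrn ger0_norm //; exact: key.
have S : \sum_(l < M) ((1 + `|(l%:Z + a)%:~R : R|) ^+ 2)^-1 <= H (M%:Z + a - 1) - H (a - 1).
  elim: M => [|M IH]; first by rewrite big_ord0 add0r subrr.
  rewrite big_ord_recr /=; apply: le_trans (lerD IH (Hs _)) _.
  have -> : (M.+1%:Z + a - 1 = M%:Z + a)%R by lia.
  by rewrite le_eqVlt; apply/orP; left; apply/eqP; ring.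
apply: (le_trans S); have /andP[_ h1] := Hb (M%:Z + a - 1); have /andP[h2 _] := Hb (a - 1).
lra.
Qed.

Variable N : nat.
Local Notation Z := {ffun 'I_N -> int}.
Implicit Types th et : Z.

Lemma wt_add th et : wt R (th + et) <= wt R th * wt R et.
Proof.
rewrite /wt mulrDl mul1r mulrDr mulr1 -addrA lerD2l.
apply: (@le_trans _ _ (\sum_i (`|(th i)%:~R| + `|(et i)%:~R|))).
  by apply: ler_sum => i _; rewrite ffunE rmorphD ler_normD.
rewrite big_split /= addrC lerD2l lerDl mulr_ge0 // sumr_ge0 //.
Qed.

Lemma prod_le_wt th : \prod_(i < N) (1 + `|(th i)%:~R : R|) ^+ 2 <= wt R th ^+ (2 * N).
Proof.
have -> : wt R th ^+ (2 * N) = \prod_(i < N) wt R th ^+ 2.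
  by rewrite prodr_const card_ord exprM.
apply: ler_prod => i _.
rewrite exprn_ge0 ?addr_ge0 //=; apply: lerXn2r.
- by rewrite nnegrE addr_ge0.
- by rewrite nnegrE; exact: ltW (wt_gt0 _ _).
by rewrite /wt lerD2l (bigD1 i) //= lerDl sumr_ge0.
Qed.

(** The power 2N of the weight dominates a product of N factors (1 + |.|)^2, so the sum splits into
    one-dimensional ones, each at most 3. The bound depends neither on K nor on the translation. *)
Lemma lattice_sum K et :
  \sum_j (wt R (@bx N K j + et) ^+ (2 * N))^-1 <= 3 ^+ N.
Proof.
have h j : (wt R (@bx N K j + et) ^+ (2 * N))^-1 <=
    \prod_(i < N) ((1 + `|((j i)%:Z + (et i - K%:Z))%:~R : R|) ^+ 2)^-1.
  rewrite prodfV lef_pV2 ?posrE; last 2 first.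
  - by rewrite exprn_gt0 // wt_gt0.
  - by apply: prodr_gt0 => i _; rewrite exprn_gt0 // ltr_wpDr.
  apply: le_trans (prod_le_wt _); rewrite le_eqVlt; apply/orP; left; apply/eqP.
  by apply: eq_bigr => i _; rewrite !ffunE addrAC addrA.
apply: (le_trans (ler_sum _ (fun j _ => h j))).
rewrite -(bigA_distr_bigA (fun i (l : 'I_(K.*2).+1) => ((1 + `|(l%:Z + (et i - K%:Z))%:~R : R|) ^+ 2)^-1)) /=.
have -> : 3 ^+ N = \prod_(i < N) (3 : R) by rewrite prodr_const card_ord.
apply: ler_prod => i _.
rewrite sum_inv_sq andbT; apply: sumr_ge0 => l _.
by rewrite invr_ge0 exprn_ge0 // addr_ge0.
Qed.

(** The same cube as a list of frequencies, for which inclusion and complement make sense as K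
    varies. *)
Definition box K : seq Z := [seq bx j | j : {ffun 'I_N -> 'I_(K.*2).+1}].

Lemma box_uniq K : uniq (box K).
Proof. by rewrite map_inj_uniq ?enum_uniq //; exact: bx_inj. Qed.

Lemma mem_box K th : (th \in box K) = [forall i, `|th i| <= K%:Z].
Proof.
apply/mapP/forallP => [[j _ ->] i|h].
  rewrite ffunE ler_norml; have := ltn_ord (j i); move: (nat_of_ord (j i)) => m mK.
  by apply/andP; split; lia.
exists [ffun i => inord (absz (th i + K%:Z))]; first by rewrite mem_enum.
apply/ffunP => i; rewrite !ffunE; have := h i; rewrite ler_norml => /andP[h1 h2].
have h0 : 0 <= th i + K%:Z by rewrite -lerBlDr sub0r.
have hm := gez0_abs h0; rewrite inordK; first by rewrite hm addrK.
by rewrite ltnS -lez_nat hm -addnn PoszD lerD2r.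
Qed.

Lemma box_sum (V : nmodType) K (g : Z -> V) :
  \sum_j g (@bx N K j) = \sum_(th <- box K) g th.
Proof. by rewrite /box big_image. Qed.

Lemma box_subset K L : (K <= L)%N -> {subset box K <= box L}.
Proof.
move=> KL th; rewrite !mem_box => /forallP h; apply/forallP => i.
by apply: le_trans (h i) _; rewrite lez_nat.
Qed.

Lemma box_diff (V : zmodType) K L (g : Z -> V) : (K <= L)%N ->
  \sum_j g (@bx N L j) - \sum_j g (@bx N K j) =
  \sum_(th <- box L | th \notin box K) g th.
Proof.
move=> KL; rewrite !box_sum (bigID (mem (box K)) _ g) /= addrAC.
suff -> : \sum_(th <- box L | th \in box K) g th = \sum_(th <- box K) g th.
  by rewrite subrr add0r.
rewrite -big_filter; apply: perm_big; apply: uniq_perm.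
- by rewrite filter_uniq // box_uniq.
- exact: box_uniq.
move=> th; rewrite mem_filter; case: (boolP (th \in box K)) => //= h.
exact: (box_subset KL h).
Qed.

Lemma wt_outside K th : th \notin box K -> K.+1%:R <= wt R th.
Proof.
rewrite mem_box => /forallPn[i hi]; move: hi; rewrite -ltNge => h.
apply: le_trans (le_wt R th i).
rewrite -intr_norm; have -> : K.+1%:R = (K.+1%:Z)%:~R :> R by [].
rewrite ler_int; lia.
Qed.

Definition rapid (c : Z -> R[i]) := forall p, exists2 C, 0 <= C &
  forall th, normc (c th) * wt R th ^+ p <= C.

Lemma exists_box th : exists K, th \in box K.
Proof.
exists (\max_i absz (th i)); rewrite mem_box; apply/forallP => i.
by rewrite -abszE lez_nat; exact: (leq_bigmax (F := fun i => absz (th i))).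
Qed.

Definition ft_mult (s : seq 'I_N) th : R[i] := \prod_(k <- s) (0 +i* (th k)%:~R).

Lemma partialsC_em s th : partialsC s (em th) = fun z : 'rV[R]_N => ft_mult s th * em th z.
Proof.
elim: s => [|k s IH].
  by rewrite partialsC_nil; apply/funext => z; rewrite /ft_mult big_nil mul1r.
rewrite partialsC_cons IH dC_scale ?dC_em; last exact: CinftyC_em.
by apply/funext => z; rewrite /ft_mult big_cons; ring.
Qed.

Lemma normc_ft_mult s th : normc (ft_mult s th) <= wt R th ^+ size s.
Proof.
elim: s => [|k s IH]; first by rewrite /ft_mult big_nil ComplexField.Normc.normc1.
rewrite /ft_mult big_cons normcM normc_i exprS.
by apply: ler_pM => //; [exact: normc_ge0|exact: le_wt].
Qed.

Definition series_approx K (c : Z -> R[i]) : 'rV[R]_N -> R[i] :=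
  fun z => \sum_j c (@bx N K j) * em (bx j) z.

Lemma CinftyC_series_approx K c : CinftyC (series_approx K c).
Proof. by apply: CinftyC_sum => j; apply: CinftyC_scale; exact: CinftyC_em. Qed.

Lemma partialsC_sum s (I : Type) (r : seq I) (F : I -> 'rV[R]_N -> R[i]) :
  (forall i, CinftyC (F i)) ->
  partialsC s (fun z => \sum_(i <- r) F i z) = fun z => \sum_(i <- r) partialsC s (F i) z.
Proof.
move=> cF; elim: s => [|k s IH].
  by rewrite partialsC_nil; apply/funext => z; under [RHS]eq_bigr do rewrite partialsC_nil.
by rewrite partialsC_cons IH dC_sum // => i; exact: CinftyC_partials.
Qed.

Lemma partialsC_series_approx s K c :
  partialsC s (series_approx K c) = series_approx K (fun th => c th * ft_mult s th).
Proof.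
rewrite partialsC_sum; last by move=> j; apply: CinftyC_scale; exact: CinftyC_em.
apply/funext => z; apply: eq_bigr => j _.
by rewrite partialsC_scale ?partialsC_em ?mulrA //; exact: CinftyC_em.
Qed.

Lemma rapid_ft_mult s c : rapid c -> rapid (fun th => c th * ft_mult s th).
Proof.
move=> hc p; have [C C0 h] := hc (size s + p)%N; exists C => // th.
apply: le_trans (h th); rewrite normcM -mulrA ler_wpM2l ?normc_ge0 //.
by rewrite exprD ler_wpM2r ?normc_ft_mult // exprn_ge0 // ltW // wt_gt0.
Qed.

(** One power of the weight beyond the summable 2N is used: outside the cube the weight is at least
    K + 1. *)
Lemma series_tail c : rapid c -> exists2 C, 0 <= C & forall K L, (K <= L)%N ->
  forall z, normc (series_approx L c z - series_approx K c z) <= C / K.+1%:R.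
Proof.
move=> /(_ (2 * N).+1)[C C0 h]; exists (C * 3 ^+ N); first by rewrite mulr_ge0 // exprn_ge0.
move=> K L KL z; have K1 : (0 : R) < K.+1%:R by rewrite ltr0n.
rewrite /series_approx (box_diff (fun th => c th * em th z) KL).
apply: (le_trans (normc_sum _ _ _)).
have w0 th := wt_gt0 R th.
apply: (@le_trans _ _ (\sum_(th <- box L | th \notin box K) C / K.+1%:R * (wt R th ^+ (2 * N))^-1)).
  apply: ler_sum => th hth; rewrite normcM normc_em mulr1.
  rewrite ler_pdivlMr ?exprn_gt0 // ler_pdivlMr //.
  apply: le_trans (h th); rewrite exprSr mulrA ler_wpM2l //.
    by rewrite mulr_ge0 ?normc_ge0 // exprn_ge0 // ltW.
  exact: wt_outside.
apply: (@le_trans _ _ (\sum_(th <- box L) C / K.+1%:R * (wt R th ^+ (2 * N))^-1)).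
  rewrite [leRHS](bigID (mem (box K))) /= lerDr sumr_ge0 // => th _.
  by rewrite mulr_ge0 // ?divr_ge0 // invr_ge0 exprn_ge0 // ltW.
rewrite -mulr_sumr [leRHS]mulrAC; apply: ler_wpM2l; first exact: divr_ge0.
rewrite -box_sum; apply: le_trans (lattice_sum L 0).
by rewrite le_eqVlt; apply/orP; left; apply/eqP; apply: eq_bigr => j _; rewrite addr0.
Qed.

(** Rapid decay survives the multipliers of derivatives, so all derivatives of the partial sums are
    uniformly Cauchy. Coefficients pass to the limit since they are bounded by the sup norm. *)
Lemma fourier_inverse c : rapid c -> exists2 F : 'rV[R]_N -> R[i], CinftyC F &
  forall th, fc F th = c th.
Proof.
move=> hc.
have [F cF hF] : exists2 F, CinftyC F & tends0 (fun K z => series_approx K c z - F z).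
  apply: smooth_limitC => [K|s e e0]; first exact: CinftyC_series_approx.
  have [C C0 h] := series_tail (rapid_ft_mult s hc).
  exists (Num.truncn (C / e)).+1 => K L hK hL z; rewrite !partialsC_series_approx.
  wlog KL : K L hK hL / (K <= L)%N.
    move=> H; have [KL|/ltnW LK] := leqP K L; first exact: H.
    by rewrite -normcN opprB; exact: H.
  rewrite -normcN opprB; apply: (le_trans (h K L KL z)).
  rewrite ler_pdivrMr ?ltr0n // mulrC -ler_pdivrMr //.
  apply: le_trans (ltW (truncnS_gt _)) _; rewrite ler_nat.
  exact: leq_trans hK _.
exists F => // th; apply/eqP; rewrite -subr_eq0; apply/eqP; apply: normc_eq0.
apply/eqP; rewrite eq_le normc_ge0 andbT; apply/ler_addgt0Pl => e e0; rewrite addr0.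
have e2 : 0 < e / 2 by rewrite divr_gt0.
have [K0 h] := hF [::] _ e2; have [K1 hK1] := exists_box th.
pose K := maxn K0 K1; have hK := box_subset (leq_maxr K0 K1) hK1.
have := hK => /mapP[j0 _ thE].
have cs := CinftyC_series_approx K c.
have fs : fc (series_approx K c) th = c th.
  rewrite /series_approx fc_sum; last by move=> j; apply: CinftyC_scale; exact: CinftyC_em.
  rewrite (bigD1 j0) //= fc_scale ?fc_em ?thE; last exact: CinftyC_em.
  rewrite eqxx mulr1 big1 ?addr0 // => j jj0.
  rewrite fc_scale ?fc_em; last exact: CinftyC_em.
  by rewrite (inj_eq (@bx_inj N K)) eq_sym (negbTE jj0) mulr0.
rewrite -fs -normcN opprB -fc_sub //.
have -> : e = 2 * (e / 2) by field.
apply: normc_fc; first exact: CinftyC_sub.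
by move=> z; have := h K (leq_maxl _ _) z; rewrite partialsC_nil.
Qed.

End LatticeSums.

(** * The vector fields and the sum of their squares *)

Opaque dC fc int_torusC.

(* The ring tactic compares atoms up to conversion, which diverges on
   derivatives; they are abstracted first. *)
Ltac dC_ring := repeat match goal with
  | |- context [@dC ?R ?N ?k ?f ?z] => generalize (@dC R N k f z); intro
  end; repeat match goal with
  | |- context [@real_complex_def _ _ ?x] => assert_fails (is_var x); generalize x; intro
  end; ring.

Section Coordinates.
Variable n : nat.

Definition tco (i : 'I_n) : 'I_(n + 1) := lshift 1 i.
Definition xco : 'I_(n + 1) := rshift n ord0.

Lemma coP (k : 'I_(n + 1)) : (exists i, k = tco i) \/ k = xco.
Proof.
case: (split_ordP k) => [i ->|l ->]; first by left; exists i.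
by right; rewrite [l]ord1.
Qed.

Lemma tco_inj : injective tco.
Proof. exact: lshift_inj. Qed.

Lemma big_co (V : nmodType) (F : 'I_(n + 1) -> V) :
  \sum_k F k = \sum_i F (tco i) + F xco.
Proof. by rewrite big_split_ord big_ord1. Qed.

End Coordinates.

Arguments xco {n}.

Section Lift.
Variables (R : realType) (n : nat).
Implicit Types (f : 'rV[R]_n -> R) (z : 'rV[R]_(n + 1)).

Definition lift_t f : 'rV[R]_(n + 1) -> R := fun z => f (lsubmx z).

Lemma lsubmx_tco (h : R) i z : lsubmx (h *: evec R (tco i) + z) = h *: evec R i + lsubmx z.
Proof.
by apply/rowP => j; rewrite !mxE !eqxx /=; congr (_ * _%:R + _).
Qed.

Lemma lsubmx_xco (h : R) z : lsubmx (h *: evec R xco + z) = lsubmx z.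
Proof.
by apply/rowP => j; rewrite !mxE /xco eq_lrshift andbF mulr0n mulr0 add0r.
Qed.

Lemma lift_t_derive f i z : derivable f (lsubmx z) (evec R i) ->
  is_derive z (evec R (tco i)) (lift_t f) (partial i f (lsubmx z)).
Proof.
move=> /derivableP /is_deriveP H; apply/is_deriveP => e /H[r r0 h].
by exists r => // x xr; rewrite /lift_t lsubmx_tco; exact: h.
Qed.

Lemma lift_t_derive_xco f z : is_derive z (evec R xco) (lift_t f) 0.
Proof.
apply/is_deriveP => e e0; exists 1 => // x xr.
by rewrite /lift_t lsubmx_xco subrr scaler0 subr0 normr0 mulr_ge0 // ltW.
Qed.

Lemma continuous_lsubmx : continuous (@lsubmx R 1 n 1).
Proof. by move=> z; apply: differentiable_continuous; exact: differentiable_lsubmx. Qed.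

Lemma partial_lift_t f i : smooth f -> partial (tco i) (lift_t f) = lift_t (partial i f).
Proof.
move=> sf; apply/funext => z.
have [_ d] := sf [::].
by case: (lift_t_derive (d i (lsubmx z))).
Qed.

Lemma partial_lift_t_xco f : partial xco (lift_t f) = fun=> 0.
Proof. by apply/funext => z; case: (lift_t_derive_xco f z). Qed.

Lemma smooth_lift_t f : smooth f -> smooth (lift_t f).
Proof.
move=> sf s.
have [g sg ->] : exists2 g, smooth g & partials s (lift_t f) = lift_t g.
  elim: s => [|k s [g sg IH]]; first by exists f.
  rewrite /= IH; case: (coP k) => [[i ->]|->].
    by exists (partial i g); [exact: smooth_partial|exact: partial_lift_t].
  by exists (fun=> 0); [exact: smooth_cst|exact: partial_lift_t_xco].
split.
  move=> z; apply: (@continuous_comp _ _ _ (@lsubmx R 1 n 1) g).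
    exact: continuous_lsubmx.
  exact: smooth_continuous.
move=> k z; case: (coP k) => [[i ->]|->]; last by case: (lift_t_derive_xco g z).
by have [_ d] := sg [::]; case: (lift_t_derive (d i (lsubmx z))).
Qed.

Lemma Cinfty_lift_t f : Cinfty f -> Cinfty (lift_t f).
Proof.
move=> [sf pf]; split; first exact: smooth_lift_t.
move=> k z; rewrite /lift_t addrC; case: (coP k) => [[i ->]|->].
  by rewrite lsubmx_tco addrC pf.
by rewrite lsubmx_xco.
Qed.

End Lift.

(** * The fields X_j on test functions: transposes, commutators, energy *)

Section VectorFields.
Variables (R : realType) (n : nat).
Local Notation T := 'rV[R]_(n + 1).
Implicit Types (phi psi : T -> R[i]).

Definition Xop (b : 'I_n -> T -> R) (j : 'I_n) phi : T -> R[i] :=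
  fun z => dC (tco j) phi z + (b j z)%:C * dC xco phi z.

Variables (b : 'I_n -> T -> R).
Hypothesis cb : forall j, Cinfty (b j).
Hypothesis bx0 : forall j, partial xco (b j) = fun=> 0.

Lemma CinftyC_coef j phi : CinftyC phi -> CinftyC (fun z => (b j z)%:C * phi z).
Proof. by move=> cp; apply: CinftyC_mul => //; exact: CinftyC_real. Qed.

Lemma CinftyC_Xop j phi : CinftyC phi -> CinftyC (Xop b j phi).
Proof.
move=> cp; apply: CinftyC_add; first exact: CinftyC_dC.
exact/CinftyC_coef/CinftyC_dC.
Qed.

Lemma Xop_add j phi psi : CinftyC phi -> CinftyC psi ->
  Xop b j (fun z => phi z + psi z) = fun z => Xop b j phi z + Xop b j psi z.
Proof.
by move=> cp cs; apply/funext => z; rewrite /Xop (dC_add _ cp cs) (dC_add _ cp cs); dC_ring.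
Qed.

Lemma Xop_scale j (c : R[i]) phi : CinftyC phi ->
  Xop b j (fun z => c * phi z) = fun z => c * Xop b j phi z.
Proof.
by move=> cp; apply/funext => z; rewrite /Xop (dC_scale _ c cp) (dC_scale _ c cp); dC_ring.
Qed.

Lemma Xop_mul j phi psi : CinftyC phi -> CinftyC psi ->
  Xop b j (fun z => phi z * psi z) = fun z => Xop b j phi z * psi z + phi z * Xop b j psi z.
Proof.
by move=> cp cs; apply/funext => z; rewrite /Xop (dC_mul _ cp cs) (dC_mul _ cp cs); dC_ring.
Qed.

Lemma Xop_conj j phi : CinftyC phi ->
  Xop b j (fun z => conjc (phi z)) = fun z => conjc (Xop b j phi z).
Proof.
move=> cp; apply/funext => z.
by rewrite /Xop (dC_conj _ cp) (dC_conj _ cp) cJD cJM cJ_real.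
Qed.

Lemma dC_xco_coef j phi : CinftyC phi ->
  dC xco (fun z => (b j z)%:C * phi z) = fun z => (b j z)%:C * dC xco phi z.
Proof.
move=> cp; rewrite dC_mul //; last exact: CinftyC_real.
by apply/funext => z; rewrite dC_real bx0 mul0r add0r.
Qed.

Lemma dC_xco_Xop j phi : CinftyC phi -> dC xco (Xop b j phi) = Xop b j (dC xco phi).
Proof.
move=> cp; have cx := CinftyC_dC xco cp; have ct := CinftyC_dC (tco j) cp.
have := dC_add xco ct (CinftyC_coef j cx); rewrite (dC_xco_coef j cx) => E.
by apply: (eq_trans E); apply/funext => z; rewrite (dC_comm xco (tco j) cp).
Qed.

(** X_j has no divergence, its coefficient being independent of x, so its transpose is -X_j. *)
Lemma int_Xop_parts j phi psi : CinftyC phi -> CinftyC psi ->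
  int_torusC (fun z => Xop b j phi z * psi z) = - int_torusC (fun z => phi z * Xop b j psi z).
Proof.
move=> cp cs.
have cpx := CinftyC_dC xco cp; have csx := CinftyC_dC xco cs.
have cpt := CinftyC_dC (tco j) cp; have cst := CinftyC_dC (tco j) cs.
have -> : (fun z => Xop b j phi z * psi z) =
  (fun z => dC (tco j) phi z * psi z + dC xco phi z * ((b j z)%:C * psi z)).
  by apply/funext => z; rewrite /Xop; dC_ring.
have -> : (fun z => phi z * Xop b j psi z) =
  (fun z => phi z * dC (tco j) psi z + phi z * ((b j z)%:C * dC xco psi z)).
  by apply/funext => z; rewrite /Xop; dC_ring.
rewrite intC_add; [|exact: CinftyC_mul|exact: CinftyC_mul (CinftyC_coef _ _)].
rewrite intC_add; [|exact: CinftyC_mul|exact: CinftyC_mul (CinftyC_coef _ _)].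
rewrite opprD (intC_parts _ cp cs) (intC_parts _ cp (CinftyC_coef j cs)).
by rewrite (dC_xco_coef j cs).
Qed.

Definition curv j k : T -> R := fun z => partial (tco j) (b k) z - partial (tco k) (b j) z.

Lemma Cinfty_curv j k : Cinfty (curv j k).
Proof. by apply: CinftyB; [exact: (Cinfty_partials [:: tco j])|exact: (Cinfty_partials [:: tco k])]. Qed.

Lemma Xop_Xop j k phi : CinftyC phi -> forall z,
  Xop b j (Xop b k phi) z = dC (tco j) (dC (tco k) phi) z
    + (partial (tco j) (b k) z)%:C * dC xco phi z
    + (b k z)%:C * dC (tco j) (dC xco phi) z
    + (b j z)%:C * dC xco (dC (tco k) phi) z + (b j z)%:C * ((b k z)%:C * dC xco (dC xco phi) z).
Proof.
move=> cp z; have cx := CinftyC_dC xco cp; have ct := CinftyC_dC (tco k) cp.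
have E1 := dC_add (tco j) ct (CinftyC_coef k cx).
have E2 := dC_add xco ct (CinftyC_coef k cx).
have E3 := dC_mul (tco j) (CinftyC_real (cb k)) cx.
rewrite /Xop; have -> := congr1 (fun f => f z) E1; have -> := congr1 (fun f => f z) E2.
rewrite /= (dC_xco_coef k cx); have -> := congr1 (fun f => f z) E3.
by rewrite /= dC_real; dC_ring.
Qed.

Lemma Xop_comm j k phi : CinftyC phi -> forall z,
  Xop b j (Xop b k phi) z - Xop b k (Xop b j phi) z = (curv j k z)%:C * dC xco phi z.
Proof.
move=> cp z; rewrite !Xop_Xop // (dC_comm (tco k) (tco j) cp) (dC_comm xco (tco k) cp).
rewrite (dC_comm xco (tco j) cp) /curv RCB; dC_ring.
Qed.

Definition sumX2 phi : T -> R[i] := fun z => \sum_j Xop b j (Xop b j phi) z.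

Lemma CinftyC_sumX2 phi : CinftyC phi -> CinftyC (sumX2 phi).
Proof. by move=> cp; apply: CinftyC_sum => j; do 2 apply: CinftyC_Xop. Qed.

(** The Dirichlet form of -P. *)
Definition energy phi : R := \sum_j sqn (Xop b j phi).

Lemma energy_ge0 phi : CinftyC phi -> 0 <= energy phi.
Proof. by move=> cp; apply: sumr_ge0 => j _; apply: sqn_ge0; exact: CinftyC_Xop. Qed.

Lemma sqn_Xop_le j phi : CinftyC phi -> sqn (Xop b j phi) <= energy phi.
Proof.
move=> cp; rewrite /energy (bigD1 j) //= lerDl sumr_ge0 // => k _.
by apply: sqn_ge0; exact: CinftyC_Xop.
Qed.

Lemma int_sumX2_conj phi : CinftyC phi ->
  int_torusC (fun z => phi z * sumX2 (fun z => conjc (phi z)) z) = - (energy phi)%:C.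
Proof.
move=> cp; have cc := CinftyC_conj cp.
have -> : (fun z => phi z * sumX2 (fun z => conjc (phi z)) z) =
  fun z => \sum_j phi z * Xop b j (Xop b j (fun z => conjc (phi z))) z.
  by apply/funext => z; rewrite mulr_sumr.
have cF j : CinftyC (fun z => phi z * Xop b j (Xop b j (fun z => conjc (phi z))) z).
  exact: CinftyC_mul cp (CinftyC_Xop j (CinftyC_Xop j cc)).
apply: (eq_trans (intC_sum _ _ cF)).
rewrite RC_sum -sumrN; apply: eq_bigr => j _.
have cX := CinftyC_Xop j cp.
rewrite -(sqnE cX).
have -> : (fun z => Xop b j phi z * conjc (Xop b j phi z)) =
  (fun z => Xop b j phi z * Xop b j (fun z => conjc (phi z)) z).
  by apply/funext => z; rewrite (Xop_conj j cp).
by have := int_Xop_parts j cp (CinftyC_Xop j cc) => ->; rewrite opprK.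
Qed.

End VectorFields.

(** * The operator on distributions as a transpose *)

Section Operator.
Variables (R : realType) (n : nat).
Variable a : 'I_n -> 'rV[R]_n -> R.
Hypothesis ca : forall j, Cinfty (a j).
Local Notation T := 'rV[R]_(n + 1).
Implicit Types (phi psi : T -> R[i]) (u : functional R (n + 1)).

Definition la j : T -> R := lift_t (a j).

Lemma Cinfty_la j : Cinfty (la j).
Proof. exact: Cinfty_lift_t. Qed.

Lemma la_xco j : partial xco (la j) = fun=> 0.
Proof. exact: partial_lift_t_xco. Qed.

(** The coefficient is multiplied in before d_x is transferred to the test function; being
    independent of x, it commutes with d_x, and X_j itself reappears. *)
Lemma vf_actE u j phi : linearC u -> CinftyC phi ->
  vf_act (Xfield a j) u phi = - u (Xop la j phi).
Proof.
move=> lu cp; rewrite /vf_act big_co.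
have ct := CinftyC_dC (tco j) cp; have cx := CinftyC_dC xco cp.
have Et i z : Xfield a j z 0 (tco i) = (i == j)%:R.
  rewrite !mxE eqxx /= /xco eq_lrshift mulr0n mulr0 addr0.
  by congr (nat_of_bool _)%:R; exact: (inj_eq (@tco_inj n)).
have Ex z : Xfield a j z 0 xco = la j z.
  by rewrite !mxE !eqxx /= /xco eq_rlshift mulr0n mulr1n mulr1 add0r.
rewrite (bigD1 j) //= big1 => [|i ij].
  rewrite addr0 /dist_mul /dist_partial.
  have -> : (fun z => (Xfield a j z 0 (tco j))%:C * phi z) = phi.
    by apply/funext => z; rewrite Et eqxx mul1r.
  have -> : (fun z => (Xfield a j z 0 xco)%:C * phi z) = (fun z => (la j z)%:C * phi z).
    by apply/funext => z; rewrite Ex.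
  have E := dC_xco_coef (@Cinfty_la) (@la_xco) j cp.
  rewrite -!dCE E.
  rewrite -opprD; congr (- _).
  by rewrite -(linearC_add lu ct (CinftyC_coef (@Cinfty_la) j cx)).
rewrite /dist_mul /dist_partial.
have -> : (fun z => (Xfield a j z 0 (tco i))%:C * phi z) = fun=> 0.
  by apply/funext => z; rewrite Et (negbTE ij) mul0r.
by rewrite -dCE dC_cst linearC0 // oppr0.
Qed.

Lemma linearC_vf_act u j : linearC u -> linearC (vf_act (Xfield a j) u).
Proof.
move=> lu c phi psi cp cs.
have cX := CinftyC_Xop (@Cinfty_la).
rewrite !vf_actE //; last by apply: CinftyC_add => //; exact: CinftyC_scale.
rewrite (Xop_add la j (CinftyC_scale c cp) cs) (Xop_scale la j c cp).
by rewrite lu; [ring|exact: cX..].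
Qed.

Lemma sum_squaresE u phi : linearC u -> CinftyC phi ->
  sum_squares a u phi = u (sumX2 la phi).
Proof.
move=> lu cp; have cX := CinftyC_Xop (@Cinfty_la).
have cF j : CinftyC (Xop la j (Xop la j phi)) by exact: cX (cX _ _ _).
apply: (eq_trans _ (esym (linearC_sum _ _ lu cF))).
apply: eq_bigr => j _.
apply: (eq_trans (vf_actE j (linearC_vf_act j lu) cp)).
by rewrite (vf_actE j lu (cX j phi cp)) opprK.
Qed.

End Operator.

(** * Ellipticity at fixed x-frequency *)

Section Symbols.
Variables (R : realType) (n : nat).
Local Notation T := 'rV[R]_(n + 1).
Local Notation Z := {ffun 'I_(n + 1) -> int}.
Implicit Types (th et : Z).

Definition tpart th : {ffun 'I_n -> int} := [ffun i => th (tco i)].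
(** The weight is split into a t-part, in which P is elliptic, and an x-part [wx], in which
    polynomial losses are tolerated. *)
Definition wtt th : R := wt R (tpart th).
Definition wx th : R := 1 + `|(th xco)%:~R|.

Lemma wtt_ge1 th : 1 <= wtt th. Proof. exact: wt_ge1. Qed.
Lemma wtt_gt0 th : 0 < wtt th. Proof. exact: wt_gt0. Qed.
Lemma wx_ge1 th : 1 <= wx th. Proof. by rewrite lerDl. Qed.
Lemma wx_gt0 th : 0 < wx th. Proof. exact: lt_le_trans (wx_ge1 th). Qed.

Lemma tpartD th et : tpart (th + et) = tpart th + tpart et.
Proof. by apply/ffunP => i; rewrite !ffunE. Qed.

Lemma tpartN th : tpart (- th) = - tpart th.
Proof. by apply/ffunP => i; rewrite !ffunE. Qed.

Lemma wttN th : wtt (- th) = wtt th.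
Proof. by rewrite /wtt tpartN wtN. Qed.

Lemma wt_split th : wt R th = wtt th + `|(th xco)%:~R|.
Proof.
rewrite /wt big_co addrA; congr (_ + _ + _).
by apply: eq_bigr => i _; rewrite ffunE.
Qed.

Lemma wtt_le_wt th : wtt th <= wt R th.
Proof. by rewrite wt_split lerDl. Qed.

Lemma wt_le_mul th : wt R th <= wtt th * wx th.
Proof. by rewrite wt_split /wx mulrDr mulr1 lerD2l ler_peMl // wtt_ge1. Qed.

Lemma wtt_add th et : wtt (th + et) <= wtt th * wtt et.
Proof. by rewrite /wtt tpartD wt_add. Qed.

Lemma fc_xco_eq0 (g : T -> R[i]) th : CinftyC g -> dC xco g = (fun=> 0) ->
  th xco != 0 -> fc g th = 0.
Proof.
move=> cg g0 th0; have := fc_dC xco th cg; rewrite g0.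
have -> : fc (fun _ : T => (0 : R[i])) th = 0.
  apply: (eq_trans _ (eq_trans (fc_scale (0 : R[i]) th cg) (mul0r _))).
  by congr (fc _ _); apply/funext => z; rewrite mul0r.
move=> /esym/eqP; rewrite mulf_eq0 => /orP[|/eqP//].
by rewrite eq_complex /= eqxx intr_eq0 (negbTE th0).
Qed.

Lemma fc_mul_em (g : T -> R[i]) th et : fc (fun z => g z * em (- th) z) et = fc g (et + th).
Proof.
Transparent fc.
rewrite /fc; congr (_ * int_torusC _); apply/funext => z.
by rewrite -mulrA -emD -opprD addrC.
Qed.
Opaque fc.

(** Multiplication by a function of t convolves in the t-frequencies only. As [wtt] is
    submultiplicative, replacing et by th in the weights costs powers of the weight of their
    difference (Peetre's inequality), absorbed by the rapid decay of the coefficients of g. *)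
Lemma conv_bound m k (g : T -> R[i]) : CinftyC g -> dC xco g = (fun=> 0) ->
  exists2 C, 0 <= C & forall (u : functional R (n + 1)) A th, wdist u -> 0 <= A ->
    (forall et, et xco = th xco ->
       normc (u (em (- et))) <= A * (wtt et ^+ m / wtt et ^+ k)) ->
    normc (u (fun z => g z * em (- th) z)) <= C * A * (wtt th ^+ m / wtt th ^+ k).
Proof.
move=> cg g0; have [C C0 hC] := fc_decay (m + k + 2 * (n + 1)) cg.
exists (C * 3 ^+ (n + 1)); first by rewrite mulr_ge0 // exprn_ge0.
move=> u A th wu A0 hA.
have W0 et : 0 <= wtt et ^+ m / wtt et ^+ k.
  by rewrite divr_ge0 // exprn_ge0 // ltW // wtt_gt0.
apply: (wdist_le wu (CinftyC_mul_em _ cg)) => K.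
apply: (@le_trans _ _ (\sum_j C * A * (wtt th ^+ m / wtt th ^+ k) *
    (wt R (@bx _ K j + th) ^+ (2 * (n + 1)))^-1)); last first.
  rewrite -mulr_sumr.
  have -> : C * 3 ^+ (n + 1) * A * (wtt th ^+ m / wtt th ^+ k) =
    C * A * (wtt th ^+ m / wtt th ^+ k) * 3 ^+ (n + 1) by ring.
  by apply: ler_wpM2l; [exact: (mulr_ge0 (mulr_ge0 C0 A0) (W0 th))|exact: lattice_sum].
apply: ler_sum => j _; rewrite fc_mul_em.
set et := bx j; set ze := et + th.
have w0 : 0 < wt R ze by exact: wt_gt0.
have [zx|zx] := eqVneq (ze xco) 0; last first.
  rewrite (fc_xco_eq0 cg g0 zx) ComplexField.Normc.normc0 mul0r.
  by rewrite !mulr_ge0 // ?invr_ge0 ?exprn_ge0 ?(ltW w0) ?(ltW (wtt_gt0 _)).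
have hx : (- et) xco = th xco.
  by rewrite ffunE; apply/eqP; rewrite eq_sym -subr_eq0 opprK addrC; move: zx; rewrite ffunE => ->.
have := hA (- et) hx; rewrite opprK wttN => h1.
have e0 := wtt_gt0 et; have t0 := wtt_gt0 th; have z0 := wtt_gt0 ze.
have p1 : wtt et ^+ m / wtt et ^+ k <= wtt th ^+ m / wtt th ^+ k * wt R ze ^+ (m + k).
  have a1 : wtt et <= wtt th * wt R ze.
    have -> : et = ze - th by rewrite addrK.
    apply: le_trans (wtt_add _ _) _; rewrite wttN mulrC.
    by rewrite ler_wpM2l ?(ltW t0) // wtt_le_wt.
  have a2 : wtt th <= wtt et * wt R ze.
    have -> : th = - et + ze by rewrite /ze addKr.
    apply: le_trans (wtt_add _ _) _; rewrite wttN.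
    by rewrite ler_wpM2l ?(ltW e0) // wtt_le_wt.
  rewrite ler_pdivrMr ?exprn_gt0 // exprD.
  have -> : wtt th ^+ m / wtt th ^+ k * (wt R ze ^+ m * wt R ze ^+ k) * wtt et ^+ k =
    (wtt th * wt R ze) ^+ m * ((wtt et * wt R ze) ^+ k / wtt th ^+ k).
    by rewrite !exprMn; ring.
  have b1 : wtt et ^+ m <= (wtt th * wt R ze) ^+ m.
    by apply: lerXn2r; rewrite ?nnegrE ?(ltW e0) // mulr_ge0 ?(ltW t0) ?(ltW w0).
  apply: (le_trans b1); rewrite ler_peMr ?exprn_ge0 ?mulr_ge0 ?(ltW t0) ?(ltW w0) //.
  rewrite ler_pdivlMr ?exprn_gt0 // mul1r.
  by apply: lerXn2r; rewrite ?nnegrE ?(ltW t0) // mulr_ge0 ?(ltW e0) ?(ltW w0).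
apply: (@le_trans _ _ (normc (fc g ze) * (A * (wtt th ^+ m / wtt th ^+ k * wt R ze ^+ (m + k))))).
  rewrite ler_wpM2l ?normc_ge0 //; apply: (le_trans h1); exact: ler_wpM2l.
rewrite ler_pdivlMr ?exprn_gt0 //.
have -> : normc (fc g ze) * (A * (wtt th ^+ m / wtt th ^+ k * wt R ze ^+ (m + k))) *
    wt R ze ^+ (2 * (n + 1)) =
  A * (wtt th ^+ m / wtt th ^+ k) * (normc (fc g ze) * wt R ze ^+ (m + k + 2 * (n + 1))).
  by rewrite [wt R ze ^+ (_ + 2 * _)]exprD; ring.
rewrite [C * A]mulrC [leRHS]mulrAC ler_wpM2l //; exact: mulr_ge0.
Qed.

End Symbols.

Section SymbolFormula.
Variables (R : realType) (n : nat).
Local Notation T := 'rV[R]_(n + 1).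
Local Notation Z := {ffun 'I_(n + 1) -> int}.
Variables (b : 'I_n -> T -> R).
Hypothesis cb : forall j, Cinfty (b j).
Hypothesis bx0 : forall j, partial xco (b j) = fun=> 0.

Lemma Xop_em j (th : Z) : Xop b j (em th) =
  fun z => (0 +i* ((th (tco j))%:~R + b j z * (th xco)%:~R)) * em th z.
Proof.
apply/funext => z; rewrite /Xop dC_em dC_em; apply: complex_eq;
  rewrite ?cReD ?cImD !(cReM, cImM) /=; ring.
Qed.

(** Only the term -(th_j)^2 is quadratic in the t-frequency; each other term carries the x-frequency
    as a factor and has degree at most one in th_j. This is the ellipticity in t. *)
Lemma Xop_Xop_em j (th : Z) z : Xop b j (Xop b j (em th)) z =
  (- ((th (tco j))%:~R ^+ 2)%:C - (2 * (th (tco j))%:~R * (th xco)%:~R)%:C * (b j z)%:C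
   - ((th xco)%:~R ^+ 2)%:C * ((b j z)%:C * (b j z)%:C)
   + (0 +i* (th xco)%:~R) * (partial (tco j) (b j) z)%:C) * em th z.
Proof.
pose ka z : R[i] := (0 +i* (th (tco j))%:~R) + (0 +i* (th xco)%:~R) * (b j z)%:C.
have cbj : CinftyC (fun z => (b j z)%:C) by exact: CinftyC_real.
have ck0 := CinftyC_scale (0 +i* (th xco)%:~R) cbj.
have ck1 := CinftyC_cst (n + 1) (0 +i* (th (tco j))%:~R : R[i]).
have ck : CinftyC ka by exact: CinftyC_add ck1 ck0.
have dk k : dC k ka = fun z => (0 +i* (th xco)%:~R) * (partial k (b j) z)%:C.
  apply: (eq_trans (dC_add k ck1 ck0)); apply/funext => y.
  by rewrite dC_cst (dC_scale k _ cbj) dC_real add0r.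
have E : Xop b j (em th) = fun z => ka z * em th z.
  rewrite Xop_em; apply/funext => y; congr (_ * _); rewrite /ka; apply: complex_eq;
  rewrite ?cReD ?cImD ?cReM ?cImM /=; ring.
rewrite E; have -> := congr1 (fun f => f z) (Xop_mul b j ck (CinftyC_em R th)).
rewrite E {1}/Xop dk dk bx0 /ka.
move: (em th z) (partial _ _ z) (b j z) => e p q.
by apply: complex_eq; rewrite !(cReD, cImD, cReM, cImM, cReN, cImN) /=; ring.
Qed.

End SymbolFormula.

Section Growth.
Variables (R : realType) (N : nat).
Local Notation Z := {ffun 'I_N -> int}.

Lemma distribution_growth (u : functional R N) : is_distribution u ->
  exists m, exists2 A, 0 <= A & forall th : Z, normc (u (em th)) <= A * wt R th ^+ m.
Proof.
move=> [_ [m [C hC]]]; exists m, (`|C| * #|{bseq m of 'I_N}|%:R).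
  by rewrite mulr_ge0.
move=> th; apply: le_trans (hC _ (CinftyC_em R th)) _.
apply: (@le_trans _ _ (`|C| * Cm_norm m (em th : 'rV[R]_N -> R[i]))).
  by rewrite ler_wpM2r ?Cm_norm_ge0 // ler_norm.
rewrite -mulrA ler_wpM2l //; apply: Cm_norm_le.
  by rewrite exprn_ge0 // ltW // wt_gt0.
move=> s z; rewrite partialsC_em normcM normc_em mulr1.
apply: le_trans (normc_ft_mult _ _ _) _; apply: ler_weXn2l; first exact: wt_ge1.
exact: size_bseq.
Qed.

End Growth.

(** * Decay in the t-frequency, polynomially in the x-frequency *)

Section Bootstrap.
Variables (R : realType) (n : nat).
Local Notation T := 'rV[R]_(n + 1).
Local Notation Z := {ffun 'I_(n + 1) -> int}.
Variables (b : 'I_n -> T -> R).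
Hypothesis cb : forall j, Cinfty (b j).
Hypothesis bx0 : forall j, partial xco (b j) = fun=> 0.
Variables (u : functional R (n + 1)) (f : T -> R[i]).
Hypothesis wu : wdist u.
Hypothesis cf : CinftyC f.
Hypothesis Pu : forall phi, CinftyC phi -> u (sumX2 b phi) = int_torusC (fun z => f z * phi z).

(** Growth of order m - k in the t-frequency; a quotient, because this order becomes negative. *)
Definition rho m k (th : Z) : R := wtt R th ^+ m / wtt R th ^+ k.

Lemma rho_ge0 m k th : 0 <= rho m k th.
Proof. by rewrite divr_ge0 // exprn_ge0 // ltW // wtt_gt0. Qed.

(** The equation Pu = f is tested on [em (- th)] and solved for its principal term. What remains
    contains at most one power of the t-frequency. *)
Lemma symbol_identity (th : Z) :
  (\sum_i `|(th (tco i))%:~R : R| ^+ 2)%:C * u (em (- th)) =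
  - int_torusC (fun z => f z * em (- th) z)
  - \sum_j ((2 * (th (tco j))%:~R * (th xco)%:~R)%:C * u (fun z => (b j z)%:C * em (- th) z)
     + ((th xco)%:~R ^+ 2)%:C * u (fun z => ((b j z)%:C * (b j z)%:C) * em (- th) z)
     + (0 +i* (th xco)%:~R) * u (fun z => (partial (tco j) (b j) z)%:C * em (- th) z)).
Proof.
have ce := CinftyC_em R (- th); have [lu _] := wu.
have c1 j : CinftyC (fun z => (b j z)%:C) by exact: CinftyC_real.
have c2 j : CinftyC (fun z => (b j z)%:C * (b j z)%:C) by exact: CinftyC_mul.
have c3 j : CinftyC (fun z => (partial (tco j) (b j) z)%:C).
  exact: CinftyC_real (Cinfty_partials [:: tco j] (cb j)).
pose G1 j z := (b j z)%:C * em (- th) z.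
pose G2 j z := ((b j z)%:C * (b j z)%:C) * em (- th) z.
pose G3 j z := (partial (tco j) (b j) z)%:C * em (- th) z.
have cG1 j : CinftyC (G1 j) by exact: CinftyC_mul_em.
have cG2 j : CinftyC (G2 j) by exact: CinftyC_mul_em.
have cG3 j : CinftyC (G3 j) by exact: CinftyC_mul_em.
pose F j z := (- ((th (tco j))%:~R ^+ 2)%:C) * em (- th) z +
  ((- (2 * (th (tco j))%:~R * (th xco)%:~R)%:C) * G1 j z +
   ((- ((th xco)%:~R ^+ 2)%:C) * G2 j z + (- (0 +i* (th xco)%:~R)) * G3 j z)).
have cF23 j : CinftyC (fun z => (- ((th xco)%:~R ^+ 2)%:C) * G2 j z + (- (0 +i* (th xco)%:~R)) * G3 j z).
  by apply: CinftyC_add; exact: CinftyC_scale.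
have cF123 j : CinftyC (fun z => (- (2 * (th (tco j))%:~R * (th xco)%:~R)%:C) * G1 j z +
   ((- ((th xco)%:~R ^+ 2)%:C) * G2 j z + (- (0 +i* (th xco)%:~R)) * G3 j z)).
  by apply: CinftyC_add => //; exact: CinftyC_scale.
have cF j : CinftyC (F j) by apply: CinftyC_add => //; exact: CinftyC_scale.
have E : sumX2 b (em (- th)) = fun z => \sum_j F j z.
  apply/funext => z; apply: eq_bigr => j _; rewrite Xop_Xop_em // /F /G1 /G2 /G3 !ffunE.
  move: (em _ z) (partial _ _ z) (b j z) => e p q.
  rewrite !intrN; move: (_%:~R) (_%:~R) => x y.
  by apply: complex_eq; rewrite !(cReD, cImD, cReM, cImM, cReN, cImN) /=; ring.
have := Pu ce; rewrite E => E'.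
have {}E' := eq_trans (esym (linearC_sum _ _ lu cF)) E'.
have uF j : u (F j) = - ((th (tco j))%:~R ^+ 2)%:C * u (em (- th)) -
  ((2 * (th (tco j))%:~R * (th xco)%:~R)%:C * u (G1 j) + ((th xco)%:~R ^+ 2)%:C * u (G2 j)
   + (0 +i* (th xco)%:~R) * u (G3 j)).
  rewrite (linearC_add lu (CinftyC_scale _ ce) (cF123 j)) (linearC_scale _ lu ce).
  rewrite (linearC_add lu (CinftyC_scale _ (cG1 j)) (cF23 j)) (linearC_scale _ lu (cG1 j)).
  rewrite (linearC_add lu (CinftyC_scale _ (cG2 j)) (CinftyC_scale _ (cG3 j))).
  rewrite (linearC_scale _ lu (cG2 j)) (linearC_scale _ lu (cG3 j)).
  by move: (u _) (u _) (u _) (u _) => x1 x2 x3 x4; ring.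
have SE := eq_trans (esym (eq_bigr _ (fun j _ => uF j))) E'.
have aux (X Y : R[i]) : - (X - Y) - Y = - X by ring.
rewrite -SE sumrB aux -sumrN RC_sum mulr_suml; apply: eq_bigr => i _.
by rewrite mulNr opprK real_normK ?num_real.
Qed.

(** The principal symbol has order two in t and the remainder order one, whence the gain of one
    order; the x-frequency enters at most quadratically, whence the exponent M + 2. *)
Lemma bootstrap_step m k M A : 0 <= A ->
  (forall th, normc (u (em (- th))) <= A * wx R th ^+ M * rho m k th) ->
  exists2 A', 0 <= A' &
    forall th, normc (u (em (- th))) <= A' * wx R th ^+ (M + 2) * rho m k.+1 th.
Proof.
move=> A0 hA.
have c1 j : CinftyC (fun z => (b j z)%:C) by exact: CinftyC_real.
have c2 j : CinftyC (fun z => (b j z)%:C * (b j z)%:C) by exact: CinftyC_mul.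
have c3 j : CinftyC (fun z => (partial (tco j) (b j) z)%:C).
  exact: CinftyC_real (Cinfty_partials [:: tco j] (cb j)).
have d1 j : dC xco (fun z => (b j z)%:C) = fun=> 0.
  by rewrite dC_real bx0.
have d2 j : dC xco (fun z => (b j z)%:C * (b j z)%:C) = fun=> 0.
  by rewrite dC_mul // d1; apply/funext => z; rewrite mul0r mulr0 addr0.
have d3 j : dC xco (fun z => (partial (tco j) (b j) z)%:C) = fun=> 0.
  rewrite -dC_real (dC_comm xco (tco j) (c1 j)) d1; exact: dC_cst.
(* The hole stands for the bound supplied by [conv_bound], repackaged as a conjunction so that
   [choice] applies. *)
have H1 j : exists C, 0 <= C /\ _ := let: ex_intro2 C a b := conv_bound m k (c1 j) (d1 j) in ex_intro _ C (conj a b).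
have H2 j : exists C, 0 <= C /\ _ := let: ex_intro2 C a b := conv_bound m k (c2 j) (d2 j) in ex_intro _ C (conj a b).
have H3 j : exists C, 0 <= C /\ _ := let: ex_intro2 C a b := conv_bound m k (c3 j) (d3 j) in ex_intro _ C (conj a b).
have [C1 h1] := choice H1; have [C2 h2] := choice H2; have [C3 h3] := choice H3.
have [Cf Cf0 hf] := fc_decay k cf.
pose v := vol R (n + 1); have v0 : 0 < v by exact: vol_gt0.
pose S := \sum_j (2 * C1 j + C2 j + C3 j).
have S0 : 0 <= S.
  apply: sumr_ge0 => j _; have [a1 _] := h1 j; have [a2 _] := h2 j; have [a3 _] := h3 j.
  by rewrite !addr_ge0 // mulr_ge0.
exists (n.+1%:R ^+ 2 * (A + (v * Cf + S * A))).
  by rewrite mulr_ge0 ?exprn_ge0 // !addr_ge0 ?mulr_ge0 ?(ltW v0).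
move=> th; set x := wx R th; set w := wtt R th; set r := rho m k th.
have x1 : 1 <= x by exact: wx_ge1.
have w1 : 1 <= w by exact: wtt_ge1.
have x0 : 0 < x by exact: wx_gt0.
have w0 : 0 < w by exact: wtt_gt0.
have r0 : 0 <= r by exact: rho_ge0.
have B0 : 0 <= A * x ^+ M by rewrite mulr_ge0 // exprn_ge0 // ltW.
have hB (et : Z) : et xco = th xco -> normc (u (em (- et))) <= A * x ^+ M * rho m k et.
  by move=> e; have := hA et; rewrite /x /wx -e.
have tj j : `|(th (tco j))%:~R : R| <= w.
  by have := le_wt R (tpart th) j; rewrite ffunE.
have tx : `|(th xco)%:~R : R| <= x by rewrite lerDr.
have xM : x ^+ M * x ^+ 2 = x ^+ (M + 2) by rewrite exprD.
have bnd : (\sum_i `|(th (tco i))%:~R : R| ^+ 2) * normc (u (em (- th))) <=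
    (v * Cf + S * A) * x ^+ (M + 2) * (w * r).
  have := congr1 (@normc R) (symbol_identity th).
  rewrite normcM normc_real ger0_norm => [->|]; last first.
    by apply: sumr_ge0 => i _; rewrite exprn_ge0.
  apply: (le_trans (normcB _ _)); rewrite -mulrA mulrDl; apply: lerD.
    rewrite normcN int_fc normcM normc_real ger0_norm ?(ltW v0) // -mulrA.
    rewrite ler_wpM2l ?(ltW v0) //.
    apply: (@le_trans _ _ (Cf / w ^+ k)).
      rewrite ler_pdivlMr ?exprn_gt0 //; apply: le_trans (hf th).
      rewrite ler_wpM2l ?normc_ge0 //; apply: lerXn2r; rewrite ?nnegrE ?(ltW w0) //.
        exact: ltW (wt_gt0 _ _).
      exact: wtt_le_wt.
    rewrite ler_wpM2l // /r /rho -/w.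
    have -> : x ^+ (M + 2) * (w * (w ^+ m / w ^+ k)) = (x ^+ (M + 2) * w ^+ m.+1) * (w ^+ k)^-1.
      by rewrite exprS; ring.
    rewrite ler_peMl ?invr_ge0 ?exprn_ge0 ?(ltW w0) //.
    by apply: mulr_ege1; exact: exprn_ege1.
  apply: (le_trans (normc_sum _ _ _)); rewrite /S -mulrA mulr_suml; apply: ler_sum => j _.
  have [a1 g1] := h1 j; have [a2 g2] := h2 j; have [a3 g3] := h3 j.
  have {}g1 := g1 u _ th wu B0 hB; have {}g2 := g2 u _ th wu B0 hB.
  have {}g3 := g3 u _ th wu B0 hB.
  rewrite -/(rho m k th) -/r in g1 g2 g3.
  apply: (le_trans (normcD _ _)); apply: (le_trans (lerD (normcD _ _) (lexx _))).
  rewrite 3!normcM !normc_real normc_i.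
  have n0 := normc_ge0.
  have D0 : 0 <= A * x ^+ M * r by exact: mulr_ge0.
  have t1 : `|2 * (th (tco j))%:~R * (th xco)%:~R : R| * normc (u (fun z => (b j z)%:C * em (- th) z)) <=
     2 * C1 j * (A * x ^+ M * r) * (w * x ^+ 2).
    rewrite !normrM [`|2|]ger0_norm //.
    have -> : 2 * C1 j * (A * x ^+ M * r) * (w * x ^+ 2) = (2 * w * x * x) * (C1 j * (A * x ^+ M) * r) by ring.
    apply: ler_pM; [exact: (mulr_ge0 (mulr_ge0 (ler0n _ 2) (normr_ge0 _)) (normr_ge0 _))|exact: normc_ge0| |exact: g1].
    have wx0 : 0 <= 2 * w * x by rewrite !mulr_ge0 // ltW.
    apply: (@le_trans _ _ (2 * w * x)); last by rewrite ler_peMr.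
    by apply: ler_pM => //; exact: ler_wpM2l.
  have t2 : `|(th xco)%:~R ^+ 2 : R| * normc (u (fun z => ((b j z)%:C * (b j z)%:C) * em (- th) z)) <=
     C2 j * (A * x ^+ M * r) * (w * x ^+ 2).
    rewrite normrX.
    have -> : C2 j * (A * x ^+ M * r) * (w * x ^+ 2) = (w * x ^+ 2) * (C2 j * (A * x ^+ M) * r) by ring.
    apply: ler_pM; [by rewrite exprn_ge0|exact: normc_ge0| |exact: g2].
    apply: (@le_trans _ _ (x ^+ 2)); last by rewrite ler_peMl // exprn_ge0 // ltW.
    by apply: lerXn2r; rewrite ?nnegrE ?(ltW x0).
  have t3 : `|(th xco)%:~R : R| * normc (u (fun z => (partial (tco j) (b j) z)%:C * em (- th) z)) <=
     C3 j * (A * x ^+ M * r) * (w * x ^+ 2).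
    have -> : C3 j * (A * x ^+ M * r) * (w * x ^+ 2) = (w * (x * x)) * (C3 j * (A * x ^+ M) * r) by ring.
    apply: ler_pM; [by []|exact: normc_ge0| |exact: g3]; apply: (le_trans tx).
    apply: (@le_trans _ _ (x * x)); first by rewrite ler_peMr // ltW.
    by rewrite ler_peMl // mulr_ge0 // ltW.
  apply: (le_trans (lerD (lerD t1 t2) t3)).
  rewrite -xM le_eqVlt; apply/orP; left; apply/eqP; ring.
have hu0 := hA th; rewrite -/x -/r in hu0.
have hw : w ^+ 2 * normc (u (em (- th))) <= n.+1%:R ^+ 2 * (A + (v * Cf + S * A)) * x ^+ (M + 2) * (w * r).
  (* In wtt^2 <= (n + 1)^2 (1 + sum of th_i^2), the term 1 is paid by the previous bound and the sum
     by the symbol identity. *)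
  have W2 := wt_pow_le R (tpart th) 2.
  apply: (le_trans (ler_wpM2r (normc_ge0 _) W2)).
  rewrite -[leLHS]mulrA.
  have -> : n.+1%:R ^+ 2 * (A + (v * Cf + S * A)) * x ^+ (M + 2) * (w * r) =
    n.+1%:R ^+ 2 * ((A + (v * Cf + S * A)) * (x ^+ (M + 2) * (w * r))) by ring.
  apply: ler_wpM2l; first by rewrite exprn_ge0.
  rewrite [leLHS]mulrDl mul1r [leRHS]mulrDl; apply: lerD.
    apply: (le_trans hu0).
    have -> : A * (x ^+ (M + 2) * (w * r)) = A * x ^+ M * r * (x ^+ 2 * w).
      by rewrite -xM; ring.
    apply: ler_peMr; first exact: mulr_ge0.
    by apply: mulr_ege1 => //; exact: exprn_ege1.
  rewrite [leRHS]mulrA; apply: le_trans bnd; rewrite ler_wpM2r ?normc_ge0 //.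
  by apply: ler_sum => i _; rewrite ffunE.
have -> : rho m k.+1 th = r / w.
  by rewrite /r /rho exprSr invfM mulrA.
rewrite mulrA ler_pdivlMr //.
rewrite -(ler_pM2l w0); apply: le_trans (le_trans _ hw) _.
  by rewrite le_eqVlt; apply/orP; left; apply/eqP; ring.
by rewrite le_eqVlt; apply/orP; left; apply/eqP; ring.
Qed.

Lemma bootstrap m A : 0 <= A -> (forall th, normc (u (em th)) <= A * wt R th ^+ m) ->
  forall k, exists A', exists M, 0 <= A' /\
    forall th, normc (u (em (- th))) * wtt R th ^+ k <= A' * wx R th ^+ M.
Proof.
move=> A0 hA.
have H k : exists A', exists M, 0 <= A' /\
    forall th, normc (u (em (- th))) <= A' * wx R th ^+ M * rho m k th.
  elim: k => [|k [B [M [B0 hB]]]].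
    exists A, m; split=> // th; rewrite /rho expr0 divr1 -mulrA -exprMn.
    have := hA (- th); rewrite wtN => /le_trans; apply; apply: ler_wpM2l => //.
    have w0 := ltW (wt_gt0 R th); have t0 := ltW (wtt_gt0 R th); have x0 := ltW (wx_gt0 R th).
    apply: lerXn2r; rewrite ?nnegrE ?mulr_ge0 //.
    by rewrite mulrC wt_le_mul.
  by have [B' B'0 h] := bootstrap_step B0 hB; exists B', (M + 2)%N.
(* m steps cancel the initial growth of u, and k further ones give the decay. *)
move=> k; have [A' [M [A'0 h]]] := H (m + k)%N; exists A', M; split => // th.
have w0 := wtt_gt0 R th.
rewrite -ler_pdivlMr ?exprn_gt0 //; apply: (le_trans (h th)).
rewrite -mulrA -mulrA ler_wpM2l // ler_wpM2l ?exprn_ge0 ?(ltW (wx_gt0 _ _)) //.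
by rewrite /rho exprD invfM mulrA divff ?mul1r // expf_neq0 // gt_eqF.
Qed.

End Bootstrap.

(** * Estimates at a nonzero x-frequency *)

Section L2.
Variables (R : realType) (N : nat).
Local Notation Z := {ffun 'I_N -> int}.
Implicit Types (phi psi : 'rV[R]_N -> R[i]).

Lemma sqn_conj phi : sqn (fun z => conjc (phi z)) = sqn phi.
Proof.
by congr int_torus; apply/funext => z; rewrite /re_part /im_part cReJ cImJ sqrrN.
Qed.

Lemma sqn_em_mul (th : Z) phi : CinftyC phi -> sqn (fun z => em th z * phi z) = sqn phi.
Proof.
move=> cp; congr int_torus; apply/funext => z.
by rewrite -!normc_sqr normcM normc_em mul1r.
Qed.

Lemma normc_fc_sqn phi (th : Z) d : 0 < d -> CinftyC phi ->
  vol R N * normc (fc phi th) <= d^-1 * sqn phi + d * vol R N.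
Proof.
move=> d0 cp; have v0 := ltW (vol_gt0 R N).
have -> : vol R N * normc (fc phi th) = normc (int_torusC (fun z => phi z * em (- th) z)).
  by rewrite int_fc normcM normc_real ger0_norm.
have -> : vol R N = sqn (em (- th) : 'rV[R]_N -> R[i]).
  rewrite -[LHS]mul1r -int_torus_cst; congr int_torus; apply/funext => z.
  by rewrite -normc_sqr normc_em expr1n.
by apply: normc_int_mul => //; exact: CinftyC_em.
Qed.

Lemma sqn_eq0 phi : CinftyC phi -> sqn phi = 0 -> phi = fun=> 0.
Proof.
move=> cp p0; have c0 := CinftyC_cst N (0 : R[i]).
have v0 := vol_gt0 R N.
apply: fc_inj => // th.
have -> : fc (fun _ : 'rV[R]_N => (0 : R[i])) th = 0.
  apply: (eq_trans _ (eq_trans (fc_scale (0 : R[i]) th cp) (mul0r _))).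
  by congr (fc _ _); apply/funext => z; rewrite mul0r.
apply: normc_eq0; apply/eqP; rewrite eq_le normc_ge0 andbT.
apply/ler_addgt0Pl => e e0; rewrite addr0.
have := normc_fc_sqn th e0 cp; rewrite p0 mulr0 add0r mulrC.
by rewrite ler_pM2r.
Qed.

Lemma sum_fc_bound phi : CinftyC phi ->
  exists2 C, 0 <= C & forall K, \sum_j normc (fc phi (@bx N K j)) <= C.
Proof.
move=> cp; have [C C0 hC] := fc_decay (2 * N) cp.
exists (C * 3 ^+ N); first by rewrite mulr_ge0 // exprn_ge0.
move=> K; apply: (@le_trans _ _ (C * \sum_j (wt R (@bx N K j + 0) ^+ (2 * N))^-1)).
  rewrite mulr_sumr; apply: ler_sum => j _; rewrite addr0.
  by rewrite ler_pdivlMr ?exprn_gt0 ?wt_gt0.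
by rewrite ler_wpM2l // lattice_sum.
Qed.

End L2.

(** * The estimate when some c_jk is nonzero *)

Section NonClosed.
Variables (R : realType) (n : nat).
Local Notation T := 'rV[R]_(n + 1).
Local Notation Z := {ffun 'I_(n + 1) -> int}.
Variables (b : 'I_n -> T -> R).
Hypothesis cb : forall j, Cinfty (b j).
Hypothesis bx0 : forall j, partial xco (b j) = fun=> 0.

(** Frequency x in the last variable, stated as a differential equation so that V remains a function
    on the whole torus. *)
Definition xfreq (x : R) (V : T -> R[i]) := dC xco V = fun z => (0 +i* x) * V z.

(* The commutator identity [X_j, X_k] V = i x h V paired with h * conj V. *)
Lemma commutator_bound j k : exists2 C, 0 <= C & forall d x V, 0 < d -> 1 <= `|x| ->
  CinftyC V -> xfreq x V ->
  sqn (fun z => (curv b j k z)%:C * V z) <= C * d * sqn V + C * (d^-1 + 1) * energy b V.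
Proof.
set h := curv b j k; have ch : Cinfty h by exact: Cinfty_curv.
have chC := CinftyC_real ch.
have [B B0 hB] := CinftyC_bounded chC.
have cXh i : CinftyC (Xop b i (fun z => (h z)%:C)) by exact: CinftyC_Xop.
have [Bj Bj0 hBj] := CinftyC_bounded (cXh j).
have [Bk Bk0 hBk] := CinftyC_bounded (cXh k).
pose C := 2 * (Bj ^+ 2 + Bk ^+ 2 + B ^+ 2 + 1).
have C0 : 0 <= C by rewrite mulr_ge0 // !addr_ge0 ?sqr_ge0.
exists C => // d x V d0 x1 cV xV.
have cVb := CinftyC_conj cV.
have E0 : 0 <= energy b V by exact: energy_ge0.
have S0 := sqn_ge0 cV.
pose hVb z := (h z)%:C * conjc (V z).
have chVb : CinftyC hVb by exact: CinftyC_mul.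
have cX i : CinftyC (Xop b i V) by exact: CinftyC_Xop.
(* One half of the commutator: X_i is moved onto h conj V. Where it hits h, the factor V is
   undifferentiated, and d weighs it against the energy; where it hits V, both factors are energy
   terms. *)
have half i l D : CinftyC (Xop b i (fun z => (h z)%:C)) ->
    (forall z, normc (Xop b i (fun z => (h z)%:C) z) <= D) ->
    normc (int_torusC (fun z => hVb z * Xop b i (Xop b l V) z)) <=
    d * D ^+ 2 * sqn V + (d^-1 + 1 + B ^+ 2) * energy b V.
  move=> cXhi hD.
  have P := int_Xop_parts cb bx0 i chVb (cX l).
  have -> : int_torusC (fun z => hVb z * Xop b i (Xop b l V) z) =
    - int_torusC (fun z => Xop b i hVb z * Xop b l V z) by rewrite P opprK.
  rewrite normcN.
  have -> : (fun z => Xop b i hVb z * Xop b l V z) =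
    fun z => (Xop b i (fun z => (h z)%:C) z * conjc (V z)) * Xop b l V z
     + ((h z)%:C * conjc (Xop b i V z)) * Xop b l V z.
    apply/funext => z; have -> := congr1 (fun f => f z) (Xop_mul b i chC cVb).
    by have -> := congr1 (fun f => f z) (Xop_conj b i cV); rewrite mulrDl.
  have c1 := CinftyC_mul cXhi cVb; have c2 := CinftyC_mul chC (CinftyC_conj (cX i)).
  rewrite (intC_add (CinftyC_mul c1 (cX l)) (CinftyC_mul c2 (cX l))).
  apply: (le_trans (normcD _ _)).
  have dV : 0 < d^-1 by rewrite invr_gt0.
  have e1 := normc_int_mul dV c1 (cX l); rewrite invrK in e1.
  have e2 := normc_int_mul ltr01 c2 (cX l); rewrite invr1 !mul1r in e2.
  apply: (le_trans (lerD e1 e2)).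
  have s1 := sqn_mul_le cXhi cVb hD; rewrite sqn_conj in s1.
  have s2 := sqn_mul_le chC (CinftyC_conj (cX i)) hB; rewrite sqn_conj in s2.
  have t1 := sqn_Xop_le cb l cV; have t2 := sqn_Xop_le cb i cV.
  have u1 : d * sqn (fun z => Xop b i (fun z => (h z)%:C) z * conjc (V z)) <= d * D ^+ 2 * sqn V.
    by rewrite -mulrA ler_wpM2l // ltW.
  have u2 : d^-1 * sqn (Xop b l V) <= d^-1 * energy b V by rewrite ler_wpM2l // ltW.
  have u3 : sqn (fun z => (h z)%:C * conjc (Xop b i V z)) <= B ^+ 2 * energy b V.
    by apply: (le_trans s2); rewrite ler_wpM2l // sqr_ge0.
  by move: u1 u2 u3 t1; lra.
have key : (0 +i* x) * (sqn (fun z => (h z)%:C * V z))%:C =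
  int_torusC (fun z => hVb z * Xop b j (Xop b k V) z) -
  int_torusC (fun z => hVb z * Xop b k (Xop b j V) z).
  have cjk := CinftyC_Xop cb j (cX k); have ckj := CinftyC_Xop cb k (cX j).
  rewrite -(intC_sub (CinftyC_mul chVb cjk) (CinftyC_mul chVb ckj)).
  rewrite -(sqnE (CinftyC_mul chC cV)) -intC_scale; last first.
    by apply: CinftyC_mul; [|apply: CinftyC_conj]; exact: CinftyC_mul.
  congr int_torusC; apply/funext => z.
  rewrite -mulrBr (Xop_comm cb bx0 j k cV) xV cJM cJ_real /hVb -/h; ring.
have h1 := half j k Bj (cXh j) hBj; have h2 := half k j Bk (cXh k) hBk.
have hn := congr1 (@normc R) key; rewrite normcM normc_i normc_real in hn.
have Sh0 : 0 <= sqn (fun z => (h z)%:C * V z) by apply: sqn_ge0; exact: CinftyC_mul.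
rewrite (ger0_norm Sh0) in hn.
apply: (@le_trans _ _ (`|x| * sqn (fun z => (h z)%:C * V z))); first by rewrite ler_peMl.
rewrite hn; apply: (le_trans (normcB _ _)); apply: (le_trans (lerD h1 h2)).
have dV0 : 0 <= d^-1 by rewrite invr_ge0 ltW.
have p1 : d * Bj ^+ 2 * sqn V + d * Bk ^+ 2 * sqn V <= C * d * sqn V.
  rewrite -mulrDl -mulrDr mulrC [C * d]mulrC [leRHS]mulrC ler_wpM2l // ler_wpM2l ?(ltW d0) //.
  by rewrite /C; move: (sqr_ge0 Bj) (sqr_ge0 Bk) (sqr_ge0 B); clear -cb bx0; lra.
have p2 : (d^-1 + 1 + B ^+ 2) * energy b V + (d^-1 + 1 + B ^+ 2) * energy b V
    <= C * (d^-1 + 1) * energy b V.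
  rewrite -mulrDl ler_wpM2r //.
  have C2 : 2 * (B ^+ 2 + 1) <= C.
    by rewrite /C; move: (sqr_ge0 Bj) (sqr_ge0 Bk); clear -cb bx0; lra.
  apply: (@le_trans _ _ (2 * (B ^+ 2 + 1) * (d^-1 + 1))); last first.
    by rewrite ler_wpM2r // addr_ge0.
  have : 0 <= B ^+ 2 * d^-1 by rewrite mulr_ge0 // sqr_ge0.
  by move: dV0 (sqr_ge0 B); clear -cb bx0; lra.
by move: p1 p2; clear -cb bx0; lra.
Qed.

(* A Poincare inequality: the oscillation of the weight g against |V|^2 is
   controlled mode by mode, since i th_i e_th = X_i e_th for modes independent
   of x and X_i can be integrated by parts. *)
Lemma poincare_weight (g : T -> R[i]) : CinftyC g -> dC xco g = (fun=> 0) ->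
  exists2 C, 0 <= C & forall d V, 0 < d -> CinftyC V ->
  normc (int_torusC (fun z => (V z * conjc (V z)) * g z) - (sqn V)%:C * fc g 0) <=
    C * (d^-1 * energy b V + d * sqn V).
Proof.
move=> cg g0; have [C C0 hC] := sum_fc_bound cg.
exists (2 * C) => [|d V d0 cV]; first by rewrite mulr_ge0.
have cVb := CinftyC_conj cV; have cW := CinftyC_mul cV cVb.
have E0 : 0 <= energy b V by exact: energy_ge0.
have S0 := sqn_ge0 cV.
(* [c0] is the mean of |V|^2, so L pairs a weight with |V|^2 minus its mean; being continuous, L
   need only be bounded on the modes of g. *)
pose c0 : R[i] := (sqn V)%:C * ((vol R (n + 1))^-1)%:C.
pose L phi := int_torusC (fun z => (V z * conjc (V z)) * phi z) -
  int_torusC (fun z : T => c0 * phi z).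
have wL : wdist L := wdist_sub (wdist_int cW) (wdist_int (CinftyC_cst _ c0)).
have Lg : int_torusC (fun z => (V z * conjc (V z)) * g z) - (sqn V)%:C * fc g 0 = L g.
  congr (_ - _); rewrite (intC_scale c0 cg) /c0 -mulrA; congr (_ * _).
  have := int_fc g 0; have -> : (fun z => g z * em (- 0) z) = g.
    by apply/funext => z; rewrite oppr0 em0 mulr1.
  by move=> ->; rewrite volCV mulrA mulVf ?mul1r // volC_neq0.
have K0 : 0 <= 2 * (d^-1 * energy b V + d * sqn V).
  by rewrite mulr_ge0 // addr_ge0 // mulr_ge0 // ?invr_ge0 ltW.
rewrite Lg; apply: (wdist_le wL cg) => K.
apply: (@le_trans _ _ (\sum_j normc (fc g (@bx _ K j)) * (2 * (d^-1 * energy b V + d * sqn V)))); last first.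
  by rewrite -mulr_suml [2 * C]mulrC -[leRHS]mulrA; exact: ler_wpM2r.
apply: ler_sum => j _; set th := bx j.
have [thx|thx] := eqVneq (th xco) 0; last first.
  by rewrite (fc_xco_eq0 cg g0 thx) ComplexField.Normc.normc0 !mul0r.
rewrite ler_wpM2l ?normc_ge0 //.
have ce := CinftyC_em R th.
have [th0|th0] := eqVneq th 0.
  suff -> : L (em th) = 0 by rewrite ComplexField.Normc.normc0.
  rewrite /L th0 (intC_scale c0 (CinftyC_em R 0)) int_em eqxx /c0.
  have -> : (fun z => V z * conjc (V z) * em 0 z) = fun z => V z * conjc (V z).
    by apply/funext => z; rewrite em0 mulr1.
  by rewrite sqnE // -mulrA volCV mulVf ?mulr1 ?subrr // volC_neq0.
have [i thi] : exists i, th (tco i) != 0.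
  apply/existsP; apply: contraNT th0 => /existsPn H; apply/eqP/ffunP => k.
  rewrite [RHS]ffunE; case: (coP k) => [[i ->]|->] //.
  by apply/eqP; have := H i; rewrite negbK.
rewrite /L (intC_scale c0 ce) int_em (negbTE th0) mulr0 subr0.
have cX : CinftyC (Xop b i V) by exact: CinftyC_Xop.
have Xe : Xop b i (em th) = fun z => (0 +i* (th (tco i))%:~R) * em th z.
  by rewrite Xop_em thx; apply/funext => z; rewrite mulr0 addr0.
have P := int_Xop_parts cb bx0 i ce cW.
have cVV := CinftyC_mul_em th cW.
have E1 : int_torusC (fun z => Xop b i (em th) z * (V z * conjc (V z))) =
    (0 +i* (th (tco i))%:~R) * int_torusC (fun z => (V z * conjc (V z)) * em th z).
  rewrite -(intC_scale _ cVV); congr int_torusC; apply/funext => z.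
  by rewrite Xe; ring.
have E2 : (fun z => em th z * Xop b i (fun z => V z * conjc (V z)) z) =
  fun z => Xop b i V z * (em th z * conjc (V z)) + conjc (Xop b i V z) * (em th z * V z).
  apply/funext => z; have -> := congr1 (fun f => f z) (Xop_mul b i cV cVb).
  have -> := congr1 (fun f => f z) (Xop_conj b i cV).
  by move: (Xop b i V z) (em th z) (V z) => p q r; ring.
have ceV := CinftyC_mul ce cV; have ceVb := CinftyC_mul ce cVb.
rewrite E1 E2 (intC_add (CinftyC_mul cX ceVb) (CinftyC_mul (CinftyC_conj cX) ceV)) in P.
have := congr1 (@normc R) P; rewrite normcM normc_i normcN.
have t1 := sqn_Xop_le cb i cV.
have e1 := normc_int_mul d0 cX ceVb.
have e2 := normc_int_mul d0 (CinftyC_conj cX) ceV.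
rewrite (sqn_em_mul th cVb) sqn_conj in e1; rewrite (sqn_em_mul th cV) sqn_conj in e2.
have t2 : d^-1 * sqn (Xop b i V) <= d^-1 * energy b V by rewrite ler_wpM2l // invr_ge0 ltW.
set I1 := int_torusC _ in e1 *; set I2 := int_torusC _ in e2 *; set I0 := int_torusC _ => hn.
apply: (@le_trans _ _ (`|(th (tco i))%:~R : R| * normc I0)).
  rewrite ler_peMl ?normc_ge0 // -intr_norm -[1]/(1%:~R) ler_int.
  by move: thi; rewrite -normr_gt0 -gtz0_ge1.
rewrite hn; apply: (le_trans (normcD _ _)).
by move: e1 e2 t2; lra.
Qed.

(** With weight h^2, whose mean [be] is positive since h does not vanish identically, the Poincare
    inequality bounds [be] |V|^2 by |hV|^2 and the commutator bounds |hV|^2, both up to the energy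
    and a small multiple of |V|^2. *)
Lemma nonclosed_estimate j k z0 : curv b j k z0 != 0 ->
  exists2 C, 0 <= C & forall x V, 1 <= `|x| -> CinftyC V -> xfreq x V ->
    sqn V <= C * energy b V.
Proof.
move=> h0; set h := curv b j k in h0.
have ch : Cinfty h by exact: Cinfty_curv.
have chC := CinftyC_real ch; have cg := CinftyC_mul chC chC.
have hx0 : dC xco (fun z => (h z)%:C * (h z)%:C) = fun=> 0.
  have cc i l : CinftyC (fun z => (partial (tco i) (b l) z)%:C).
    exact: CinftyC_real (Cinfty_partials [:: tco i] (cb l)).
  have d0 i l : dC xco (fun z => (partial (tco i) (b l) z)%:C) = fun=> 0.
    rewrite -dC_real (dC_comm xco (tco i) (CinftyC_real (cb l))) dC_real bx0; exact: dC_cst.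
  have dh : dC xco (fun z => (h z)%:C) = fun=> 0.
    have -> : (fun z => (h z)%:C) = fun z => (partial (tco j) (b k) z)%:C - (partial (tco k) (b j) z)%:C.
      by apply/funext => z; rewrite /h /curv RCB.
    by rewrite (dC_sub xco (cc j k) (cc k j)) !d0; apply/funext => z; rewrite subrr.
  by rewrite (dC_mul xco chC chC) dh; apply/funext => z; rewrite mul0r mulr0 addr0.
have [C1 C10 H1] := commutator_bound j k; have [C2 C20 H2] := poincare_weight cg hx0.
pose be := (vol R (n + 1))^-1 * sqn (fun z => (h z)%:C).
have be0 : 0 < be.
  rewrite mulr_gt0 ?invr_gt0 ?vol_gt0 // lt_neqAle sqn_ge0 // andbT.
  apply: contra h0 => /eqP/esym /(sqn_eq0 chC) /(congr1 (fun f => complex.Re (f z0))) /=.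
  by move=> ->.
have fcb : fc (fun z => (h z)%:C * (h z)%:C) 0 = be%:C.
  have := int_fc (fun z => (h z)%:C * (h z)%:C) 0.
  have -> : (fun z => (h z)%:C * (h z)%:C * em (- 0) z) = fun z => (h z)%:C * conjc ((h z)%:C).
    by apply/funext => z; rewrite oppr0 em0 mulr1 cJ_real.
  rewrite sqnE // /be RCM volCV => ->.
  by rewrite mulrA mulVf ?mul1r // volC_neq0.
(* Chosen so that (C1 + C2) d <= be / 2: the terms in |V|^2 are absorbed on the left. *)
pose d := be / (2 * (C1 + C2 + 1)).
have D0 : 0 < C1 + C2 + 1 by rewrite ltr_wpDl // addr_ge0.
have d0 : 0 < d by rewrite divr_gt0 // mulr_gt0.
have dV0 : 0 <= d^-1 by rewrite invr_ge0 ltW.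
exists (2 / be * (C1 * (d^-1 + 1) + C2 * d^-1)).
  by rewrite mulr_ge0 ?divr_ge0 ?(ltW be0) // addr_ge0 // mulr_ge0 // addr_ge0.
move=> x V x1 cV xV.
have e1 := H1 d x V d0 x1 cV xV; have e2 := H2 d V d0 cV.
have Ei : int_torusC (fun z => V z * conjc (V z) * ((h z)%:C * (h z)%:C)) =
   (sqn (fun z => (h z)%:C * V z))%:C.
  rewrite -sqnE; last exact: CinftyC_mul.
  congr int_torusC; apply/funext => z; rewrite cJM cJ_real; ring.
rewrite Ei fcb -RCM -RCB normc_real in e2.
have S0 := sqn_ge0 cV; have E0 := energy_ge0 cb cV.
set S := sqn V in e1 e2 S0 *; set E := energy b V in e1 e2 E0 *.
set Q := sqn _ in e1 e2.
have e3 : S * be <= Q + C2 * (d^-1 * E + d * S).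
  by move: e2; rewrite ler_norml => /andP[? _]; lra.
have dS : (C1 + C2) * d * S <= be / 2 * S.
  rewrite ler_wpM2r //; have -> : (C1 + C2) * d = be / 2 * ((C1 + C2) / (C1 + C2 + 1)).
    by rewrite /d; field; rewrite gt_eqF.
  by rewrite ler_piMr ?divr_ge0 ?(ltW be0) // ler_pdivrMr // mul1r lerDl.
have b2 : 0 < be / 2 by rewrite divr_gt0.
rewrite -(ler_pM2l b2).
have -> : be / 2 * (2 / be * (C1 * (d^-1 + 1) + C2 * d^-1) * E) =
    (C1 * (d^-1 + 1) + C2 * d^-1) * E.
  by move: (d^-1) => dv; field; rewrite gt_eqF.
by move: (d^-1) e1 e3 dS => dv e1 e3 dS; lra.
Qed.


End NonClosed.

(** * Bessel's inequality *)

Section Bessel.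
Variables (R : realType) (N : nat).
Local Notation Z := {ffun 'I_N -> int}.
Implicit Types (phi psi : 'rV[R]_N -> R[i]).

Lemma mul_conjc (x : R[i]) : x * conjc x = (normc x ^+ 2)%:C.
Proof. by apply: complex_eq; rewrite ?cReM ?cImM cReJ cImJ /= ?normc_sqr; ring. Qed.

Lemma int_em_conj phi (th : Z) : CinftyC phi ->
  int_torusC (fun z => conjc (phi z) * em th z) = (vol R N)%:C * conjc (fc phi th).
Proof.
move=> cp; have := congr1 conjc (int_fc phi th); rewrite cJM cJ_real => <-.
rewrite -intC_conj; last exact: CinftyC_mul_em.
by congr int_torusC; apply/funext => z; rewrite cJM -emN opprK.
Qed.

(** The partial sum p is orthogonal to phi - p, so the norm of phi - p is the difference of the two
    sides. *)
Lemma bessel phi K : CinftyC phi ->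
  vol R N * (\sum_j normc (fc phi (@bx N K j)) ^+ 2) <= sqn phi.
Proof.
move=> cp; have cc := CinftyC_conj cp.
pose p := series_approx K (fc phi).
have cP : CinftyC p by exact: CinftyC_series_approx.
have cd : CinftyC (fun z => phi z - p z) by exact: CinftyC_sub.
have fp j : fc p (bx j) = fc phi (@bx N K j).
  rewrite /p /series_approx fc_sum; last by move=> i; apply: CinftyC_scale; exact: CinftyC_em.
  rewrite (bigD1 j) //= fc_scale ?fc_em ?eqxx ?mulr1; last exact: CinftyC_em.
  rewrite big1 ?addr0 // => i ij; rewrite fc_scale ?fc_em; last exact: CinftyC_em.
  by rewrite (inj_eq (@bx_inj N K)) eq_sym (negbTE ij) mulr0.
have I1 : int_torusC (fun z => (phi z - p z) * conjc (p z)) = 0.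
  have -> : (fun z => (phi z - p z) * conjc (p z)) =
    fun z => \sum_j conjc (fc phi (@bx N K j)) * ((phi z - p z) * em (- bx j) z).
    apply/funext => z; rewrite {2}/p /series_approx.
    rewrite (big_morph conjc (@cJD R) (conjc0 R)) mulr_sumr.
    by apply: eq_bigr => j _; rewrite cJM emN mulrCA.
  rewrite intC_sum => [|j]; last by apply: CinftyC_scale; exact: CinftyC_mul_em.
  apply: big1 => j _; rewrite intC_scale; last exact: CinftyC_mul_em.
  by rewrite int_fc fc_sub // fp subrr !mulr0.
have I2 : int_torusC (fun z => (phi z - p z) * conjc (phi z)) =
    (sqn phi - vol R N * (\sum_j normc (fc phi (@bx N K j)) ^+ 2))%:C.
  have -> : (fun z => (phi z - p z) * conjc (phi z)) =
    fun z => phi z * conjc (phi z) - \sum_j fc phi (@bx N K j) * (conjc (phi z) * em (bx j) z).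
    apply/funext => z; rewrite mulrBl; congr (_ - _).
    rewrite mulr_suml; apply: eq_bigr => j _; ring.
  have cs j : CinftyC (fun z => fc phi (@bx N K j) * (conjc (phi z) * em (bx j) z)).
    by apply: CinftyC_scale; exact: CinftyC_mul_em.
  rewrite intC_sub; [|exact: CinftyC_mul|exact: CinftyC_sum].
  rewrite sqnE // RCB; congr (_ - _).
  rewrite intC_sum // RCM RC_sum mulr_sumr; apply: eq_bigr => j _.
  rewrite intC_scale; last exact: CinftyC_mul_em.
  by rewrite int_em_conj // mulrCA mul_conjc.
have : 0 <= sqn (fun z => phi z - p z) by exact: sqn_ge0.
have : (sqn (fun z => phi z - p z))%:C =
    (sqn phi - vol R N * (\sum_j normc (fc phi (@bx N K j)) ^+ 2))%:C.
  rewrite -sqnE // -I2.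
  have -> : (fun z => (phi z - p z) * conjc (phi z - p z)) =
    fun z => (phi z - p z) * conjc (phi z) - (phi z - p z) * conjc (p z).
    by apply/funext => z; rewrite [conjc (_ - _)]rmorphB mulrBr.
  rewrite intC_sub ?I1 ?subr0 //; apply: CinftyC_mul => //; exact: CinftyC_conj.
by move=> /(congr1 (@complex.Re R)) /= ->; rewrite subr_ge0.
Qed.

Lemma fc_cst (c : R[i]) (th : Z) : fc (fun _ : 'rV[R]_N => c) th = if th == 0 then c else 0.
Proof.
have -> : (fun _ : 'rV[R]_N => c) = fun z => c * em 0 z.
  by apply/funext => z; rewrite em0 mulr1.
rewrite fc_scale ?fc_em; last exact: CinftyC_em.
by case: eqP => _; rewrite ?mulr1 ?mulr0.
Qed.

End Bessel.

(** * The potential and the estimate when all c_jk vanish *)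

Section Closed.
Variables (R : realType) (n : nat).
Local Notation T := 'rV[R]_(n + 1).
Local Notation Z := {ffun 'I_(n + 1) -> int}.
Variables (b : 'I_n -> T -> R).
Hypothesis cb : forall j, Cinfty (b j).
Hypothesis bx0 : forall j, partial xco (b j) = fun=> 0.
Hypothesis closed : forall j k z, curv b j k z = 0.

Definition bC j : T -> R[i] := fun z => (b j z)%:C.

Lemma CinftyC_bC j : CinftyC (bC j).
Proof. exact: CinftyC_real. Qed.

Definition mean j : R := complex.Re (fc (bC j) 0).

Lemma fc_mean j : fc (bC j) 0 = (mean j)%:C.
Proof.
apply: complex_eq; first by [].
change (complex.Im (fc (bC j) 0) = 0).
have := fc_conj 0 (CinftyC_bC j); rewrite oppr0.
have -> : (fun z => conjc (bC j z)) = bC j by apply/funext => z; rewrite /bC cJ_real.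
move=> /(congr1 (@complex.Im R)); rewrite cImJ => /eqP.
by rewrite -addr_eq0 -mulr2n mulrn_eq0 => /orP[//|/eqP].
Qed.

Lemma fc_closed j k (th : Z) :
  (0 +i* (th (tco j))%:~R) * fc (bC k) th = (0 +i* (th (tco k))%:~R) * fc (bC j) th.
Proof.
have E1 := fc_dC (tco j) th (CinftyC_bC k); have E2 := fc_dC (tco k) th (CinftyC_bC j).
rewrite -E1 -E2; congr (fc _ th); apply/funext => z; rewrite /bC !dC_real.
by have := closed j k z => /subr0_eq ->.
Qed.

(** The solution of i th_i A = b_i on the Fourier side, for some i with th_i != 0; by [fc_closed]
    every such i gives the same quotient. *)
Definition pot_coef (th : Z) : R[i] :=
  if [pick i | th (tco i) != 0] is Some i then fc (bC i) th / (0 +i* (th (tco i))%:~R) else 0.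

Lemma im_int_neq0 (m : int) : m != 0 -> (0 +i* m%:~R : R[i]) != 0.
Proof. by move=> m0; rewrite eq_complex /= eqxx intr_eq0. Qed.

Lemma rapid_pot_coef : rapid pot_coef.
Proof.
move=> p; have H j : exists C, 0 <= C /\ forall th, normc (fc (bC j) th) * wt R th ^+ p <= C.
  by have [C C0 h] := fc_decay p (CinftyC_bC j); exists C.
have [C hC] := choice H.
exists (\sum_j C j); first by apply: sumr_ge0 => j _; case: (hC j).
move=> th; rewrite /pot_coef; case: pickP => [i hi|_]; last first.
  rewrite ComplexField.Normc.normc0 mul0r; apply: sumr_ge0 => j _; by case: (hC j).
have [Ci0 hCi] := hC i.
apply: (@le_trans _ _ (C i)); last first.
  by rewrite (bigD1 i) //= lerDl sumr_ge0 // => j _; case: (hC j).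
apply: le_trans (hCi th); rewrite ler_wpM2r ?exprn_ge0 ?(ltW (wt_gt0 _ _)) //.
rewrite normcM ComplexField.Normc.normcV normc_i.
have t1 : 1 <= `|(th (tco i))%:~R : R|.
  by rewrite -intr_norm -[1]/(1%:~R) ler_int -gtz0_ge1 normr_gt0.
by rewrite ler_pdivrMr ?ler_peMr ?normc_ge0 // (lt_le_trans ltr01).
Qed.

(** On the Fourier side, dividing by i th_i fails only where all t-frequencies vanish. There b_j
    contributes nothing but its mean, being independent of x. *)
Lemma potential : exists A : T -> R, [/\ Cinfty A, partial xco A = fun=> 0 &
  forall j, partial (tco j) A = fun z => b j z - mean j].
Proof.
have [F cF hF] := fourier_inverse rapid_pot_coef.
have Fx : dC xco F = fun=> 0.
  apply: fc_inj; [exact: CinftyC_dC|exact: CinftyC_cst|move=> th].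
  rewrite fc_dC // hF fc_cst if_same /pot_coef.
  have [->|thx] := eqVneq (th xco) 0.
    by apply: complex_eq; rewrite ?cReM ?cImM /=; ring.
  case: pickP => [i _|_]; last by rewrite mulr0.
  rewrite (fc_xco_eq0 (CinftyC_bC i) _ thx) ?mul0r ?mulr0 //.
  by rewrite /bC dC_real bx0.
have Ft j : dC (tco j) F = fun z => (b j z)%:C - (mean j)%:C.
  have cm : CinftyC (fun _ : T => (mean j)%:C) by exact: CinftyC_cst.
  apply: fc_inj; [exact: CinftyC_dC|exact: CinftyC_sub (CinftyC_bC j) cm|move=> th].
  have := fc_sub th (CinftyC_bC j) cm; rewrite /bC => ->.
  rewrite fc_dC // hF fc_cst -/(bC j).
  have [->|th0] := eqVneq th 0.
    by rewrite fc_mean subrr ffunE; apply: complex_eq; rewrite ?cReM ?cImM /=; ring.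
  rewrite subr0 /pot_coef; case: pickP => [i hi|h].
    by rewrite mulrA (fc_closed j i th) mulrC mulKf // im_int_neq0.
  have thx : th xco != 0.
    apply: contra th0 => /eqP tx; apply/eqP/ffunP => k; rewrite [RHS]ffunE.
    by case: (coP k) => [[i ->]|->] //; have := h i => /negbFE/eqP.
  rewrite (fc_xco_eq0 (CinftyC_bC j) _ thx) ?mulr0 //.
  by rewrite /bC dC_real bx0.
(* The functions b_j and their means are real, so the real part of F solves the same equations. *)
exists (re_part F); split.
- by case: cF.
- apply/funext => z; have := congr1 (fun g => complex.Re (g z)) Fx.
  by rewrite /= Re_dC.
- move=> j; apply/funext => z; have := congr1 (fun g => complex.Re (g z)) (Ft j).
  by rewrite /= Re_dC => ->.
Qed.

Lemma closed_estimate (A : T -> R) (m : int) (de : R) (V : T -> R[i]) :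
  Cinfty A -> partial xco A = (fun=> 0) ->
  (forall j, partial (tco j) A = fun z => b j z - mean j) ->
  0 < de ->
  (forall eta : 'I_n -> int, exists j, de <= `|(eta j)%:~R + mean j * m%:~R|) ->
  CinftyC V -> xfreq m%:~R V -> de ^+ 2 * sqn V <= energy b V.
Proof.
move=> cA Ax At de0 hde cV xV.
pose E z := expi (m%:~R * A z).
have sA : smooth (fun z => m%:~R * A z) by apply: smoothZ; case: cA.
have cE : CinftyC E.
  apply: CinftyC_expi => // k z; have [_ pA] := cA; by rewrite pA.
have dE k : dC k E = fun z => (0 +i* (m%:~R * partial k A z)) * E z.
  rewrite /E dC_expi // partialZ //; by case: cA.
pose psi z := E z * V z; have cpsi : CinftyC psi by exact: CinftyC_mul.
pose al (j : 'I_n) : T -> R := fun=> mean j.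
have cal j : Cinfty (al j) by exact: Cinfty_cst.
have dx : dC xco psi = fun z => (0 +i* m%:~R) * psi z.
  apply: (eq_trans (dC_mul xco cE cV)); apply/funext => z.
  rewrite dE Ax xV /psi; apply: complex_eq; rewrite ?(cReD, cImD, cReM, cImM) /=; ring.
have Y j : Xop al j psi = fun z => E z * Xop b j V z.
  apply/funext => z; rewrite /Xop dx.
  have -> := congr1 (fun g => g z) (dC_mul (tco j) cE cV).
  rewrite dE At xV /psi /al; move: (E z) (V z) (dC (tco j) V z) (b j z) (mean j) => e v w p q.
  apply: complex_eq; rewrite ?(cReD, cImD, cReM, cImM) /=; ring.
have sY j : sqn (Xop al j psi) = sqn (Xop b j V).
  rewrite Y; congr int_torus; apply/funext => z.
  by rewrite -!normc_sqr normcM normc_expi mul1r.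
have sp : sqn psi = sqn V.
  congr int_torus; apply/funext => z.
  by rewrite -!normc_sqr normcM normc_expi mul1r.
have fY j (th : Z) : fc (Xop al j psi) th =
    (0 +i* ((th (tco j))%:~R + mean j * m%:~R)) * fc psi th.
  have -> : Xop al j psi = fun z => dC (tco j) psi z + (mean j)%:C * dC xco psi z by [].
  rewrite fc_add ?fc_scale; try exact: CinftyC_dC; last first.
    by apply: CinftyC_scale; exact: CinftyC_dC.
  rewrite fc_dC // dx fc_scale //.
  move: (fc psi th) (mean j) => p q; apply: complex_eq; rewrite ?(cReD, cImD, cReM, cImM) /=; ring.
have v0 := vol_gt0 R (n + 1).
rewrite -sp -(ler_pdivlMl _ _ (exprn_gt0 2 de0)).
have -> : sqn psi = normc ((sqn psi)%:C).
  by rewrite normc_real ger0_norm // sqn_ge0.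
rewrite -sqnE //.
have -> : (fun z => psi z * conjc (psi z)) = fun z => conjc (psi z) * psi z.
  by apply/funext => z; rewrite mulrC.
(* The missing half of Parseval: the norm of psi is the functional [integral of conj psi times .]
   evaluated at psi, hence bounded by the sums of its squared coefficients. *)
apply: (wdist_le (wdist_int (CinftyC_conj cpsi)) cpsi) => K.
rewrite ler_pdivlMl ?exprn_gt0 //.
under eq_bigr => j _.
  rewrite (int_em_conj _ cpsi) normcM normc_real (ger0_norm (ltW v0)) normcJ mulrCA -expr2.
over.
rewrite -mulr_sumr mulrCA.
apply: (@le_trans _ _ (\sum_i vol R (n + 1) * \sum_j normc (fc (Xop al i psi) (@bx _ K j)) ^+ 2)).
  rewrite -mulr_sumr ler_wpM2l ?(ltW v0) // mulr_sumr exchange_big /=.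
  apply: ler_sum => j _.
  have [i hi] := hde (fun i => bx j (tco i)).
  rewrite (bigD1 i) //= fY normcM normc_i exprMn.
  rewrite ler_wpDr ?sumr_ge0 // => [k _|]; first exact: sqr_ge0.
  rewrite ler_wpM2r ?sqr_ge0 //; apply: lerXn2r => //; rewrite ?nnegrE // ltW //.
rewrite /energy; apply: ler_sum => i _; rewrite -sY.
by apply: bessel; exact: CinftyC_Xop.
Qed.

End Closed.

(** * Sufficiency *)

Section Frequency.
Variables (R : realType) (n : nat).
Local Notation T := 'rV[R]_(n + 1).
Local Notation Z := {ffun 'I_(n + 1) -> int}.
Implicit Types (phi V : T -> R[i]).

Lemma int_em_fc (F : T -> R[i]) (th : Z) :
  int_torusC (fun z => F z * em th z) = (vol R (n + 1))%:C * fc F (- th).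
Proof. by rewrite -int_fc opprK. Qed.

Lemma fc_xfreq (m : int) phi (th : Z) : CinftyC phi -> xfreq m%:~R phi ->
  th xco != m -> fc phi th = 0.
Proof.
move=> cp xp hm; have := fc_dC xco th cp; rewrite xp fc_scale // => /eqP.
rewrite -subr_eq0 -mulrBl mulf_eq0 => /orP[|/eqP//].
have -> : (0 +i* m%:~R) - (0 +i* (th xco)%:~R) = 0 +i* (m - th xco)%:~R :> R[i].
  by apply: complex_eq; rewrite ?cReD ?cImD ?cReN ?cImN /= ?subr0 // rmorphB.
by rewrite eq_complex /= eqxx intr_eq0 subr_eq0 eq_sym (negbTE hm).
Qed.

Lemma xfreqI (m : int) phi : CinftyC phi -> (forall th : Z, th xco != m -> fc phi th = 0) ->
  xfreq m%:~R phi.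
Proof.
move=> cp h; apply: fc_inj; [exact: CinftyC_dC|exact: CinftyC_scale|move=> th].
rewrite fc_dC // fc_scale //; have [->//|/h ->] := eqVneq (th xco) m.
by rewrite !mulr0.
Qed.

Lemma xfreq_conj x phi : CinftyC phi -> xfreq x phi -> xfreq (- x) (fun z => conjc (phi z)).
Proof.
move=> cp xp; rewrite /xfreq (dC_conj xco cp) xp; apply/funext => z.
by rewrite cJM; congr (_ * _); apply: complex_eq; rewrite ?cReJ ?cImJ.
Qed.

Variables (b : 'I_n -> T -> R).
Hypothesis cb : forall j, Cinfty (b j).
Hypothesis bx0 : forall j, partial xco (b j) = fun=> 0.

Lemma xfreq_Xop x j phi : CinftyC phi -> xfreq x phi -> xfreq x (Xop b j phi).
Proof. by move=> cp xp; rewrite /xfreq dC_xco_Xop // xp Xop_scale. Qed.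

Lemma xfreq_sumX2 x phi : CinftyC phi -> xfreq x phi -> xfreq x (sumX2 b phi).
Proof.
move=> cp xp; have cX j := CinftyC_Xop cb j (CinftyC_Xop cb j cp).
apply: (eq_trans (dC_sum xco _ _ cX)); apply/funext => z.
rewrite /sumX2 mulr_sumr; apply: eq_bigr => j _.
by have -> := xfreq_Xop j (CinftyC_Xop cb j cp) (xfreq_Xop j cp xp).
Qed.

Lemma int_xfreq_parts x V (f : T -> R[i]) k : CinftyC V -> CinftyC f -> xfreq x V ->
  normc (int_torusC (fun z => partialsC (nseq k xco) f z * V z)) =
  `|x| ^+ k * normc (int_torusC (fun z => f z * V z)).
Proof.
move=> cV cf xV; elim: k => [|k IH]; first by rewrite partialsC_nil mul1r.
have ck := CinftyC_partials (nseq k xco) cf.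
rewrite partialsC_cons (intC_parts xco ck cV) normcN xV.
have -> : (fun z => partialsC (nseq k xco) f z * ((0 +i* x) * V z)) =
  fun z => (0 +i* x) * (partialsC (nseq k xco) f z * V z).
  by apply/funext => z; rewrite mulrCA.
rewrite intC_scale; last exact: CinftyC_mul.
by rewrite normcM normc_i IH exprS mulrA.
Qed.

End Frequency.

(** * From the estimate to the smoothness of u *)

Section Sufficiency.
Variables (R : realType) (n : nat).
Local Notation T := 'rV[R]_(n + 1).
Local Notation Z := {ffun 'I_(n + 1) -> int}.
Variables (b : 'I_n -> T -> R).
Hypothesis cb : forall j, Cinfty (b j).
Hypothesis bx0 : forall j, partial xco (b j) = fun=> 0.
Variables (C : R) (p : nat).
Hypothesis C0 : 0 <= C.
Hypothesis est : forall (m : int) (V : T -> R[i]), m != 0 -> CinftyC V -> xfreq m%:~R V ->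
  sqn V <= C * (1 + `|m%:~R : R|) ^+ p * energy b V.
Variables (u : functional R (n + 1)) (f : T -> R[i]).
Hypothesis du : is_distribution u.
Hypothesis cf : CinftyC f.
Hypothesis Pu : forall phi, CinftyC phi -> u (sumX2 b phi) = int_torusC (fun z => f z * phi z).

Let wu : wdist u := is_distribution_wdist du.

Definition ucoef (th : Z) : R[i] := ((vol R (n + 1))^-1)%:C * u (em (- th)).

Lemma ucoefE (th : Z) : (vol R (n + 1))%:C * ucoef (- th) = u (em th).
Proof. by rewrite /ucoef opprK volCV mulrA divff ?mul1r // volC_neq0. Qed.

Lemma ucoef_bootstrap k : exists A, exists M, 0 <= A /\
  forall th, normc (ucoef th) * wtt R th ^+ k <= A * wx R th ^+ M.
Proof.
have [m [B B0 hB]] := distribution_growth du.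
have [A [M [A0 hA]]] := bootstrap cb bx0 wu cf Pu B0 hB k.
have v0 := vol_gt0 R (n + 1).
exists ((vol R (n + 1))^-1 * A), M; split; first by rewrite mulr_ge0 // invr_ge0 ltW.
move=> th; rewrite /ucoef normcM normc_real ger0_norm ?invr_ge0 ?(ltW v0) //.
by rewrite -!mulrA ler_wpM2l ?invr_ge0 ?(ltW v0).
Qed.

(** On frequencies th with th_x = m the factor [wx] is constant, so the bootstrap gives rapid decay
    outright. *)
Lemma frequency_part (m : int) : exists2 V : T -> R[i], CinftyC V &
  xfreq m%:~R V /\ forall th : Z, th xco = m -> fc V th = ucoef th.
Proof.
pose c (th : Z) : R[i] := if th xco == m then ucoef th else 0.
have rc : rapid c.
  move=> k; have [A [M [A0 hA]]] := ucoef_bootstrap k.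
  pose X := 1 + `|m%:~R : R|; have X0 : 0 <= X by rewrite addr_ge0.
  exists (A * X ^+ M * X ^+ k); first by rewrite !mulr_ge0 ?exprn_ge0.
  move=> th; rewrite /c; case: eqP => [thm|_]; last first.
    by rewrite ComplexField.Normc.normc0 mul0r !mulr_ge0 ?exprn_ge0.
  have xX : wx R th = X by rewrite /wx thm.
  apply: (@le_trans _ _ (normc (ucoef th) * (wtt R th ^+ k * X ^+ k))).
    rewrite ler_wpM2l ?normc_ge0 // -exprMn -xX.
    have w0 := ltW (wt_gt0 R th); have t0 := ltW (wtt_gt0 R th); have x0 := ltW (wx_gt0 R th).
    by apply: lerXn2r; rewrite ?nnegrE ?mulr_ge0 // wt_le_mul.
  rewrite mulrA ler_wpM2r ?exprn_ge0 //; apply: le_trans (hA th) _.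
  by rewrite xX.
have [V cV hV] := fourier_inverse rc; exists V => //; split.
  by apply: xfreqI => // th hm; rewrite hV /c (negbTE hm).
by move=> th hm; rewrite hV /c hm eqxx.
Qed.

(** Pairing the equation with conj V gives the energy of V as an integral of f conj V. Integrations
    by parts in x turn f into a derivative and gain a power of m; the estimate turns the resulting
    |V|^2 back into energy, which is absorbed. *)
Lemma frequency_decay k : exists2 D, 0 <= D & forall th : Z, th xco != 0 ->
  normc (ucoef th) * wx R th ^+ k <= D.
Proof.
(* k powers of m are wanted, and p more repay the loss in the estimate. *)
pose l := (k + p)%N; pose fl := partialsC (nseq l xco) f.
have cfl : CinftyC fl by exact: CinftyC_partials.
have v0 := vol_gt0 R (n + 1).
pose D1 := 4 * 4 ^+ l * (C + 1) ^+ 2 * sqn fl.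
have D10 : 0 <= D1 by rewrite !mulr_ge0 ?exprn_ge0 ?addr_ge0 // sqn_ge0.
exists ((vol R (n + 1))^-1 * (D1 + vol R (n + 1))).
  by rewrite mulr_ge0 ?invr_ge0 ?addr_ge0 // ltW.
move=> th th0; set m := th xco; have [V cV [xV hV]] := frequency_part m.
have cVb := CinftyC_conj cV; have xVb := xfreq_conj cV xV.
pose X := 1 + `|m%:~R : R|; have X0 : 0 < X by rewrite ltr_pwDl.
have m1 : 1 <= `|m%:~R : R|.
  by rewrite -intr_norm -[1]/(1%:~R) ler_int -gtz0_ge1 normr_gt0.
have X1 : 1 <= X by rewrite lerDl.
have E0 : 0 <= energy b V by exact: energy_ge0.
(* conj V has the single x-frequency -m, so u may be replaced by V in the pairing. *)
have EI : energy b V = normc (int_torusC (fun z => f z * conjc (V z))).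
  have cS := CinftyC_sumX2 cb cVb.
  have H : int_torusC (fun z => V z * sumX2 b (fun z => conjc (V z)) z) =
      u (sumX2 b (fun z => conjc (V z))).
    apply/eqP; rewrite -subr_eq0; apply/eqP.
    apply: (wdist_eq0 (wdist_sub (wdist_int cV) wu) cS) => et.
    have [em|em] := eqVneq (et xco) (- m); last first.
      left; apply: (fc_xfreq cS _ em); rewrite rmorphN.
      exact: xfreq_sumX2.
    right; rewrite int_em_fc hV; last by rewrite ffunE em opprK.
    by rewrite ucoefE subrr.
  rewrite -(Pu cVb) -H int_sumX2_conj // normcN normc_real ger0_norm //.
have K := int_xfreq_parts l cVb cf xVb; rewrite -EI normrN in K.
have S0 := sqn_ge0 cV; have F0 := sqn_ge0 cfl.
pose Q := (C + 1) * X ^+ p.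
have Q0 : 0 < Q by rewrite mulr_gt0 ?exprn_gt0 // ltr_wpDl.
have SQ : sqn V <= Q * energy b V.
  apply: (le_trans (est th0 cV xV)); rewrite -/X ler_wpM2r // /Q ler_wpM2r ?exprn_ge0 ?(ltW X0) //.
  by rewrite lerDl.
pose y := `|m%:~R : R| ^+ l; have y0 : 0 < y by rewrite exprn_gt0 // (lt_le_trans ltr01).
have B1 : y * energy b V <= 4 * Q * sqn fl / y.
  (* With this parameter in Young's inequality the term in |V|^2 is at most half of the left
     side. *)
  have d0 : 0 < y / (2 * Q) by rewrite divr_gt0 // mulr_gt0.
  have := normc_int_mul d0 cfl cVb; rewrite -/fl K -/y sqn_conj => h.
  have h2 : y / (2 * Q) * sqn V <= y / 2 * energy b V.
    have -> : y / 2 * energy b V = y / (2 * Q) * (Q * energy b V) by field; rewrite gt_eqF.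
    by rewrite ler_wpM2l // ltW.
  have -> : 4 * Q * sqn fl / y = 2 * ((y / (2 * Q))^-1 * sqn fl).
    by field; rewrite !gt_eqF.
  by move: ((y / (2 * Q))^-1 * sqn fl) h => q h; lra.
have B2 : sqn V * X ^+ (2 * k) <= D1.
  have y2 : X ^+ l <= 2 ^+ l * y.
    rewrite -exprMn; apply: lerXn2r; rewrite ?nnegrE ?mulr_ge0 ?(ltW X0) //.
    by rewrite /X; lra.
  have B3 : energy b V * y ^+ 2 <= 4 * Q * sqn fl.
    by move: B1; rewrite ler_pdivlMr // => B1; apply: le_trans B1; rewrite le_eqVlt; apply/orP; left; apply/eqP; ring.
  have Xl : X ^+ l = X ^+ k * X ^+ p by rewrite exprD.
  have y3 : X ^+ l * X ^+ l <= 4 ^+ l * y ^+ 2.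
    have -> : 4 ^+ l * y ^+ 2 = (2 ^+ l * y) * (2 ^+ l * y) :> R.
      have -> : 4 = 2 * 2 :> R by ring.
      by rewrite exprMn; ring.
    by apply: ler_pM; rewrite ?exprn_ge0 ?(ltW X0).
  have Xp0 : 0 < X ^+ p by rewrite exprn_gt0.
  rewrite -(ler_pM2r (mulr_gt0 Xp0 Xp0)).
  have -> : sqn V * X ^+ (2 * k) * (X ^+ p * X ^+ p) = sqn V * (X ^+ l * X ^+ l).
    by rewrite Xl mul2n -addnn exprD; ring.
  apply: (@le_trans _ _ (Q * energy b V * (4 ^+ l * y ^+ 2))).
    by apply: ler_pM => //; rewrite mulr_ge0 // exprn_ge0 // ltW.
  have -> : Q * energy b V * (4 ^+ l * y ^+ 2) = Q * 4 ^+ l * (energy b V * y ^+ 2) by ring.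
  apply: (@le_trans _ _ (Q * 4 ^+ l * (4 * Q * sqn fl))).
    by rewrite ler_wpM2l // mulr_ge0 ?exprn_ge0 // ltW.
  by rewrite /D1 /Q le_eqVlt; apply/orP; left; apply/eqP; ring.
have xX : wx R th = X by [].
rewrite -(hV th erefl) ler_pdivlMl // xX mulrA.
(* |V|^2 is of order X^(-2k), so with d = X^(-k) both terms of the bound on a coefficient have order
   X^(-k). *)
have d0 : 0 < (X ^+ k)^-1 by rewrite invr_gt0 exprn_gt0.
have Xk0 : 0 < X ^+ k by rewrite exprn_gt0.
have := normc_fc_sqn th d0 cV; rewrite invrK => h.
apply: (le_trans (ler_wpM2r (ltW Xk0) h)); rewrite mulrDl; apply: lerD.
  apply: le_trans B2; rewrite mul2n -addnn exprD le_eqVlt; apply/orP; left; apply/eqP; ring.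
by rewrite mulrAC mulVf ?mul1r // gt_eqF.
Qed.

(** Interpolation by a geometric mean: y^2 is the product of a bound with decay in t and growth in
    x, and of one with enough decay in x to absorb that growth. At x-frequency 0 the first bound
    suffices. *)
Lemma rapid_ucoef : rapid ucoef.
Proof.
move=> q.
have [A [M [A0 hA]]] := ucoef_bootstrap (2 * q).
have [D D0 hD] := frequency_decay (2 * q + M).
have AD0 : 0 <= A * (D + A) by rewrite mulr_ge0 // addr_ge0.
exists (1 + A * (D + A)); first by rewrite addr_ge0.
move=> th; have x1 := wx_ge1 R th; have x0 := wx_gt0 R th; have t0 := wtt_gt0 R th.
have c0 := normc_ge0 (ucoef th).
have B : normc (ucoef th) * wx R th ^+ (2 * q + M) <= D + A.
  have [thx|thx] := eqVneq (th xco) 0; last first.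
    by apply: (le_trans (hD th thx)); rewrite lerDl.
  have -> : wx R th = 1 by rewrite /wx thx normr0 addr0.
  have := hA th; have -> : wx R th = 1 by rewrite /wx thx normr0 addr0.
  rewrite !expr1n !mulr1 => h; apply: (@le_trans _ _ A); last by rewrite lerDr.
  apply: le_trans h; rewrite ler_peMr //; apply: exprn_ege1; exact: wtt_ge1.
pose y := normc (ucoef th) * (wtt R th * wx R th) ^+ q.
have y0 : 0 <= y by rewrite mulr_ge0 // exprn_ge0 // mulr_ge0 ?(ltW x0) ?(ltW t0).
have y2 : y ^+ 2 <= A * (D + A).
  have -> : y ^+ 2 = (normc (ucoef th) * wtt R th ^+ (2 * q)) * (normc (ucoef th) * wx R th ^+ (2 * q)).
    have E (t : R) : t ^+ (2 * q) = t ^+ q * t ^+ q by rewrite mul2n -addnn exprD.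
    rewrite !E /y !exprMn; move: (normc _) (wtt R th ^+ q) (wx R th ^+ q) => r1 r2 r3; ring.
  apply: (@le_trans _ _ (A * wx R th ^+ M * (normc (ucoef th) * wx R th ^+ (2 * q)))).
    by rewrite ler_wpM2r ?hA // mulr_ge0 // exprn_ge0 // ltW.
  rewrite -mulrA ler_wpM2l //; apply: le_trans B; rewrite exprD.
  move: (normc _) (wx R th ^+ M) (wx R th ^+ (2 * q)) => r1 r2 r3.
  by rewrite le_eqVlt; apply/orP; left; apply/eqP; ring.
apply: (@le_trans _ _ y).
  rewrite /y ler_wpM2l //; have w0 := ltW (wt_gt0 R th).
  by apply: lerXn2r; rewrite ?nnegrE ?mulr_ge0 ?(ltW x0) ?(ltW t0) // wt_le_mul.
have [y1|y1] := leP y 1; first by rewrite (le_trans y1) // lerDl.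
apply: (@le_trans _ _ (y ^+ 2)); first by rewrite expr2 ler_peMr // ltW.
by apply: (le_trans y2); rewrite lerDr.
Qed.

Lemma distribution_smooth : is_smooth u.
Proof.
have [F cF hF] := fourier_inverse rapid_ucoef.
exists F => // phi cp; apply/eqP; rewrite -subr_eq0; apply/eqP.
apply: (wdist_eq0 (wdist_sub wu (wdist_int cF)) cp) => th; right.
by rewrite int_em_fc hF ucoefE subrr.
Qed.

End Sufficiency.

(** * Necessity *)

Section ComplexSequences.
Variable R : realType.
Implicit Types (s t : nat -> R[i]) (l : R[i]).

Definition cvgC s l := forall e, 0 < e -> exists K0, forall K, (K0 <= K)%N -> normc (s K - l) <= e.

Lemma cvgC_exists s :
  (forall e, 0 < e -> exists K0, forall K L, (K0 <= K)%N -> (K0 <= L)%N -> normc (s K - s L) <= e) ->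
  exists l, cvgC s l.
Proof.
move=> hs.
(* A sequence is viewed as a sequence of functions on the one-point space ['rV[R]_0], to which
   [uniform_limit] applies. *)
have [F hF] : exists F : 'rV[R]_0 -> R, forall e, 0 < e -> exists K0, forall K, (K0 <= K)%N ->
    forall z, `|complex.Re (s K) - F z| <= e.
  apply: (@uniform_limit _ _ (fun K _ => complex.Re (s K))) => e /hs[K0 h].
  exists K0 => K L a b _; apply: le_trans (h K L a b).
  by apply: le_trans (normc_Re _); rewrite cReD cReN.
have [G hG] : exists F : 'rV[R]_0 -> R, forall e, 0 < e -> exists K0, forall K, (K0 <= K)%N ->
    forall z, `|complex.Im (s K) - F z| <= e.
  apply: (@uniform_limit _ _ (fun K _ => complex.Im (s K))) => e /hs[K0 h].
  exists K0 => K L a b _; apply: le_trans (h K L a b).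
  by apply: le_trans (normc_Im _); rewrite cImD cImN.
exists (F 0 +i* G 0) => e e0; have e2 : 0 < e / 2 by rewrite divr_gt0.
have [K1 h1] := hF _ e2; have [K2 h2] := hG _ e2.
exists (maxn K1 K2) => K; rewrite geq_max => /andP[a b].
apply: (le_trans (normc_le_ReIm _)); rewrite cReD cImD cReN cImN.
by have := lerD (h1 K a 0) (h2 K b 0); rewrite -splitr.
Qed.

Lemma cvgC_unique s l l' : cvgC s l -> cvgC s l' -> l = l'.
Proof.
move=> h h'; apply/eqP; rewrite -subr_eq0; apply/eqP/normc_eq0/eqP.
rewrite eq_le normc_ge0 andbT; apply/ler_addgt0Pl => e e0; rewrite addr0.
have e2 : 0 < e / 2 by rewrite divr_gt0.
have [K1 h1] := h _ e2; have [K2 h2] := h' _ e2.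
have a := h1 _ (leq_maxl K1 K2); have b := h2 _ (leq_maxr K1 K2).
set x := s _ in a b; have -> : l - l' = (x - l') - (x - l) by ring.
by apply: (le_trans (normcB _ _)); rewrite [e]splitr lerD.
Qed.

Lemma cvgC_lin c s t l l' : cvgC s l -> cvgC t l' -> cvgC (fun K => c * s K + t K) (c * l + l').
Proof.
move=> h h' e e0; have c1 : 0 < normc c + 1 by rewrite ltr_wpDl ?normc_ge0.
have e2 : 0 < e / 2 by rewrite divr_gt0.
have e3 : 0 < e / 2 / (normc c + 1) by rewrite divr_gt0.
have [K1 h1] := h _ e3; have [K2 h2] := h' _ e2.
exists (maxn K1 K2) => K; rewrite geq_max => /andP[/h1 a /h2 b].
have -> : c * s K + t K - (c * l + l') = c * (s K - l) + (t K - l') by ring.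
apply: (le_trans (normcD _ _)); rewrite [e]splitr lerD // normcM.
apply: (le_trans (ler_wpM2l (normc_ge0 _) a)).
by rewrite mulrCA ler_piMr ?(ltW e2) // ler_pdivrMr // mul1r lerDl.
Qed.

Lemma cvgC_le s l M : cvgC s l -> (forall K, normc (s K) <= M) -> normc l <= M.
Proof.
move=> h hM; apply/ler_addgt0Pl => e e0; have [K hK] := h e e0.
have := hK K (leqnn _) => a; have -> : l = s K - (s K - l) by ring.
by apply: (le_trans (normcB _ _)); rewrite addrC lerD.
Qed.

Lemma cvgC_Re_ge s l M K0 : cvgC s l -> (forall K, (K0 <= K)%N -> M <= complex.Re (s K)) ->
  M <= complex.Re l.
Proof.
move=> h hM; rewrite -subr_ge0; apply/ler_addgt0Pr => e e0; have [K1 hK] := h e e0.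
have a := le_trans (normc_Re _) (hK _ (leq_maxr K0 K1)).
have b := hM _ (leq_maxl K0 K1).
rewrite cReD cReN ler_norml in a; have /andP[_ a2] := a; lra.
Qed.

Lemma geometric_tail (f : nat -> R[i]) (D : R) K0 : 0 <= D ->
  (forall k, (K0 <= k)%N -> normc (f k) <= D * 2^-1 ^+ k) ->
  forall K L, (K0 <= K)%N -> (K <= L)%N ->
  normc (\sum_(k < L) f k - \sum_(k < K) f k) <= 2 * D * 2^-1 ^+ K.
Proof.
move=> D0 hf K L K0K KL.
suff H : normc (\sum_(k < L) f k - \sum_(k < K) f k) <= 2 * D * (2^-1 ^+ K - 2^-1 ^+ L).
  by apply: (le_trans H); rewrite ler_wpM2l ?mulr_ge0 // gerBl exprn_ge0.
elim: L KL => [|L IH]; first by rewrite leqn0 => /eqP ->; rewrite !subrr ComplexField.Normc.normc0 mulr0.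
rewrite leq_eqVlt => /orP[/eqP ->|]; first by rewrite !subrr ComplexField.Normc.normc0 mulr0.
rewrite ltnS => KL; rewrite big_ord_recr /= addrAC.
apply: (le_trans (normcD _ _)).
apply: (le_trans (lerD (IH KL) (hf L (leq_trans K0K KL)))).
rewrite exprS; move: (2^-1 ^+ K) (2^-1 ^+ L) => x y.
by rewrite le_eqVlt; apply/orP; left; apply/eqP; field.
Qed.

Lemma half_pow_lt (e : R) : 0 < e -> exists K, 2^-1 ^+ K < e.
Proof.
move=> e0; exists (Num.truncn e^-1).+1; set K := (Num.truncn e^-1).+1.
have h : e^-1 < 2 ^+ K.
  apply: lt_le_trans (truncnS_gt _) _; rewrite -natrX ler_nat; exact: ltnW (ltn_expl _ _).
by rewrite exprVn -[e]invrK ltf_pV2 ?posrE ?invr_gt0 ?exprn_gt0.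
Qed.

End ComplexSequences.

(** * A singular distribution with a smooth image *)

Section Singular.
Variables (R : realType) (n : nat).
Local Notation T := 'rV[R]_(n + 1).
Local Notation Z := {ffun 'I_(n + 1) -> int}.
Variables (b : 'I_n -> T -> R) (al : 'I_n -> R) (A : T -> R).
Hypothesis cb : forall j, Cinfty (b j).
Hypothesis bx0 : forall j, partial xco (b j) = fun=> 0.
Hypothesis cA : Cinfty A.
Hypothesis Ax : partial xco A = fun=> 0.
Hypothesis At : forall j, partial (tco j) A = fun z => b j z - al j.
Variable ze : nat -> Z.
Local Notation xi k := ((ze k xco)%:~R : R).
Hypothesis xi_large : forall k, 2 ^+ k <= `|xi k|.
Hypothesis ze_close : forall k j,
  `|(ze k (tco j))%:~R + al j * xi k| <= (1 + `|xi k|) ^- k.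

Lemma xi_ge1 k : 1 <= `|xi k|.
Proof. by apply: le_trans (xi_large k); apply: exprn_ege1; rewrite ler1n. Qed.

(* Resonant modes: in the coordinate x - A(t) they are pure exponentials. *)
Definition mode k : T -> R[i] := fun z => expi (dotz (ze k) z + - xi k * A z).

Lemma modeE k z : mode k z = em (ze k) z * expi (- xi k * A z).
Proof. by rewrite /mode expiD. Qed.

Let smooth_phase k : smooth (fun z => dotz (ze k) z + - xi k * A z).
Proof. by apply: smoothD; [exact: smooth_dotr|apply: smoothZ; case: cA]. Qed.

Lemma CinftyC_mode k : CinftyC (mode k).
Proof.
apply: CinftyC_expi => // l z; rewrite -!/(mode _ _) !modeE periodic_em.
by have [_ ->] := cA.
Qed.

Lemma normc_mode k z : normc (mode k z) = 1.
Proof. exact: normc_expi. Qed.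

Lemma dC_mode k l : dC l (mode k) =
  fun z => (0 +i* ((ze k l)%:~R - xi k * partial l A z)) * mode k z.
Proof.
rewrite /mode (dC_expi l (smooth_phase k)); apply/funext => z.
have sA : smooth A by case: cA.
rewrite (partialD l (smooth_dotr _) (smoothZ (- xi k) sA)) (partialZ _ _ sA).
by rewrite partial_dotr mulNr.
Qed.

Lemma xfreq_mode k : xfreq (xi k) (mode k).
Proof. by rewrite /xfreq dC_mode Ax; apply/funext => z; rewrite mulr0 subr0. Qed.

Lemma Xop_mode k j : Xop b j (mode k) =
  fun z => (0 +i* ((ze k (tco j))%:~R + al j * xi k)) * mode k z.
Proof.
apply/funext => z; rewrite /Xop xfreq_mode dC_mode At.
move: (mode k z) (b j z) => e p.
by apply: complex_eq; rewrite !(cReD, cImD, cReM, cImM) /=; ring.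
Qed.

(** The eigenvalue of -P at [mode k], a sum of squares of small divisors. *)
Definition lam k : R := \sum_j ((ze k (tco j))%:~R + al j * xi k) ^+ 2.

Lemma sumX2_mode k : sumX2 b (mode k) = fun z => - (lam k)%:C * mode k z.
Proof.
apply/funext => z; rewrite /sumX2 /lam RC_sum -sumrN mulr_suml; apply: eq_bigr => j _.
rewrite Xop_mode; have -> := congr1 (fun f => f z) (Xop_scale b j (0 +i* ((ze k (tco j))%:~R + al j * xi k)) (CinftyC_mode k)).
rewrite Xop_mode; move: (mode k z) => e.
by apply: complex_eq; rewrite !(cReM, cImM, cReN, cImN) /=; ring.
Qed.

Lemma int_sumX2 (f g : T -> R[i]) : CinftyC f -> CinftyC g ->
  int_torusC (fun z => f z * sumX2 b g z) = int_torusC (fun z => sumX2 b f z * g z).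
Proof.
move=> cf cg; have cX j h (ch : CinftyC h) := CinftyC_Xop cb j ch.
have -> : (fun z => f z * sumX2 b g z) = fun z => \sum_j f z * Xop b j (Xop b j g) z.
  by apply/funext => z; rewrite mulr_sumr.
have -> : (fun z => sumX2 b f z * g z) = fun z => \sum_j Xop b j (Xop b j f) z * g z.
  by apply/funext => z; rewrite mulr_suml.
rewrite intC_sum => [|j]; last exact: CinftyC_mul cf (cX j _ (cX j _ cg)).
rewrite intC_sum => [|j]; last exact: CinftyC_mul (cX j _ (cX j _ cf)) cg.
apply: eq_bigr => j _.
have -> := int_Xop_parts cb bx0 j (cX j _ cf) cg.
by have -> := int_Xop_parts cb bx0 j cf (cX j _ cg); rewrite opprK.
Qed.

Lemma int_mode_sumX2 k g : CinftyC g ->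
  int_torusC (fun z => mode k z * sumX2 b g z) = - (lam k)%:C * int_torusC (fun z => mode k z * g z).
Proof.
move=> cg; rewrite (int_sumX2 (CinftyC_mode k) cg) sumX2_mode.
rewrite -intC_scale; last exact: CinftyC_mul (CinftyC_mode k) cg.
by congr int_torusC; apply/funext => z; rewrite mulrA.
Qed.

(** One integration by parts in x gains 1 / |xi_k| <= 2^(-k). The series of modes thus converges
    against test functions, with a bound by first derivatives. *)
Lemma int_mode_le k g M : CinftyC g -> (forall z, normc (dC xco g z) <= M) ->
  normc (int_torusC (fun z => mode k z * g z)) <= 2 * vol R (n + 1) * M * 2^-1 ^+ k.
Proof.
move=> cg hM; have cm := CinftyC_mode k; have cgx := CinftyC_dC xco cg.
have x0 : 0 < `|xi k| by exact: lt_le_trans ltr01 (xi_ge1 k).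
have M0 : 0 <= M by exact: le_trans (normc_ge0 _) (hM 0).
have P := intC_parts xco cm cg.
have E : int_torusC (fun z => dC xco (mode k) z * g z) =
    (0 +i* xi k) * int_torusC (fun z => mode k z * g z).
  rewrite xfreq_mode -intC_scale; last exact: CinftyC_mul.
  by congr int_torusC; apply/funext => z; rewrite mulrA.
rewrite E in P; have := congr1 (@normc R) P; rewrite normcM normc_i normcN => Q.
have B : normc (int_torusC (fun z => mode k z * dC xco g z)) <= 2 * (M * (2 * pi) ^+ (n + 1)).
  apply: normc_int_cst; first exact: CinftyC_mul.
  by move=> z; rewrite normcM normc_mode mul1r.
rewrite exprVn ler_pdivlMr ?exprn_gt0 // mulrC.
apply: (@le_trans _ _ (`|xi k| * normc (int_torusC (fun z => mode k z * g z)))).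
  by rewrite ler_wpM2r ?normc_ge0.
rewrite Q; apply: (le_trans B); rewrite -/(vol R (n + 1)).
by rewrite le_eqVlt; apply/orP; left; apply/eqP; ring.
Qed.

Definition psum K (g : T -> R[i]) : R[i] := \sum_(k < K) int_torusC (fun z => mode k z * g z).

Lemma psum_lin K c g h : CinftyC g -> CinftyC h ->
  psum K (fun z => c * g z + h z) = c * psum K g + psum K h.
Proof.
move=> cg ch; rewrite /psum mulr_sumr -big_split; apply: eq_bigr => k _ /=.
have cm := CinftyC_mode k.
have -> : (fun z => mode k z * (c * g z + h z)) =
  fun z => c * (mode k z * g z) + mode k z * h z by apply/funext => z; ring.
rewrite intC_add; [|exact/CinftyC_scale/CinftyC_mul|exact: CinftyC_mul].
by rewrite intC_scale //; exact: CinftyC_mul.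
Qed.

Lemma psum_cvg g : CinftyC g -> exists l, cvgC (psum ^~ g) l.
Proof.
move=> cg; have [M M0 hM] := CinftyC_bounded (CinftyC_dC xco cg).
apply: cvgC_exists => e e0.
pose D := 2 * vol R (n + 1) * M.
have D0 : 0 <= D by rewrite !mulr_ge0 // ltW // vol_gt0.
have D1 : 0 < 2 * D + 1 by rewrite ltr_wpDl // mulr_ge0.
have [K0 hK0] := half_pow_lt (divr_gt0 e0 D1).
exists K0 => K L hK hL.
wlog KL : K L hK hL / (K <= L)%N.
  move=> H; have [KL|/ltnW LK] := leqP K L; first exact: H.
  by rewrite -normcN opprB; exact: H.
rewrite -normcN opprB.
have H := geometric_tail D0 (fun k (_ : (0 <= k)%N) => int_mode_le k cg hM) (leq0n K) KL.
apply: (le_trans H).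
have h2 : 2^-1 ^+ K <= e / (2 * D + 1).
  apply: le_trans (ltW hK0); apply: ler_wiXn2l => //; rewrite ?invr_ge0 //.
  by rewrite invf_le1 // ler1n.
apply: (le_trans (ler_wpM2l _ h2)); first by rewrite mulr_ge0.
by rewrite mulrCA ler_piMr ?(ltW e0) // ler_pdivrMr // mul1r lerDl.
Qed.

Lemma singular_functional : exists u : functional R (n + 1),
  forall g, CinftyC g -> cvgC (psum ^~ g) (u g).
Proof.
suff /choice[u hu] : forall g : T -> R[i], exists l, CinftyC g -> cvgC (psum ^~ g) l by exists u.
(* Outside the test functions the value 0 is a default. *)
move=> g; have [cg|ng] := pselect (CinftyC g); last by exists 0.
by have [l hl] := psum_cvg cg; exists l.
Qed.

Lemma normc_dC_le_Cm (g : T -> R[i]) l z : CinftyC g -> normc (dC l g z) <= Cm_norm 1 g.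
Proof.
move=> cg; pose s : {bseq 1 of 'I_(n + 1)} := [bseq l].
have [M M0 hM] := CinftyC_bounded (CinftyC_dC l cg).
have h : normc (dC l g z) <= sup [set normc (partialsC s g w) | w in [set: T]].
  apply: ub_le_sup; first by exists M => _ [w _ <-]; rewrite -dCE.
  by exists z => //; rewrite -dCE.
apply: (le_trans h); rewrite /Cm_norm (bigD1 s) //= lerDl sumr_ge0 // => t _.
set S := [set _ | _ in _].
have [hS|hS] := pselect (has_sup S); last by rewrite sup_out.
apply: le_trans (normc_ge0 (partialsC t g 0)) _.
by apply: ub_le_sup; [case: hS|exists 0].
Qed.

Section Functional.
Variable u : functional R (n + 1).
Hypothesis hu : forall g, CinftyC g -> cvgC (psum ^~ g) (u g).

Lemma singular_distribution : is_distribution u.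
Proof.
split.
  move=> c g h cg ch; apply: cvgC_unique (hu _) _.
    by apply: CinftyC_add => //; exact: CinftyC_scale.
  have := cvgC_lin c (hu cg) (hu ch).
  by congr (cvgC _ _); apply/funext => K; rewrite psum_lin.
exists 1%N, (2 * (2 * vol R (n + 1))) => g cg.
apply: cvgC_le (hu cg) _ => K.
have C0 := Cm_norm_ge0 1 g; have v0 := ltW (vol_gt0 R (n + 1)).
have D0 : 0 <= 2 * vol R (n + 1) * Cm_norm 1 g by rewrite !mulr_ge0.
have hM z := normc_dC_le_Cm xco z cg.
have := geometric_tail D0 (fun k (_ : (0 <= k)%N) => int_mode_le k cg hM) (leq0n 0) (leq0n K).
by rewrite big_ord0 subr0 expr0 mulr1 mulrA.
Qed.

(** Against conj ([mode k]) the series gives at least [vol], for its k-th term is [vol] and the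
    others are nonnegative. A smooth density would give values of order 2^(-k). *)
Lemma singular_not_smooth : ~ is_smooth u.
Proof.
move=> [f cf hf].
have v0 := vol_gt0 R (n + 1).
have [M M0 hM] := CinftyC_bounded (CinftyC_dC xco cf).
have M1 : 0 < 2 * M + 1 by rewrite ltr_wpDl // mulr_ge0.
have [k hk] := half_pow_lt (divr_gt0 ltr01 M1).
have ck := CinftyC_conj (CinftyC_mode k).
have up : normc (u (fun z => conjc (mode k z))) < vol R (n + 1).
  rewrite hf //.
  have cfb := CinftyC_conj cf.
  have -> : (fun z => f z * conjc (mode k z)) = fun z => conjc (mode k z * conjc (f z)).
    by apply/funext => z; rewrite cJM conjcK mulrC.
  rewrite intC_conj ?normcJ; last exact: CinftyC_mul (CinftyC_mode k) cfb.
  have hMb z : normc (dC xco (fun z => conjc (f z)) z) <= M.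
    by rewrite (dC_conj xco cf) normcJ.
  apply: le_lt_trans (int_mode_le k cfb hMb) _.
  have -> : 2 * vol R (n + 1) * M * 2^-1 ^+ k = vol R (n + 1) * (2 * M * 2^-1 ^+ k) by ring.
  rewrite gtr_pMr //; apply: le_lt_trans (ler_wpM2l _ (ltW hk)) _; first by rewrite mulr_ge0.
  by rewrite mul1r ltr_pdivrMr // mul1r ltrDl.
have low : vol R (n + 1) <= complex.Re (u (fun z => conjc (mode k z))).
  apply: (cvgC_Re_ge (K0 := k.+1) (hu ck)) => K kK; rewrite /psum Re_sum.
  rewrite (bigD1 (Ordinal kK)) //= ler_wpDr //; last first.
    have -> : (fun z => mode k z * conjc (mode k z)) = fun=> 1.
      by apply/funext => z; rewrite mul_conjc normc_mode expr1n.
    by rewrite intC_cst mul1r.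
  apply: sumr_ge0 => l _.
  have cl := CinftyC_mul (CinftyC_mode l) ck.
  (* Different indices may share an x-frequency. The factors in A then cancel and a pure exponential
     is left, of integral [vol] or 0; otherwise the modes are orthogonal. *)
  have [e|ne] := eqVneq (ze l xco) (ze k xco).
    have -> : (fun z => mode l z * conjc (mode k z)) = em (ze l - ze k).
      apply/funext => z; rewrite !modeE e cJM -emN emD.
      have -> : conjc (expi (- xi k * A z)) = expi (xi k * A z).
        by rewrite -expiN mulNr opprK.
      have h1 : expi (- xi k * A z) * expi (xi k * A z) = 1.
        by rewrite -expiD mulNr addNr expi0.
      by rewrite mulrACA h1 mulr1.
    by rewrite int_em; case: eqP => //= _; exact: ltW.
  suff -> : int_torusC (fun z => mode l z * conjc (mode k z)) = 0 by [].
  have := intC_dC xco cl; rewrite (dC_mul xco (CinftyC_mode l) ck).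
  have -> : (fun z => dC xco (mode l) z * conjc (mode k z) +
      mode l z * dC xco (fun z => conjc (mode k z)) z) =
    fun z => (0 +i* (ze l xco - ze k xco)%:~R) * (mode l z * conjc (mode k z)).
    apply/funext => z; rewrite (xfreq_conj (CinftyC_mode k) (xfreq_mode k)) xfreq_mode.
    rewrite rmorphB /=; move: (mode l z) (conjc (mode k z)) => p q.
    by apply: complex_eq; rewrite !(cReD, cImD, cReM, cImM) /=; ring.
  rewrite intC_scale // => /eqP; rewrite mulf_eq0 => /orP[|/eqP//].
  by rewrite eq_complex /= eqxx intr_eq0 subr_eq0 (negbTE ne).
have := le_trans low (le_trans (ler_norm _) (normc_Re _)).
by rewrite leNgt up.
Qed.

(** The factor g makes the induction work, as each derivative brings down a derivative of A. The
    t-frequencies are of the size of xi_k, since they are close to -al_j xi_k. *)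
Lemma mode_partials_bound s : forall g : T -> R[i], CinftyC g -> exists2 C, 0 <= C &
  forall k z, normc (partialsC s (fun z => g z * mode k z) z) <= C * (1 + `|xi k|) ^+ size s.
Proof.
have [B B0 hB] : exists2 B, 0 <= B & forall l k, `|(ze k l)%:~R : R| <= B * (1 + `|xi k|).
  exists (1 + \sum_j `|al j|); first by rewrite addr_ge0 // sumr_ge0.
  move=> l k; have x1 := xi_ge1 k; have x0 : 0 <= 1 + `|xi k| by rewrite addr_ge0.
  case: (coP l) => [[j ->]|->]; last first.
    apply: (@le_trans _ _ (1 * (1 + `|xi k|))); first by rewrite mul1r lerDr.
    by rewrite ler_wpM2r // lerDl sumr_ge0.
  have -> : (ze k (tco j))%:~R = ((ze k (tco j))%:~R + al j * xi k) - al j * xi k :> R by ring.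
  apply: (le_trans (ler_normB _ _)); rewrite mulrDl; apply: lerD.
    apply: (le_trans (ze_close k j)); rewrite mul1r.
    apply: (@le_trans _ _ 1); last by rewrite lerDl.
    by rewrite invf_le1 ?exprn_gt0 ?exprn_ege1 // ?lerDl // ltr_pwDl.
  rewrite normrM; apply: ler_pM => //; last by rewrite lerDr.
  by rewrite (bigD1 j) //= lerDl sumr_ge0.
elim/last_ind: s => [|s l IH] g cg.
  have [M M0 hM] := CinftyC_bounded cg; exists M => // k z.
  by rewrite partialsC_nil normcM normc_mode !mulr1.
have cAl : CinftyC (fun z => (partial l A z)%:C) by exact: CinftyC_real (Cinfty_partials [:: l] cA).
have [C1 C10 h1] := IH _ (CinftyC_dC l cg).
have [C2 C20 h2] := IH _ cg.
have [C3 C30 h3] := IH _ (CinftyC_mul cg cAl).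
exists (C1 + B * C2 + C3); first by rewrite !addr_ge0 // mulr_ge0.
move=> k z; have cm := CinftyC_mode k; have x1 := xi_ge1 k.
set X := 1 + `|xi k|; have X1 : 1 <= X by rewrite lerDl.
have X0 : 0 <= X by exact: le_trans ler01 X1.
pose F1 z := dC l g z * mode k z; pose F2 z := g z * mode k z.
pose F3 z := g z * (partial l A z)%:C * mode k z.
have c1 : CinftyC F1 by exact: CinftyC_mul (CinftyC_dC l cg) cm.
have c2 : CinftyC F2 by exact: CinftyC_mul cg cm.
have c3 : CinftyC F3 by exact: CinftyC_mul (CinftyC_mul cg cAl) cm.
have E : dC l (fun z => g z * mode k z) =
  fun z => F1 z + ((0 +i* (ze k l)%:~R) * F2 z + (0 +i* - xi k) * F3 z).
  rewrite (dC_mul l cg cm); apply/funext => y; rewrite dC_mode /F1 /F2 /F3.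
  move: (dC l g y) (g y) (mode k y) (partial l A y) => p q r t.
  by apply: complex_eq; rewrite !(cReD, cImD, cReM, cImM) /=; ring.
have c23 := CinftyC_add (CinftyC_scale (0 +i* (ze k l)%:~R) c2) (CinftyC_scale (0 +i* - xi k) c3).
rewrite partialsC_rcons E (partialsC_add s c1 c23).
rewrite (partialsC_add s (CinftyC_scale _ c2) (CinftyC_scale _ c3)).
rewrite (partialsC_scale s _ c2) (partialsC_scale s _ c3) size_rcons.
have b1 := h1 k z; have b2 := h2 k z; have b3 := h3 k z.
rewrite -/F1 -/X in b1; rewrite -/F2 -/X in b2; rewrite -/F3 -/X in b3.
have Xs0 : 0 <= X ^+ size s by exact: exprn_ge0.
apply: (le_trans (normcD _ _)).
apply: (@le_trans _ _ (C1 * X ^+ (size s).+1 + (B * C2 * X ^+ (size s).+1 + C3 * X ^+ (size s).+1))); last first.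
  by rewrite -!mulrDl addrA.
rewrite exprS; apply: lerD.
  by apply: (le_trans b1); rewrite ler_wpM2l // ler_peMl.
apply: (le_trans (normcD _ _)); apply: lerD.
  rewrite normcM normc_i.
  have -> : B * C2 * (X * X ^+ size s) = (B * X) * (C2 * X ^+ size s) by ring.
  by apply: ler_pM (hB l k) b2; rewrite ?normc_ge0.
rewrite normcM normc_i normrN.
have -> : C3 * (X * X ^+ size s) = X * (C3 * X ^+ size s) by ring.
by apply: ler_pM b3; rewrite ?normc_ge0 ?lerDr.
Qed.

Lemma lam_ge0 k : 0 <= lam k.
Proof. by apply: sumr_ge0 => j _; exact: sqr_ge0. Qed.

Lemma lam_le k : lam k <= n%:R * ((1 + `|xi k|) ^- k) ^+ 2.
Proof.
have -> : n%:R * ((1 + `|xi k|) ^- k) ^+ 2 = \sum_(j < n) ((1 + `|xi k|) ^- k) ^+ 2.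
  by rewrite sumr_const card_ord mulr_natl.
apply: ler_sum => j _; have := ze_close k j; set x := _ + _ => h.
by rewrite -real_normK ?num_real //; apply: lerXn2r; rewrite ?nnegrE //.
Qed.

Definition image_approx K : T -> R[i] := fun z => \sum_(k < K) - (lam k)%:C * mode k z.

Lemma CinftyC_image_approx K : CinftyC (image_approx K).
Proof. by apply: CinftyC_sum => k; apply: CinftyC_scale; exact: CinftyC_mode. Qed.

(** For k >= |s| the eigenvalue, of order X^(-2k), beats the growth X^|s| of the derivatives, with X
    = 1 + |xi_k| >= 2; the terms are then O(2^(-k)). *)
Lemma image_smooth : exists2 F, CinftyC F & tends0 (fun K z => image_approx K z - F z).
Proof.
apply: smooth_limitC => [K|s e e0]; first exact: CinftyC_image_approx.
have [C C0 hC] := mode_partials_bound s (CinftyC_cst (n + 1) (1 : R[i])).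
pose D := n%:R * C; have D0 : 0 <= D by rewrite mulr_ge0.
have term z k : (size s <= k)%N ->
    normc (- (lam k)%:C * partialsC s (mode k) z) <= D * 2^-1 ^+ k.
  move=> sk; have := hC k z.
  have -> : (fun z => 1 * mode k z) = mode k by apply/funext => y; rewrite mul1r.
  set X := 1 + `|xi k| => h.
  have X2 : 2 <= X by have := xi_ge1 k; rewrite /X; lra.
  have X0 : 0 < X by exact: lt_le_trans X2.
  have X1 : 1 <= X by apply: le_trans X2; rewrite ler1n.
  rewrite normcM normcN normc_real ger0_norm ?lam_ge0 //.
  apply: (@le_trans _ _ (n%:R * (X ^- k) ^+ 2 * (C * X ^+ k))).
    apply: ler_pM; rewrite ?lam_ge0 ?normc_ge0 ?lam_le //.
    by apply: (le_trans h); rewrite ler_wpM2l // ler_weXn2l.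
  have -> : n%:R * (X ^- k) ^+ 2 * (C * X ^+ k) = D * X ^- k.
    by rewrite /D; field; rewrite expf_neq0 // gt_eqF.
  by rewrite ler_wpM2l // -exprVn; apply: lerXn2r; rewrite ?nnegrE ?invr_ge0 ?(ltW X0) // lef_pV2 ?posrE.
have D1 : 0 < 2 * D + 1 by rewrite ltr_wpDl // mulr_ge0.
have [K0 hK0] := half_pow_lt (divr_gt0 e0 D1).
(* The term bound only holds from index |s| on, so the tails start there at the earliest. *)
exists (maxn K0 (size s)) => K L hK hL z.
wlog KL : K L hK hL / (K <= L)%N.
  move=> H; have [KL|/ltnW LK] := leqP K L; first exact: H.
  by rewrite -normcN opprB; exact: H.
rewrite -normcN opprB.
have cm k : CinftyC (fun z => - (lam k)%:C * mode k z) by exact: CinftyC_scale (CinftyC_mode k).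
have P M : partialsC s (image_approx M) z = \sum_(k < M) - (lam k)%:C * partialsC s (mode k) z.
  rewrite /image_approx (partialsC_sum s _ (fun k : 'I_M => cm k)).
  by apply: eq_bigr => k _; rewrite (partialsC_scale s _ (CinftyC_mode k)).
rewrite !P; move: hK; rewrite geq_max => /andP[KK0 sK].
have H := geometric_tail D0 (term z) sK KL.
apply: (le_trans H).
have h2 : 2^-1 ^+ K <= e / (2 * D + 1).
  apply: le_trans (ltW hK0); apply: ler_wiXn2l => //; rewrite ?invr_ge0 //.
  by rewrite invf_le1 // ler1n.
apply: (le_trans (ler_wpM2l _ h2)); first by rewrite mulr_ge0.
by rewrite mulrCA ler_piMr ?(ltW e0) // ler_pdivrMr // mul1r lerDl.
Qed.

(** P is its own transpose and the modes are eigenfunctions, so the partial sums of u (P g) are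
    integrals of [image_approx] against g. *)
Lemma singular_image : exists2 F : T -> R[i], CinftyC F &
  forall g, CinftyC g -> u (sumX2 b g) = int_torusC (fun z => F z * g z).
Proof.
have [F cF hF] := image_smooth; exists F => // g cg.
have cS := CinftyC_sumX2 cb cg.
apply: cvgC_unique (hu cS) _ => e e0.
have cI K := CinftyC_image_approx K.
have [_ W] := wdist_int cg.
have [K0 h] := W _ (fun K => CinftyC_sub (cI K) cF) hF e e0.
exists K0 => K /h; congr (normc _ <= _).
have -> : (fun z => g z * (image_approx K z - F z)) =
  fun z => image_approx K z * g z - F z * g z by apply/funext => z; rewrite mulrC mulrBl.
rewrite (intC_sub (CinftyC_mul (cI K) cg) (CinftyC_mul cF cg)); congr (_ - _).
have -> : (fun z => image_approx K z * g z) =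
  fun z => \sum_(k < K) - (lam k)%:C * (mode k z * g z).
  by apply/funext => z; rewrite mulr_suml; apply: eq_bigr => k _; rewrite mulrA.
have cmg (k : 'I_K) : CinftyC (fun z => mode k z * g z) by exact: CinftyC_mul (CinftyC_mode k) cg.
rewrite intC_sum; last by move=> k; exact: CinftyC_scale (cmg k).
by apply: eq_bigr => k _; rewrite (intC_scale _ (cmg k)) -int_mode_sumX2.
Qed.

End Functional.
End Singular.

(** * Points of finite type *)

Section Directional.
Variables (R : realType) (n : nat).
Implicit Types (f g : 'rV[R]_n -> R) (t w : 'rV[R]_n).

Lemma MVT_line_eq f k t (h : R) : smooth f ->
  exists2 c, `|c| <= `|h| & f (t + h *: evec R k) - f t = h * partial k f (t + c *: evec R k).
Proof.
move=> sf.
have dl x : is_derive x (1 : R) (fun h : R => f (h *: evec R k + t))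
    (partial k f (x *: evec R k + t)).
  by apply: is_derive_line; case: (is_derive_smooth k (x *: evec R k + t) sf).
have cl a b : {within `[a, b], continuous (fun h : R => f (h *: evec R k + t))}.
  apply: continuous_subspaceT => x.
  apply: differentiable_continuous; apply/derivable1_diffP.
  by case: (dl x).
rewrite [t + _]addrC; have [h0|h0] := leP 0 h.
  have [c cI] := MVT_segment h0 (fun x _ => dl x) (cl 0 h).
  rewrite scale0r add0r subr0 => ->; move: cI; rewrite in_itv /= => /andP[c0 ch].
  by exists c; rewrite ?ger0_norm // mulrC [t + _]addrC.
have [c cI] := MVT_segment (ltW h0) (fun x _ => dl x) (cl h 0).
rewrite scale0r add0r sub0r => E; move: cI; rewrite in_itv /= => /andP[c0 ch].
exists c; first by rewrite !ler0_norm ?lerN2 // ltW.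
by rewrite [t + _]addrC -opprB E mulrN opprK mulrC.
Qed.

Lemma lipc_sum f L (s : seq 'I_n) t w (h : R) : 0 <= L ->
  (forall k z h, `|f (z + h *: evec R k) - f z| <= L * `|h|) ->
  `|f (t + \sum_(i <- s) (h * w 0 i) *: evec R i) - f t| <= L * (`|h| * \sum_(i <- s) `|w 0 i|).
Proof.
move=> L0 lf; elim: s => [|i s IH].
  by rewrite !big_nil addr0 subrr normr0 !mulr0.
rewrite !big_cons addrCA addrC; set y := t + _ in IH *.
rewrite -[f (y + _)](subrK (f y)) -addrA; apply: (le_trans (ler_normD _ _)).
by rewrite mulrDr mulrDr lerD // -normrM.
Qed.

(** Brackets differentiate along arbitrary vectors, while smoothness speaks of coordinate
    directions. Moving one coordinate at a time, the Lipschitz bounds on the partial derivatives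
    leave a remainder quadratic in h. *)
Lemma directional_derive g t w : Cinfty g ->
  is_derive t w g (\sum_j w 0 j * partial j g t).
Proof.
move=> cg; have [sg _] := cg.
have H j : exists L, 0 <= L /\ forall k z h,
    `|partial j g (z + h *: evec R k) - partial j g z| <= L * `|h|.
  have [L hL] := Cinfty_lipc (Cinfty_partials [:: j] cg).
  exists `|L|; split => // k z h; apply: (le_trans (hL k z h)).
  by rewrite ler_wpM2r // ler_norm.
have [L hL] := choice H.
have key (s : seq 'I_n) : exists2 C, 0 <= C & forall h : R,
    `|g (t + \sum_(i <- s) (h * w 0 i) *: evec R i) - g t - h * \sum_(i <- s) w 0 i * partial i g t|
      <= C * h ^+ 2.
  elim: s => [|j s [C C0 IH]].
    by exists 0 => // h; rewrite !big_nil addr0 mulr0 subrr subr0 normr0 mul0r.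
  have [Lj0 hLj] := hL j.
  pose S := \sum_(i <- s) `|w 0 i|.
  have S0 : 0 <= S by apply: sumr_ge0.
  exists (C + `|w 0 j| * (L j * `|w 0 j| + L j * S)).
    by rewrite !addr_ge0 ?mulr_ge0 // addr_ge0 // mulr_ge0.
  move=> h; rewrite !big_cons addrCA addrC.
  set y := t + _ in IH *.
  have [c hc E] := MVT_line_eq j y (h * w 0 j) sg.
  have IHh := IH h; rewrite -/y in IHh *.
  have -> : g (y + (h * w 0 j) *: evec R j) - g t -
      h * (w 0 j * partial j g t + \sum_(i <- s) w 0 i * partial i g t) =
    (g y - g t - h * \sum_(i <- s) w 0 i * partial i g t) +
    h * w 0 j * ((partial j g (y + c *: evec R j) - partial j g y) + (partial j g y - partial j g t)).
    have -> : g (y + (h * w 0 j) *: evec R j) = g y + h * w 0 j * partial j g (y + c *: evec R j).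
      by rewrite -E [RHS]addrC subrK.
    move: (partial j g (y + _)) (partial j g y) (partial j g t) (\sum_(i <- s) _) => p1 p2 p3 p4.
    by move: (g y) (g t) => p5 p6; ring.
  apply: (le_trans (ler_normD _ _)); rewrite mulrDl; apply: lerD => //.
  rewrite !normrM.
  have a1 := hLj j y c; have a2 := lipc_sum s t w h Lj0 hLj; rewrite -/y -/S in a2.
  have a3 : `|(partial j g (y + c *: evec R j) - partial j g y) + (partial j g y - partial j g t)|
      <= (L j * `|w 0 j| + L j * S) * `|h|.
    apply: (le_trans (ler_normD _ _)); rewrite mulrDl; apply: lerD.
      apply: (le_trans a1); rewrite -mulrA ler_wpM2l //.
      by apply: (le_trans hc); rewrite normrM mulrC.
    by apply: (le_trans a2); rewrite -mulrA ler_wpM2l // mulrC.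
  apply: (le_trans (ler_wpM2l _ a3)); first by rewrite mulr_ge0.
  rewrite -[h ^+ 2]real_normK ?num_real //.
  by rewrite le_eqVlt; apply/orP; left; apply/eqP; ring.
have [C C0 hC] := key (index_enum 'I_n).
have tE (h : R) : h *: w + t = t + \sum_i (h * w 0 i) *: evec R i.
  rewrite addrC; congr (_ + _); apply/rowP => j; rewrite summxE (bigD1 j) //= big1 => [|i ij].
    by rewrite !mxE !eqxx mulr1n mulr1 addr0.
  by rewrite !mxE eqxx eq_sym (negbTE ij) mulr0n mulr0.
apply/is_deriveP => e e0.
have C1 : 0 < C + 1 by rewrite ltr_wpDl.
exists (e / (C + 1)); first by rewrite divr_gt0.
move=> h hh; rewrite tE; apply: (le_trans (hC h)).
rewrite -[h ^+ 2]real_normK ?num_real // expr2 mulrA ler_wpM2r //.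
move: hh; rewrite ltr_pdivlMr // => hh; apply: le_trans (ltW hh).
by rewrite mulrDr mulr1 mulrC lerDl.
Qed.

End Directional.

(** * The Lie algebra generated by the fields *)

Section FiniteType.
Variables (R : realType) (n : nat).
Variable a : 'I_n -> 'rV[R]_n -> R.
Hypothesis ca : forall j, Cinfty (a j).
Local Notation T := 'rV[R]_(n + 1).

Lemma curv_la j k z : curv (la a) j k z =
  partial j (a k) (lsubmx z) - partial k (a j) (lsubmx z).
Proof.
by rewrite /curv /la !partial_lift_t //; [case: (ca j)|case: (ca k)].
Qed.

Lemma is_derive_xfield (c0 : T) (g : 'rV[R]_n -> R) z v d :
  is_derive (lsubmx z) (lsubmx v) g d ->
  is_derive z v (fun y : T => c0 + g (lsubmx y) *: evec R xco) (d *: evec R xco).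
Proof.
move=> /is_deriveP H; apply/is_deriveP => e e0.
pose c := `|evec R (@xco n)| + 1; have c1 : 0 < c by rewrite ltr_wpDl.
have [r r0 hr] := H _ (divr_gt0 e0 c1); exists r => // h hh.
have -> : lsubmx (h *: v + z) = h *: lsubmx v + lsubmx z by rewrite linearP.
have -> : c0 + g (h *: lsubmx v + lsubmx z) *: evec R xco - (c0 + g (lsubmx z) *: evec R xco)
    - h *: (d *: evec R xco) =
  (g (h *: lsubmx v + lsubmx z) - g (lsubmx z) - h * d) *: evec R (@xco n).
  by rewrite opprD addrACA subrr add0r scalerA -!scalerBl.
rewrite normrZ; have := hr h hh; rewrite -[h *: d]/(h * d) => hb.
apply: (le_trans (ler_wpM2r (normr_ge0 _) hb)).
rewrite mulrAC ler_wpM2r // mulrAC ler_pdivrMr // ler_wpM2l ?(ltW e0) //.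
by rewrite lerDl.
Qed.

Definition comb (c : 'I_n -> R) : vfield R (n + 1) := fun z => \sum_j c j *: Xfield a j z.

Lemma combE c z : comb c z = (\sum_j c j *: evec R (tco j)) + (\sum_j c j * a j (lsubmx z)) *: evec R xco.
Proof.
rewrite /comb scaler_suml -big_split; apply: eq_bigr => j _ /=.
by rewrite scalerDr scalerA.
Qed.

Lemma lsubmx_comb c z : lsubmx (comb c z) = \row_j c j.
Proof.
rewrite combE; apply/rowP => i; rewrite !mxE summxE (bigD1 i) //= big1 => [|j ji].
  by rewrite !mxE !eqxx /= /xco eq_lrshift mulr0n mulr1n mulr0 !addr0 mulr1.
by rewrite !mxE !eqxx /= eq_lshift eq_sym (negbTE ji) mulr0n mulr0.
Qed.

Lemma comb_xco c z : comb c z 0 xco = \sum_j c j * a j (lsubmx z).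
Proof.
rewrite combE !mxE summxE big1 => [|j _].
  by rewrite !eqxx mulr1n mulr1 add0r.
by rewrite !mxE /= /xco eq_rlshift ?andbF mulr0n mulr0.
Qed.

(** The t-components of a constant combination are constant, so only its x-component is
    differentiated. *)
Lemma derive_comb c d z :
  'D_(comb c z) (comb d) z = (\sum_j c j * \sum_k d k * partial j (a k) (lsubmx z)) *: evec R xco.
Proof.
pose g := fun t => \sum_k d k * a k t.
have cg : Cinfty g.
  by apply: Cinfty_sum => k; apply: CinftyM => //; exact: Cinfty_cst.
have -> : comb d = fun y => (\sum_j d j *: evec R (tco j)) + g (lsubmx y) *: evec R xco.
  by apply/funext => y; exact: combE.
have dg := directional_derive (lsubmx z) (lsubmx (comb c z)) cg.
have [_ ->] := is_derive_xfield (\sum_j d j *: evec R (tco j)) dg.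
congr (_ *: _); apply: eq_bigr => j _; rewrite lsubmx_comb mxE; congr (_ * _).
have : forall s : seq 'I_n, partial j (fun t => \sum_(k <- s) d k * a k t) (lsubmx z) =
    \sum_(k <- s) d k * partial j (a k) (lsubmx z).
  elim=> [|k s IH].
    have -> : (fun t : 'rV[R]_n => \sum_(k <- [::]) d k * a k t) = fun=> 0.
      by apply/funext => t; rewrite big_nil.
    by rewrite partial_cst big_nil.
  have -> : (fun t : 'rV[R]_n => \sum_(k <- k :: s) d k * a k t) =
      fun t => d k * a k t + \sum_(k <- s) d k * a k t.
    by apply/funext => t; rewrite big_cons.
  have sk : smooth (a k) by case: (ca k).
  have [ss _] : Cinfty (fun t => \sum_(k <- s) d k * a k t).
    by apply: Cinfty_sum => i; apply: CinftyM => //; exact: Cinfty_cst.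
  by rewrite partialD ?partialZ ?IH ?big_cons //; exact: smoothZ.
exact.
Qed.

Lemma Xfield_comb j : Xfield a j = comb (fun i => (i == j)%:R).
Proof.
apply/funext => z; rewrite /comb (bigD1 j) //= eqxx scale1r big1 ?addr0 // => i ij.
by rewrite (negbTE ij) scale0r.
Qed.

Lemma bracket_comb c d z : bracket (comb c) (comb d) z =
  (\sum_j \sum_k c j * d k * (partial j (a k) (lsubmx z) - partial k (a j) (lsubmx z))) *: evec R xco.
Proof.
rewrite /bracket !derive_comb -scalerBl; congr (_ *: _).
under eq_bigr do rewrite mulr_sumr.
under [X in _ - X]eq_bigr do rewrite mulr_sumr.
rewrite [X in _ - X]exchange_big -sumrB; apply: eq_bigr => j _.
by rewrite -sumrB; apply: eq_bigr => k _; ring.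
Qed.

Lemma closed_lie_generated V : (forall j k t, partial j (a k) t = partial k (a j) t) ->
  lie_generated (Xfield a) V -> exists c, V = comb c.
Proof.
move=> cl; elim=> {V} [j|c V W _ [d ->] _ [e ->]|V W _ [d ->] _ [e ->]].
- by exists (fun i => (i == j)%:R); exact: Xfield_comb.
- exists (fun i => c * d i + e i); apply/funext => z.
  rewrite /comb scaler_sumr -big_split; apply: eq_bigr => j _ /=.
  by rewrite scalerDl scalerA.
- exists (fun=> 0); apply/funext => z; rewrite bracket_comb.
  rewrite big1 ?scale0r => [|j _]; last by rewrite big1 // => k _; rewrite cl subrr mulr0.
  by rewrite /comb big1 // => j _; rewrite scale0r.
Qed.

(** A constant combination equal to d_x at a point has zero t-components there; these are its
    coefficients, so it vanishes, a contradiction. *)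
Lemma closed_not_finite_type t : (forall j k t, partial j (a k) t = partial k (a j) t) ->
  ~ finite_type a t.
Proof.
move=> cl /(_ 0 (evec R xco)) [V gV hV].
have [c VE] := closed_lie_generated cl gV; move: hV; rewrite VE.
set z := row_mx _ _ => hV.
have c0 j : c j = 0.
  have := congr1 (fun w : T => lsubmx w 0 j) hV; rewrite lsubmx_comb !mxE => ->.
  by rewrite /xco eq_lrshift andbF.
have := congr1 (fun w : T => w 0 xco) hV; rewrite comb_xco big1 => [|j _]; last by rewrite c0 mul0r.
by rewrite !mxE !eqxx => /esym/eqP; rewrite oner_eq0.
Qed.

(** A combination of the X_j realises the t-components of v, and a multiple of one bracket corrects
    the x-component. *)
Lemma curved_finite_type t j k : partial j (a k) t != partial k (a j) t -> finite_type a t.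
Proof.
move=> jk x v; set z := row_mx t x%:M.
have zt : lsubmx z = t by exact: row_mxKl.
have gcomb c : exists2 V, lie_generated (Xfield a) V & forall w, V w = comb c w.
  have : forall s : seq 'I_n, exists2 V, lie_generated (Xfield a) V &
      forall w, V w = \sum_(i <- s) c i *: Xfield a i w.
    elim=> [|i s [V gV hV]].
      (* The zero field is generated as -X_j + X_j. *)
      exists (fun w => -1 *: Xfield a j w + Xfield a j w).
        by apply: lie_lin; exact: lie_gen.
      by move=> w; rewrite big_nil scaleN1r addNr.
    exists (fun w => c i *: Xfield a i w + V w); first by apply: lie_lin => //; exact: lie_gen.
    by move=> w; rewrite big_cons hV.
  exact.
pose be := partial j (a k) t - partial k (a j) t.
have be0 : be != 0 by rewrite subr_eq0.
have Bz : bracket (Xfield a j) (Xfield a k) z = be *: evec R xco.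
  rewrite !Xfield_comb bracket_comb zt; congr (_ *: _).
  rewrite (bigD1 j) //= (bigD1 k) //= !eqxx !mul1r big1 => [|i ik].
    rewrite addr0 big1 ?addr0 // => i ij; rewrite big1 // => l _.
    by rewrite (negbTE ij) !mul0r.
  by rewrite (negbTE ik) mulr0 mul0r.
have [V gV hV] := gcomb (fun i => v 0 (tco i)).
pose c := (v 0 xco - \sum_i v 0 (tco i) * a i t) / be.
exists (fun w => c *: bracket (Xfield a j) (Xfield a k) w + V w).
  by apply: lie_lin => //; apply: lie_bracket; exact: lie_gen.
rewrite Bz scalerA divfK // hV; apply/rowP => l; rewrite mxE.
case: (coP l) => [[i ->]|->].
  have -> : comb (fun i => v 0 (tco i)) z 0 (tco i) = lsubmx (comb (fun i => v 0 (tco i)) z) 0 i.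
    by rewrite mxE.
  by rewrite lsubmx_comb !mxE /= /xco eq_lrshift mulr0n mulr0 add0r.
by rewrite comb_xco zt !mxE !eqxx mulr1n mulr1 subrK.
Qed.

(** Integrating d_j A = a_j - al over the circle in t_j gives 0 on the left. *)
Lemma average_mean (A : T -> R) (al : R) j t : Cinfty A ->
  partial (tco j) A = (fun z => la a j z - al) -> average j (a j) t = al.
Proof.
move=> cA dA; have := int_coord_partial (tco j) (row_mx t 0) cA; rewrite dA.
have cl : Cinfty (la a j) by exact: Cinfty_lift_t.
have -> : (fun z => la a j z - al) = fun z => 1 * la a j z + - al.
  by apply/funext => z; rewrite mul1r.
rewrite int_coord_lin; [|exact: Cinfty_lipc|exact: lipc_cst].
rewrite int_coord_cst mul1r => /eqP; rewrite mulNr subr_eq0 => /eqP h.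
have E : int_coord (tco j) (la a j) (row_mx t 0) = int_coord j (a j) t.
  rewrite /int_coord; apply: eq_Rintegral => x _; rewrite /la /lift_t; congr (a j _).
  apply/rowP => i; rewrite [LHS]mxE [LHS]mxE [RHS]mxE /tco (inj_eq (@lshift_inj _ _)).
  by case: eqP => // _; rewrite row_mxEl.
by rewrite /average -E h mulrC mulfK // gt_eqF // pi2_gt0.
Qed.

End FiniteType.

(** * The characterization *)

Section Approximation.
Variables (R : realType) (n : nat).
Local Notation T := 'rV[R]_(n + 1).

(* Multiplying a good approximation by 2 ^ k forces the frequencies to tend to
   infinity while spoiling the error only by a power of 2 ^ k. *)
Lemma approximable_frequencies (al : 'I_n -> R) : ~ not_simultaneously_approximable al ->
  forall k, exists ze : {ffun 'I_(n + 1) -> int},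
    2 ^+ k <= `|(ze xco)%:~R : R| /\
    forall j, `|(ze (tco j))%:~R + al j * (ze xco)%:~R| <= (1 + `|(ze xco)%:~R|) ^- k.
Proof.
move=> H k; pose M : R := 2 ^+ k; pose Mz : int := 2 ^+ k.
have MzE : Mz%:~R = M by rewrite /Mz rmorphXn.
have M0 : 0 < M by rewrite exprn_gt0.
have M1 : 1 <= M by rewrite exprn_ege1 // ler1n.
(* The exponent k + 1 is positive even for k = 0. The constant M^(-k-1) pays for the factor M and
   for 1 + M x <= M (1 + x) raised to the power k. *)
have [eta [xi [xi0 hb]]] : exists eta : 'I_n -> int, exists xi : int, xi != 0 /\
    \big[Num.max/0]_(j < n) `|(eta j)%:~R + al j * xi%:~R| <
    (M ^+ k.+1)^-1 * (1 + `|xi%:~R|) `^ (- k.+1%:R).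
  apply: contrapT => h; apply: H; exists (M ^+ k.+1)^-1, k.+1%:R; split.
  - by rewrite invr_gt0 exprn_gt0.
  - by rewrite ltr0n.
  - move=> eta xi xi0; rewrite leNgt; apply/negP => h2; apply: h.
    by exists eta, xi.
have x0 : 0 <= `|xi%:~R : R| by [].
pose F : {ffun 'I_(n + 1) -> int} :=
  [ffun i => match fintype.split i with inl j => Mz * eta j | inr _ => Mz * xi end].
exists F.
have Fx : F xco = Mz * xi.
  by rewrite ffunE -[xco]/(unsplit (inr ord0)) unsplitK.
have x1 : 1 <= `|xi%:~R : R|.
  by rewrite -intr_norm -[1]/(1%:~R) ler_int -gtz0_ge1 normr_gt0.
rewrite Fx intrM MzE normrM (gtr0_norm M0).
split; first by rewrite -[leLHS]mulr1 ler_wpM2l // ltW.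
move=> j; have -> : F (tco j) = Mz * eta j.
  by rewrite ffunE -[tco j]/(unsplit (inl j)) unsplitK.
have -> : (Mz * eta j)%:~R + al j * (M * xi%:~R) = M * ((eta j)%:~R + al j * xi%:~R).
  by rewrite intrM MzE; ring.
rewrite normrM (gtr0_norm M0).
have hj : `|(eta j)%:~R + al j * xi%:~R| <= (M ^+ k.+1)^-1 * (1 + `|xi%:~R|) ^- k.+1.
  rewrite -[(1 + _) ^+ _]powR_mulrn ?addr_ge0 // -powRN; apply: le_trans (ltW hb).
  exact: (le_bigmax _ (fun j => `|(eta j)%:~R + al j * xi%:~R|) j).
apply: (le_trans (ler_wpM2l (ltW M0) hj)).
move: (`|xi%:~R : R|) x0 x1 => x x0 x1.
have y0 : 0 < 1 + x by rewrite ltr_wpDr.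
have z0 : 0 < 1 + M * x by rewrite ltr_wpDr // mulr_ge0 // ltW.
have -> : M * ((M ^+ k.+1)^-1 * (1 + x) ^- k.+1) = (M * (1 + x)) ^- k * (1 + x)^-1.
  by rewrite !exprS !exprMn; field; rewrite !expf_neq0 ?gt_eqF.
have le1 : (1 + x)^-1 <= 1 by rewrite invf_le1 // lerDl.
have pk : 0 < M * (1 + x) by rewrite mulr_gt0.
apply: (@le_trans _ _ ((M * (1 + x)) ^- k)).
  by rewrite -[leRHS]mulr1 ler_wpM2l // invr_ge0 exprn_ge0 // ltW.
rewrite lef_pV2 ?posrE ?exprn_gt0 //; apply: lerXn2r; rewrite ?nnegrE ?(ltW z0) ?(ltW pk) //.
by rewrite mulrDr mulr1 lerD2r.
Qed.

Lemma nonapproximable_estimate (b : 'I_n -> T -> R) (A : T -> R) :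
  Cinfty A -> partial xco A = (fun=> 0) ->
  (forall j, partial (tco j) A = fun z => b j z - mean b j) ->
  not_simultaneously_approximable (mean b) ->
  exists C p, 0 <= C /\ forall (m : int) (V : T -> R[i]), m != 0 -> CinftyC V ->
    xfreq m%:~R V -> sqn V <= C * (1 + `|m%:~R : R|) ^+ p * energy b V.
Proof.
move=> cA Ax At [C [rho [C0 rho0 hC]]].
(* A natural number above rho, so that the loss is an integral power; it is doubled because the
   estimate involves the square of [de]. *)
pose q := Num.bound rho.
have hq : rho < q%:R by apply: archi_boundP; exact: ltW.
exists (C ^- 2), (q * 2)%N; split; first by rewrite invr_ge0 exprn_ge0 // ltW.
move=> m V m0 cV xV; set y := 1 + `|m%:~R : R|.
have y1 : 1 <= y by rewrite lerDl.
have y0 : 0 < y by apply: lt_le_trans y1.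
have yq : 0 < y ^+ q by rewrite exprn_gt0.
pose de := C * (y ^+ q)^-1.
have de0 : 0 < de by rewrite mulr_gt0 // invr_gt0.
have hde (eta : 'I_n -> int) : exists j, de <= `|(eta j)%:~R + mean b j * m%:~R|.
  apply: contrapT => h.
  have lt : \big[Num.max/0]_(j < n) `|(eta j)%:~R + mean b j * m%:~R| < de.
    apply: bigmax_lt => // j _; rewrite ltNge; apply/negP => hj; apply: h; by exists j.
  have := le_lt_trans (hC eta m m0) lt; rewrite ltNge => /negP; apply.
  rewrite ler_wpM2l ?(ltW C0) // -/y -[y ^+ _]powR_mulrn ?(ltW y0) // -powRN.
  by apply: ler_powR => //; rewrite lerN2 ltW.
have := closed_estimate cA Ax At de0 hde cV xV.
have -> : de ^+ 2 = C ^+ 2 * (y ^+ (q * 2)) ^-1 by rewrite /de exprMn exprVn exprM.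
have d0 : 0 < C ^+ 2 * (y ^+ (q * 2))^-1 by rewrite mulr_gt0 ?invr_gt0 ?exprn_gt0.
move=> h; have -> : C ^- 2 * y ^+ (q * 2) * energy b V = energy b V / (C ^+ 2 * (y ^+ (q * 2))^-1).
  by rewrite [(_ / _)^-1]invfM invrK mulrC.
by rewrite ler_pdivlMr // mulrC.
Qed.

End Approximation.

(** * Conclusions for the sum of squares *)

Section Hypoelliptic.
Variables (R : realType) (n : nat).
Local Notation T := 'rV[R]_(n + 1).
Variable a : 'I_n -> 'rV[R]_n -> R.
Hypothesis ca : forall j, Cinfty (a j).

Lemma partial_la j : partial xco (la a j) = fun=> 0.
Proof. by apply/funext => z; rewrite /la partial_lift_t_xco. Qed.

Lemma estimate_hypoelliptic (C : R) p : 0 <= C ->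
  (forall (m : int) (V : T -> R[i]), m != 0 -> CinftyC V -> xfreq m%:~R V ->
    sqn V <= C * (1 + `|m%:~R : R|) ^+ p * energy (la a) V) ->
  globally_hypoelliptic (sum_squares a).
Proof.
move=> C0 est u du [f cf hf].
apply: (distribution_smooth (Cinfty_la ca) partial_la C0 est du cf) => phi cp.
by rewrite -hf // sum_squaresE //; case: du.
Qed.

Lemma curved_hypoelliptic j k t : partial j (a k) t != partial k (a j) t ->
  globally_hypoelliptic (sum_squares a).
Proof.
move=> jk.
have c0 : curv (la a) j k (row_mx t 0) != 0 by rewrite curv_la // row_mxKl subr_eq0.
have [C C0 hC] := nonclosed_estimate (Cinfty_la ca) partial_la c0.
apply: (@estimate_hypoelliptic C 0 C0) => m V m0 cV xV.
rewrite expr0 mulr1; apply: hC xV => //.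
by rewrite -intr_norm -[1]/(1%:~R) ler_int -gtz0_ge1 normr_gt0.
Qed.

Lemma approximable_not_hypoelliptic (A : T -> R) :
  Cinfty A -> partial xco A = (fun=> 0) ->
  (forall j, partial (tco j) A = fun z => la a j z - mean (la a) j) ->
  ~ not_simultaneously_approximable (mean (la a)) ->
  ~ globally_hypoelliptic (sum_squares a).
Proof.
move=> cA Ax At nsa gh.
have [ze hze] := choice (approximable_frequencies nsa).
have xl k : 2 ^+ k <= `|(ze k xco)%:~R : R| by case: (hze k).
have zc k j : `|(ze k (tco j))%:~R + mean (la a) j * (ze k xco)%:~R| <=
    (1 + `|(ze k xco)%:~R|) ^- k by case: (hze k).
have cl := Cinfty_la ca.
have [u hu] := singular_functional cA Ax xl.
have du := singular_distribution cA Ax xl hu.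
apply: (singular_not_smooth cA Ax xl hu); apply: (gh _ du).
have [F cF hF] := singular_image cl partial_la cA Ax At xl zc hu.
by exists F => // phi cp; rewrite sum_squaresE ?hF //; case: du.
Qed.

End Hypoelliptic.

Theorem theorem1p3 (R : realType) (n : nat) (n_gt0 : (0 < n)%N)
    (a : 'I_n -> 'rV[R]_n -> R) (a_smooth : forall j : 'I_n, Cinfty (a j)) :
  globally_hypoelliptic (sum_squares a) <->
  ((exists t : 'rV[R]_n, finite_type a t) \/
   (exists alpha : 'I_n -> R,
      (forall j : 'I_n, exists t : 'rV[R]_n, average j (a j) t = alpha j) /\
      not_simultaneously_approximable alpha)).
Proof.
have [[j [k [t jk]]]|cl] := pselect (exists j k t, partial j (a k) t != partial k (a j) t).
  (* With a nonzero c_jk both sides of the equivalence hold. *)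
  split=> _; last exact: curved_hypoelliptic jk.
  by left; exists t; exact: curved_finite_type jk.
have {}cl j k t : partial j (a k) t = partial k (a j) t.
  by apply/eqP; apply: contrapT => /negP h; apply: cl; exists j, k, t.
have cb := Cinfty_la a_smooth; have bx0 := partial_la a.
have [|A [cA Ax At]] := potential cb bx0.
  by move=> j k z; rewrite curv_la // cl subrr.
have av j t : average j (a j) t = mean (la a) j := average_mean a_smooth t cA (At j).
split=> [gh|].
  right; exists (mean (la a)); split; first by move=> j; exists 0.
  by apply: contrapT => h; exact: approximable_not_hypoelliptic At h gh.
case=> [[t /closed_not_finite_type]|[al [hal nsa]]]; first by move/(_ a_smooth cl).
(* Each range is a single point, so alpha is forced. *)
have E : al = mean (la a) by apply/funext => j; have [t <-] := hal j.
rewrite E in nsa.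
have [C [p [C0 est]]] := nonapproximable_estimate cA Ax At nsa.
exact: estimate_hypoelliptic C0 est.
Qed.
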